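(* Let $g$ be an analytic function on $\mathbb{D}$ and let $1\le p<\infty$. Then the following statements are equivalent: (i) $\mathcal{H}_g:H^1\to H^p$ is bounded; (ii) $\mathcal{H}_g:H^1\to H^p$ is compact; (iii) $g'\in H^p$. Moreover, $\mathcal{H}_g:H^1\to H^\infty$ is bounded if and only if $g'\in H^\infty$, and compact if and only if $g'\in\mathcal{A}$. Furthermore, for $1\le p\le\infty$, $$2\|g'\|_{H^p}\le\|\mathcal{H}_g\|_{H^1\to H^p}\le\pi\|g'\|_{H^p}.$$
   Context: $\mathbb{D}$ is the open unit disc in $\mathbb{C}$. For $f$ analytic on $\mathbb{D}$, $0<p<\infty$ and $0<r<1$, put $M_p(r,f)=\left(\frac1{2\pi}\int_0^{2\pi}|f(re^{i\theta})|^p\,d\theta\right)^{1/p}$ and $M_\infty(r,f)=\max_{|z|=r}|f(z)|$. The Hardy space $H^p$ ($0<p\le\infty$) consists of the analytic $f$ on $\mathbb{D}$ with $\|f\|_{H^p}=\sup_{0<r<1}M_p(r,f)<\infty$. $\mathcal{A}=H^\infty\cap C(\overline{\mathbb{D}})$ is the disc algebra, that is, the closure of the analytic polynomials in $H^\infty$. For $g$ analytic on $\mathbb{D}$, the generalized Hilbert operator is $$\mathcal{H}_g(f)(z)=\int_0^1 f(t)g'(tz)\,dt,\qquad z\in\mathbb{D},\ f\in H^1;$$ the integral converges absolutely for $f\in H^1$ (by the Fejér–Riesz inequality) and defines an analytic function on $\mathbb{D}$. $\mathcal{H}_g:H^1\to H^p$ is bounded if there is a constant $C$ with $\|\mathcal{H}_g(f)\|_{H^p}\le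 C\|f\|_{H^1}$ for all $f\in H^1$; $\|\mathcal{H}_g\|_{H^1\to H^p}$ is the smallest such $C$ (and $\infty$ if there is none). Likewise $\|g'\|_{H^p}=\infty$ when $g'\notin H^p$. *)

(* Defs.v *)
From Stdlib Require Import Reals.
From Coquelicot Require Import Coquelicot.

Open Scope R_scope.

(* Functions on the disc are represented by total functions [C -> C]; every
   notion below depends only on the values at points of the open unit disc. *)

Definition analytic_on_disc (f : C -> C) : Prop :=
  forall z : C, Cmod z < 1 -> @ex_derive C_AbsRing C_NormedModule f z.

(* [Rpower 0 p] is 1 because [ln 0] is 0; here 0 ^ p = 0, as needed for p > 0. *)
Definition rpow (x p : R) : R :=
  if Rle_dec x 0 then 0 else Rpower x p.

Definition circle_pt (r theta : R) : C := (r * cos theta, r * sin theta).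

(* Exponents live in (0, +oo]; the value at [m_infty] is irrelevant. *)
Definition integral_mean (p : Rbar) (r : R) (f : C -> C) : Rbar :=
  match p with
  | Finite q =>
      Finite (rpow (/ (2 * PI) *
                    RInt (fun theta => rpow (Cmod (f (circle_pt r theta))) q)
                      0 (2 * PI))
                (/ q))
  | p_infty => Lub_Rbar (fun y => exists z : C, Cmod z = r /\ y = Cmod (f z))
  | m_infty => Finite 0
  end.

Definition Hardy_norm (p : Rbar) (f : C -> C) : Rbar :=
  Rbar_lub (fun m => exists r : R, 0 < r < 1 /\ m = integral_mean p r f).

Definition Hardy (p : Rbar) (f : C -> C) : Prop :=
  analytic_on_disc f /\ Rbar_lt (Hardy_norm p f) p_infty.

Definition disc_algebra (f : C -> C) : Prop :=
  Hardy p_infty f /\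
  exists F : C -> C,
    continuous_on (fun z : C => Cmod z <= 1) F /\
    forall z : C, Cmod z < 1 -> F z = f z.

(* The integral over [0, 1) is the limit of the integrals over [0, s] as s
   tends to 1 from below: f need not be bounded, or defined, near 1.  Since the
   integrand is continuous on [0, 1) and absolutely integrable for f in H^1,
   this is also its Lebesgue integral. *)
Definition hilbert_op (g f : C -> C) (z : C) : C :=
  @RInt_gen C_R_CompleteNormedModule
    (fun t : R => (f (RtoC t) * C_derive g (RtoC t * z))%C)
    (at_point 0) (at_left 1).

Definition H1_bound (p : Rbar) (T : (C -> C) -> C -> C) (K : R) : Prop :=
  forall f : C -> C, Hardy (Finite 1) f ->
    Rbar_le (Hardy_norm p (T f)) (Rbar_mult (Finite K) (Hardy_norm (Finite 1) f)).

Definition H1_bounded (p : Rbar) (T : (C -> C) -> C -> C) : Prop :=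
  exists K : R, H1_bound p T K.

(* The infimum of the empty set is [p_infty]. *)
Definition H1_op_norm (p : Rbar) (T : (C -> C) -> C -> C) : Rbar :=
  Glb_Rbar (H1_bound p T).

Definition H1_compact (p : Rbar) (T : (C -> C) -> C -> C) : Prop :=
  (forall f : C -> C, Hardy (Finite 1) f -> Hardy p (T f)) /\
  forall (f : nat -> C -> C) (K : R),
    (forall n, Hardy (Finite 1) (f n) /\
               Rbar_le (Hardy_norm (Finite 1) (f n)) (Finite K)) ->
    exists (phi : nat -> nat) (h : C -> C),
      (forall n, (phi n < phi (S n))%nat) /\
      Hardy p h /\
      forall eps : R, 0 < eps ->
        exists N : nat, forall n : nat, (N <= n)%nat ->
          Rbar_lt (Hardy_norm p (fun z => (T (f (phi n)) z - h z)%C))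
                  (Finite eps).

(* Main.v *)
Require Import Defs.
From Stdlib Require Import Reals Lra Lia Psatz Classical ClassicalEpsilon.
From Coquelicot Require Import Coquelicot.

(** Upper bound: by Minkowski's inequality [M_p(r, H_g f)] is at most the supremum of the means of
    [g'] times the integral of [|f|] over [0,1], which is at most [PI ||f||] by Fejer-Riesz. On a
    circle [f = G K] with [G = exp (W / 2)] zero-free and [|G|^2], [|K|^2] both close to [|f|], so
    Fejer-Riesz reduces to squares, where it is Cauchy's theorem on a half disc.

    Lower bound: [f_a(z) = (1 - a^2) / (1 - a z)^2] has norm 1 and its mass on [0,1] tends to 2 and
    concentrates at 1 as [a] tends to 1, so [H_g f_a] tends to [2 g'].

    Compactness: when [g'] is a limit of polynomials in [H^p], [H_g] is a limit of finite rank
    operators. For [p] finite polynomials are dense: the same factorization, now with factors in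
    [H^(2p)], reduces the convergence of the dilates of [g'] to uniform convexity with exponent at
    least 2 (Clarkson). Conversely, compactness forces [H_g f_a] to tend to [2 g'] in norm along a
    sequence, and for [p] infinite every [H_g f_a] is uniformly continuous on the disc. *)

(** * Complex-valued continuity and integrals *)

(** All integrals are Riemann integrals, so nothing is taken on the unit circle itself: means live
    on circles of radius r < 1, functions are analytic across the circle on which they are
    integrated, and an integral over [0, 1) is a limit of integrals over [0, s]. Hence the factors G
    and K are only approximate and are rebuilt for each r, and whatever is drawn from them has to be
    uniform in r.

    Origin of the constants: Fejer-Riesz bounds the integral of |f| over a whole diameter by half of
    its integral over the circle, that is by PI times the mean; the mass of f_a on [0, 1] is exactly
    1 + a.

    Origin of the exponent: H^1 is not uniformly convex, and the simple form of Clarkson's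
    inequality wants an exponent at least 2. Factors in H^(2p) meet this for every p >= 1.

    In the compactness argument a bounded sequence of H^1 is thinned out until its moments, the
    integrals of f(t) t^j over [0, 1], converge for every j; these moments are all that an operator
    with polynomial kernel sees of f. *)

Definition ccont {U : UniformSpace} (u : U -> C) (x : U) : Prop :=
  @continuous U C_UniformSpace u x.

Lemma ccont_pair {U : UniformSpace} (u : U -> C) (x : U) :
  continuous (fun y => fst (u y)) x -> continuous (fun y => snd (u y)) x -> ccont u x.
Proof.
  intros H1 H2. unfold ccont, continuous.
  apply filterlim_ext with (fun y => (fst (u y), snd (u y))).
  { intros y; now destruct (u y). }
  intros P HP. destruct HP as [eps HP].
  specialize (H1 _ (locally_ball (fst (u x)) eps)).
  specialize (H2 _ (locally_ball (snd (u x)) eps)).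
  unfold filtermap in *.
  generalize (filter_and _ _ H1 H2). apply filter_imp.
  intros y [Ha Hb]. apply HP. split; assumption.
Qed.

Lemma ccont_fst {U : UniformSpace} (u : U -> C) (x : U) :
  ccont u x -> continuous (fun y => fst (u y)) x.
Proof.
  intros H. apply (continuous_comp (V := C_UniformSpace) u (fun c : C => fst c)).
  exact H. destruct (u x). apply continuous_fst.
Qed.

Lemma ccont_snd {U : UniformSpace} (u : U -> C) (x : U) :
  ccont u x -> continuous (fun y => snd (u y)) x.
Proof.
  intros H. apply (continuous_comp (V := C_UniformSpace) u (fun c : C => snd c)).
  exact H. destruct (u x). apply continuous_snd.
Qed.

Lemma ccont_const {U : UniformSpace} (c : C) (x : U) : ccont (fun _ => c) x.
Proof. apply continuous_const. Qed.

Lemma ccont_ext {U : UniformSpace} (u v : U -> C) (x : U) :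
  (forall y, u y = v y) -> ccont u x -> ccont v x.
Proof. intros H. apply continuous_ext. exact H. Qed.

Lemma ccont_RtoC {U : UniformSpace} (u : U -> R) (x : U) :
  continuous u x -> ccont (fun y => RtoC (u y)) x.
Proof. intros H. apply ccont_pair; simpl. exact H. apply continuous_const. Qed.

Lemma ccont_plus {U : UniformSpace} (u v : U -> C) (x : U) :
  ccont u x -> ccont v x -> ccont (fun y => (u y + v y)%C) x.
Proof.
  intros Hu Hv. apply ccont_pair; simpl.
  apply (continuous_plus (V := R_NormedModule)); apply ccont_fst; assumption.
  apply (continuous_plus (V := R_NormedModule)); apply ccont_snd; assumption.
Qed.

Lemma ccont_opp {U : UniformSpace} (u : U -> C) (x : U) :
  ccont u x -> ccont (fun y => (- u y)%C) x.
Proof.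
  intros Hu. apply ccont_pair; simpl.
  apply (continuous_opp (V := R_NormedModule)); apply ccont_fst; assumption.
  apply (continuous_opp (V := R_NormedModule)); apply ccont_snd; assumption.
Qed.

Lemma ccont_minus {U : UniformSpace} (u v : U -> C) (x : U) :
  ccont u x -> ccont v x -> ccont (fun y => (u y - v y)%C) x.
Proof. intros Hu Hv. apply ccont_plus. assumption. now apply ccont_opp. Qed.

Lemma ccont_mult {U : UniformSpace} (u v : U -> C) (x : U) :
  ccont u x -> ccont v x -> ccont (fun y => (u y * v y)%C) x.
Proof.
  intros Hu Hv.
  assert (H1 := ccont_fst _ _ Hu). assert (H2 := ccont_snd _ _ Hu).
  assert (H3 := ccont_fst _ _ Hv). assert (H4 := ccont_snd _ _ Hv).
  apply ccont_pair; simpl.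
  apply (continuous_minus (V := R_NormedModule));
    apply (continuous_mult (K := R_AbsRing)); assumption.
  apply (continuous_plus (V := R_NormedModule));
    apply (continuous_mult (K := R_AbsRing)); assumption.
Qed.

Lemma continuous_Rinv_comp {U : UniformSpace} (u : U -> R) (x : U) :
  continuous u x -> u x <> 0 -> continuous (fun y => / u y) x.
Proof.
  intros Hu H0. apply (continuous_comp u Rinv). exact Hu.
  apply (ex_derive_continuous (V := R_NormedModule)).
  auto_derive; auto.
Qed.

Lemma ccont_inv {U : UniformSpace} (u : U -> C) (x : U) :
  ccont u x -> u x <> RtoC 0 -> ccont (fun y => (/ u y)%C) x.
Proof.
  intros Hu H0.
  assert (H1 := ccont_fst _ _ Hu). assert (H2 := ccont_snd _ _ Hu).
  assert (Hd : continuous (fun y => fst (u y) ^ 2 + snd (u y) ^ 2) x).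
  { simpl. apply (continuous_plus (V := R_NormedModule));
      apply (continuous_mult (K := R_AbsRing)); try assumption;
      apply (continuous_mult (K := R_AbsRing)); try assumption; apply continuous_const. }
  assert (Hn : fst (u x) ^ 2 + snd (u x) ^ 2 <> 0).
  { intros E. apply H0. destruct (u x) as [a b]; simpl in *.
    unfold RtoC. f_equal; nra. }
  assert (Hi := continuous_Rinv_comp _ _ Hd Hn).
  apply ccont_pair; simpl; apply (continuous_mult (K := R_AbsRing)); try assumption.
  apply (continuous_opp (V := R_NormedModule)); assumption.
Qed.

Lemma ccont_Cmod {U : UniformSpace} (u : U -> C) (x : U) :
  ccont u x -> continuous (fun y => Cmod (u y)) x.
Proof.
  intros Hu.
  assert (H1 := ccont_fst _ _ Hu). assert (H2 := ccont_snd _ _ Hu).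
  unfold Cmod. apply (continuous_comp _ sqrt). simpl.
  apply (continuous_plus (V := R_NormedModule));
      apply (continuous_mult (K := R_AbsRing)); try assumption;
      apply (continuous_mult (K := R_AbsRing)); try assumption; apply continuous_const.
  apply continuous_sqrt.
Qed.

Lemma C_ball_Cmod (x y : C) (e : R) : Cmod (y - x) < e -> ball (M := C_UniformSpace) x e y.
Proof. apply C_NormedModule_mixin_compat1. Qed.

(** The balls of [C_UniformSpace] are squares, which costs a factor sqrt 2, rounded up to 2. *)
Lemma Cmod_C_ball (x y : C) (e : posreal) :
  ball (M := C_UniformSpace) x e y -> Cmod (y - x) < 2 * e.
Proof.
  intros H. assert (H1 := C_NormedModule_mixin_compat2 _ _ _ H).
  apply Rlt_le_trans with (1 := H1).
  apply Rmult_le_compat_r. apply Rlt_le, cond_pos.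
  rewrite <- (sqrt_square 2) at 2 by lra. apply sqrt_le_1_alt. lra.
Qed.

Lemma ccont_R_eps (u : R -> C) (x : R) :
  ccont u x <->
  (forall e, 0 < e -> exists d, 0 < d /\ forall y, Rabs (y - x) < d -> Cmod (u y - u x) < e).
Proof.
  split.
  - intros H e He. assert (He2 : 0 < e / 2) by lra.
    destruct (H _ (locally_ball (u x) (mkposreal _ He2))) as [d Hd].
    exists d. split. apply cond_pos. intros y Hy.
    specialize (Hd y Hy). apply Cmod_C_ball in Hd. simpl in Hd. lra.
  - intros H P [e He]. destruct (H e (cond_pos e)) as (d & Hd & H1).
    exists (mkposreal d Hd). intros y Hy. apply He. apply C_ball_Cmod. now apply H1.
Qed.

Lemma ccont_C_eps (u : C -> C) (x : C) :
  ccont (U := C_UniformSpace) u x <->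
  (forall e, 0 < e -> exists d, 0 < d /\ forall y, Cmod (y - x) < d -> Cmod (u y - u x) < e).
Proof.
  split.
  - intros H e He. assert (He2 : 0 < e / 2) by lra.
    destruct (H _ (locally_ball (u x) (mkposreal _ He2))) as [d Hd].
    exists d. split. apply cond_pos. intros y Hy.
    specialize (Hd y (C_ball_Cmod _ _ _ Hy)). apply Cmod_C_ball in Hd. simpl in Hd. lra.
  - intros H P [e He]. destruct (H e (cond_pos e)) as (d & Hd & H1).
    assert (Hd2 : 0 < d / 2) by lra.
    exists (mkposreal _ Hd2). intros y Hy. apply He. apply C_ball_Cmod.
    apply H1. apply Cmod_C_ball in Hy. simpl in Hy. lra.
Qed.

Lemma ccont_comp {U : UniformSpace} (u : U -> C) (f : C -> C) (x : U) :
  ccont u x -> ccont (U := C_UniformSpace) f (u x) -> ccont (fun y => f (u y)) x.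
Proof. apply (continuous_comp (V := C_UniformSpace) (W := C_UniformSpace)). Qed.

Lemma ccont_id (z : C) : ccont (U := C_UniformSpace) (fun y => y) z.
Proof. apply (continuous_id (U := C_UniformSpace)). Qed.

Lemma ccont_circle_pt (r t : R) : ccont (fun y => circle_pt r y) t.
Proof.
  apply ccont_pair; simpl; apply (ex_derive_continuous (V := R_NormedModule));
    auto_derive; auto.
Qed.

(** * Riemann integrals of complex-valued functions of a real variable *)

Notation CInt := (@RInt C_R_CompleteNormedModule).
Notation ex_CInt := (@ex_RInt C_R_NormedModule).

Lemma ex_CInt_cont (u : R -> C) (a b : R) : a <= b ->
  (forall t, a <= t <= b -> ccont u t) -> ex_CInt u a b.
Proof.
  intros Hab H. apply (ex_RInt_continuous (V := C_R_CompleteNormedModule)).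
  intros t. rewrite Rmin_left, Rmax_right by lra. apply H.
Qed.

Lemma ex_RInt_cont (u : R -> R) (a b : R) : a <= b ->
  (forall t, a <= t <= b -> continuous u t) -> ex_RInt u a b.
Proof.
  intros Hab H. apply (ex_RInt_continuous (V := R_CompleteNormedModule)).
  intros t. rewrite Rmin_left, Rmax_right by lra. apply H.
Qed.

Lemma is_CInt_pair (u : R -> C) (a b : R) (l : C) :
  is_RInt (V := C_R_NormedModule) u a b l <->
  is_RInt (fun t => fst (u t)) a b (fst l) /\ is_RInt (fun t => snd (u t)) a b (snd l).
Proof.
  split.
  - intros H. split.
    apply (is_RInt_fct_extend_fst (U := R_NormedModule) (V := R_NormedModule)). exact H.
    apply (is_RInt_fct_extend_snd (U := R_NormedModule) (V := R_NormedModule)). exact H.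
  - intros [H1 H2]. destruct l as [l1 l2].
    apply (is_RInt_fct_extend_pair (U := R_NormedModule) (V := R_NormedModule)); assumption.
Qed.

Lemma CInt_is (u : R -> C) (a b : R) : ex_CInt u a b ->
  is_RInt (V := C_R_NormedModule) u a b (CInt u a b).
Proof. apply (RInt_correct (V := C_R_CompleteNormedModule)). Qed.

Lemma CInt_unique (u : R -> C) (a b : R) (l : C) :
  is_RInt (V := C_R_NormedModule) u a b l -> CInt u a b = l.
Proof. apply (is_RInt_unique (V := C_R_CompleteNormedModule)). Qed.

Lemma CInt_fst (u : R -> C) (a b : R) : ex_CInt u a b ->
  is_RInt (fun t => fst (u t)) a b (fst (CInt u a b)).
Proof. intros H. apply CInt_is in H. now apply is_CInt_pair in H. Qed.

Lemma CInt_snd (u : R -> C) (a b : R) : ex_CInt u a b ->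
  is_RInt (fun t => snd (u t)) a b (snd (CInt u a b)).
Proof. intros H. apply CInt_is in H. now apply is_CInt_pair in H. Qed.

Lemma CInt_plus (u v : R -> C) (a b : R) : ex_CInt u a b -> ex_CInt v a b ->
  CInt (fun t => (u t + v t)%C) a b = (CInt u a b + CInt v a b)%C.
Proof. intros Hu Hv. apply CInt_unique. apply (is_RInt_plus (V := C_R_NormedModule)); now apply CInt_is. Qed.

Lemma CInt_minus (u v : R -> C) (a b : R) : ex_CInt u a b -> ex_CInt v a b ->
  CInt (fun t => (u t - v t)%C) a b = (CInt u a b - CInt v a b)%C.
Proof. intros Hu Hv. apply CInt_unique. apply (is_RInt_minus (V := C_R_NormedModule)); now apply CInt_is. Qed.

Lemma is_CInt_scal (c : C) (u : R -> C) (a b : R) (l : C) :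
  is_RInt (V := C_R_NormedModule) u a b l ->
  is_RInt (V := C_R_NormedModule) (fun t => (c * u t)%C) a b (c * l)%C.
Proof.
  intros H. apply is_CInt_pair in H. destruct H as [H1 H2]. apply is_CInt_pair. split; simpl.
  - apply (is_RInt_minus (V := R_NormedModule)); now apply (is_RInt_scal (V := R_NormedModule)).
  - apply (is_RInt_plus (V := R_NormedModule)); now apply (is_RInt_scal (V := R_NormedModule)).
Qed.

Lemma CInt_scal (c : C) (u : R -> C) (a b : R) : ex_CInt u a b ->
  CInt (fun t => (c * u t)%C) a b = (c * CInt u a b)%C.
Proof. intros Hu. apply CInt_unique. now apply is_CInt_scal, CInt_is. Qed.

Lemma CInt_ext (u v : R -> C) (a b : R) : a <= b ->
  (forall t, a <= t <= b -> u t = v t) -> CInt u a b = CInt v a b.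
Proof.
  intros Hab H. apply (RInt_ext (V := C_R_CompleteNormedModule)).
  rewrite Rmin_left, Rmax_right by lra. intros t Ht. apply H. lra.
Qed.

Lemma RInt_ext_le (u v : R -> R) (a b : R) : a <= b ->
  (forall t, a <= t <= b -> u t = v t) -> RInt u a b = RInt v a b.
Proof.
  intros Hab H. apply RInt_ext.
  rewrite Rmin_left, Rmax_right by lra. intros t Ht. apply H. lra.
Qed.

Lemma CInt_RtoC (u : R -> R) (a b : R) : ex_RInt u a b ->
  CInt (fun t => RtoC (u t)) a b = RtoC (RInt u a b).
Proof.
  intros H. apply CInt_unique. apply is_CInt_pair; simpl. split.
  now apply (RInt_correct (V := R_CompleteNormedModule)).
  assert (E := is_RInt_const (V := R_NormedModule) a b 0).
  refine (eq_ind _ (fun l => is_RInt (fun _ => 0) a b l) E 0 _).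
  unfold scal; simpl; unfold mult; simpl; ring.
Qed.

Lemma CInt_norm (u : R -> C) (m : R -> R) (a b : R) : a <= b ->
  ex_CInt u a b -> ex_RInt m a b -> (forall t, a <= t <= b -> Cmod (u t) <= m t) ->
  Cmod (CInt u a b) <= RInt m a b.
Proof.
  intros Hab Hu Hm H. rewrite Cmod_norm.
  apply (norm_RInt_le (V := C_R_NormedModule) u m a b); trivial.
  intros t Ht. apply Rle_trans with (2 := H t Ht). right. exact (eq_sym (Cmod_norm (u t))).
  now apply CInt_is.
  now apply (RInt_correct (V := R_CompleteNormedModule)).
Qed.

Lemma RInt_const_R (c a b : R) : RInt (fun _ => c) a b = (b - a) * c.
Proof. rewrite (RInt_const (V := R_CompleteNormedModule)). reflexivity. Qed.

Lemma CInt_norm_const (u : R -> C) (M : R) (a b : R) : a <= b ->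
  ex_CInt u a b -> (forall t, a <= t <= b -> Cmod (u t) <= M) ->
  Cmod (CInt u a b) <= (b - a) * M.
Proof.
  intros Hab Hu H. rewrite <- RInt_const_R. apply CInt_norm; trivial.
  apply (ex_RInt_const (V := R_NormedModule)).
Qed.

Lemma CInt_const (c : C) (a b : R) : CInt (fun _ => c) a b = ((b - a)%R * c)%C.
Proof.
  apply CInt_unique. apply is_CInt_pair. split; simpl.
  replace ((b - a) * fst c - 0 * snd c) with (scal (b - a) (fst c))
    by (unfold scal; simpl; unfold mult; simpl; ring).
  apply (is_RInt_const (V := R_NormedModule)).
  replace ((b - a) * snd c + 0 * fst c) with (scal (b - a) (snd c))
    by (unfold scal; simpl; unfold mult; simpl; ring).
  apply (is_RInt_const (V := R_NormedModule)).
Qed.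

Lemma CInt_Chasles (u : R -> C) (a b c : R) : ex_CInt u a b -> ex_CInt u b c ->
  (CInt u a b + CInt u b c)%C = CInt u a c.
Proof. apply (RInt_Chasles (V := C_R_CompleteNormedModule)). Qed.

Definition is_Cder (f : C -> C) (z l : C) : Prop :=
  @is_derive C_AbsRing C_NormedModule f z l.

(** The derivative is taken along the neighbourhoods of [C_AbsRing], given by [Cmod]; [locally_C]
    exchanges them for those of the product structure used by [ccont]. *)
Lemma is_Cder_eps (f : C -> C) (z l : C) :
  is_Cder f z l <->
  (forall e, 0 < e -> exists d, 0 < d /\
     forall w, Cmod (w - z) < d -> Cmod (f w - f z - (w - z) * l) <= e * Cmod (w - z)).
Proof.
  split.
  - intros [_ H] e He.
    assert (H1 := H z (fun P HP => HP) (mkposreal e He)).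
    apply (locally_C z) in H1.
    destruct H1 as [d Hd]. exists d. split. apply cond_pos.
    intros w Hw. exact (Hd w (C_ball_Cmod _ _ _ Hw)).
  - intros H. split. apply is_linear_scal_l.
    intros x Hx.
    assert (E : z = x) by exact (is_filter_lim_locally_unique (V := AbsRing_NormedModule C_AbsRing) z x Hx).
    subst x.
    intros e. apply (locally_C z). destruct (H e (cond_pos e)) as (d & Hd & H1).
    assert (Hd2 : 0 < d / 2) by lra.
    exists (mkposreal _ Hd2). intros w Hw. apply H1.
    apply Cmod_C_ball in Hw. simpl in Hw. lra.
Qed.

Lemma is_Cder_ccont (f : C -> C) (z l : C) : is_Cder f z l -> ccont (U := C_UniformSpace) f z.
Proof.
  intros H. apply ccont_C_eps. intros e He.
  rewrite is_Cder_eps in H. destruct (H 1 Rlt_0_1) as (d & Hd & H1).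
  assert (Hl := Cmod_ge_0 l).
  exists (Rmin d (e / (2 + Cmod l))). split.
  { apply Rmin_glb_lt; trivial. apply Rdiv_lt_0_compat; lra. }
  intros w Hw. assert (Hw1 := Rlt_le_trans _ _ _ Hw (Rmin_l _ _)).
  assert (Hw2 := Rlt_le_trans _ _ _ Hw (Rmin_r _ _)).
  specialize (H1 w Hw1).
  assert (Hw3 : Cmod (w - z) * (2 + Cmod l) < e).
  { apply (Rmult_lt_compat_r (2 + Cmod l)) in Hw2; [|lra].
    unfold Rdiv in Hw2. rewrite Rmult_assoc, Rinv_l in Hw2; lra. }
  replace (f w - f z)%C with ((f w - f z - (w - z) * l) + (w - z) * l)%C by ring.
  eapply Rle_lt_trans. apply Cmod_triangle. rewrite Cmod_mult.
  assert (Hw0 := Cmod_ge_0 (w - z)). nra.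
Qed.

(** * Complex derivatives *)

(** Lemmas on modules leave equations in the carrier of a normed module; [ceq] and [req] restate
    them in [C] and [R], where [ring] and [field] recognize their structure. *)
Ltac ceq := match goal with |- ?a = ?b => change (@eq C a b) end.

Ltac req := match goal with |- ?a = ?b => change (@eq R a b) end.

Lemma Cminus_neq_0 (z w : C) : z <> w -> (z - w)%C <> RtoC 0.
Proof. intros H E. apply H. replace z with ((z - w) + w)%C by ring. rewrite E. ring. Qed.

Lemma Cmod_pos_neq (z : C) : z <> RtoC 0 -> 0 < Cmod z.
Proof. apply Cmod_gt_0. Qed.

Lemma Cmod_minus_sym (z w : C) : Cmod (z - w) = Cmod (w - z).
Proof. rewrite <- Cmod_opp. f_equal. ring. Qed.

(* Caratheodory's form of differentiability: the rules of calculus become rules for [ccont]. *)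
Lemma is_Cder_cara (f : C -> C) (z l : C) :
  is_Cder f z l <->
  exists q : C -> C, (forall w, f w = (f z + (w - z) * q w)%C) /\ q z = l /\
    ccont (U := C_UniformSpace) q z.
Proof.
  rewrite is_Cder_eps. split.
  - intros H.
    set (q := fun w => if excluded_middle_informative (w = z) then l
                       else ((f w - f z) / (w - z))%C).
    assert (Hq : q z = l).
    { unfold q. destruct (excluded_middle_informative (z = z)); congruence. }
    exists q. split; [|split].
    + intros w. unfold q. destruct (excluded_middle_informative (w = z)) as [->|Hw].
      ring. field. now apply Cminus_neq_0.
    + exact Hq.
    + apply ccont_C_eps. intros e He. rewrite Hq.
      destruct (H (e / 2)) as (d & Hd & H1). lra.
      exists d. split; trivial. intros w Hw. specialize (H1 w Hw). unfold q.
      destruct (excluded_middle_informative (w = z)) as [->|Hn].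
      { replace (l - l)%C with (RtoC 0) by ring. rewrite Cmod_0. lra. }
      assert (Hn1 := Cminus_neq_0 _ _ Hn). assert (Hn2 := Cmod_pos_neq _ Hn1).
      apply Rmult_lt_reg_r with (1 := Hn2). rewrite <- Cmod_mult.
      replace (((f w - f z) / (w - z) - l) * (w - z))%C
        with (f w - f z - (w - z) * l)%C by (field; trivial).
      nra.
  - intros (q & Hf & Hq & Hc) e He.
    rewrite ccont_C_eps in Hc. destruct (Hc e He) as (d & Hd & H1).
    exists d. split; trivial. intros w Hw. specialize (H1 w Hw).
    rewrite (Hf w). rewrite <- Hq.
    replace (f z + (w - z) * q w - f z - (w - z) * q z)%C with ((q w - q z) * (w - z))%C by ring.
    rewrite Cmod_mult. apply Rmult_le_compat_r. apply Cmod_ge_0. lra.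
Qed.

Lemma is_Cder_const (c z : C) : is_Cder (fun _ => c) z 0.
Proof.
  apply is_Cder_cara. exists (fun _ => RtoC 0). split; [|split]; trivial.
  intros w; ring. apply ccont_const.
Qed.

Lemma is_Cder_id (z : C) : is_Cder (fun w => w) z 1.
Proof.
  apply is_Cder_cara. exists (fun _ => RtoC 1). split; [|split]; trivial.
  intros w; ring. apply ccont_const.
Qed.

Lemma is_Cder_plus (f g : C -> C) (z l m : C) :
  is_Cder f z l -> is_Cder g z m -> is_Cder (fun w => (f w + g w)%C) z (l + m)%C.
Proof.
  rewrite !is_Cder_cara. intros (q & H1 & H2 & H3) (q' & H1' & H2' & H3').
  exists (fun w => (q w + q' w)%C). split; [|split].
  intros w. rewrite (H1 w), (H1' w). ring. now rewrite H2, H2'.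
  now apply ccont_plus.
Qed.

Lemma is_Cder_mult (f g : C -> C) (z l m : C) :
  is_Cder f z l -> is_Cder g z m ->
  is_Cder (fun w => (f w * g w)%C) z (l * g z + f z * m)%C.
Proof.
  intros Hf Hg. assert (Hfc := is_Cder_ccont _ _ _ Hf). revert Hf Hg.
  rewrite !is_Cder_cara. intros (q & H1 & H2 & H3) (q' & H1' & H2' & H3').
  exists (fun w => (q w * g z + f w * q' w)%C). split; [|split].
  intros w. rewrite (H1' w), (H1 w). ring. now rewrite H2, H2'.
  apply ccont_plus; apply ccont_mult; trivial. apply ccont_const.
Qed.

Lemma is_Cder_scal (c : C) (f : C -> C) (z l : C) :
  is_Cder f z l -> is_Cder (fun w => (c * f w)%C) z (c * l)%C.
Proof.
  intros H. assert (H1 := is_Cder_mult _ _ _ _ _ (is_Cder_const c z) H).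
  replace (c * l)%C with (RtoC 0 * f z + c * l)%C by ring. exact H1.
Qed.

Lemma is_Cder_minus (f g : C -> C) (z l m : C) :
  is_Cder f z l -> is_Cder g z m -> is_Cder (fun w => (f w - g w)%C) z (l - m)%C.
Proof.
  rewrite !is_Cder_cara. intros (q & H1 & H2 & H3) (q' & H1' & H2' & H3').
  exists (fun w => (q w - q' w)%C). split; [|split].
  intros w. rewrite (H1 w), (H1' w). ring. now rewrite H2, H2'.
  now apply ccont_minus.
Qed.

Lemma is_Cder_comp (f g : C -> C) (z l m : C) :
  is_Cder g z m -> is_Cder f (g z) l -> is_Cder (fun w => f (g w)) z (l * m)%C.
Proof.
  intros Hg Hf. assert (Hgc := is_Cder_ccont _ _ _ Hg). revert Hf Hg.
  rewrite !is_Cder_cara. intros (q & H1 & H2 & H3) (q' & H1' & H2' & H3').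
  exists (fun w => (q (g w) * q' w)%C). split; [|split].
  intros w. rewrite (H1 (g w)). rewrite (H1' w) at 1; ring. now rewrite H2, H2'.
  apply ccont_mult; trivial. now apply ccont_comp.
Qed.

(** The slope - q w / (f w f z) is valid only where f w is nonzero, while Caratheodory's form asks
    for an identity at every w. The epsilon form confines the argument to a neighbourhood of z. *)
Lemma is_Cder_inv (f : C -> C) (z l : C) : f z <> RtoC 0 -> is_Cder f z l ->
  is_Cder (fun w => (/ f w)%C) z (- l / (f z * f z))%C.
Proof.
  intros H0 Hf. assert (Hc := is_Cder_ccont _ _ _ Hf).
  revert Hf. rewrite is_Cder_cara. intros (q & H1 & H2 & H3).
  rewrite is_Cder_eps.
  assert (Hq : ccont (U := C_UniformSpace) (fun w => (- q w / (f w * f z))%C) z).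
  { apply ccont_mult. now apply ccont_opp. apply ccont_inv.
    apply ccont_mult; trivial. apply ccont_const. now apply Cmult_neq_0. }
  rewrite ccont_C_eps in Hq, Hc.
  intros e He. destruct (Hq e He) as (d & Hd & Hq1).
  destruct (Hc (Cmod (f z))) as (d' & Hd' & Hc1). now apply Cmod_gt_0.
  exists (Rmin d d'). split. now apply Rmin_glb_lt.
  intros w Hw. specialize (Hq1 w (Rlt_le_trans _ _ _ Hw (Rmin_l _ _))).
  specialize (Hc1 w (Rlt_le_trans _ _ _ Hw (Rmin_r _ _))).
  assert (Hw0 : f w <> RtoC 0).
  { intros E. rewrite E in Hc1. replace (RtoC 0 - f z)%C with (- f z)%C in Hc1 by ring.
    rewrite Cmod_opp in Hc1. lra. }
  assert (E : (/ f w - / f z - (w - z) * (- l / (f z * f z)) =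
               (- q w / (f w * f z) - - q z / (f z * f z)) * (w - z))%C).
  { rewrite H2. assert (E1 : ((w - z) * q w = f w - f z)%C) by (rewrite (H1 w) at 1; ring).
    transitivity (- ((w - z) * q w) / (f w * f z) - - l * (w - z) / (f z * f z))%C.
    rewrite E1. field; auto. field; auto. }
  rewrite E, Cmod_mult. apply Rmult_le_compat_r. apply Cmod_ge_0. lra.
Qed.

(** * Derivatives along curves and the fundamental theorem of calculus *)

Definition is_Rder (u : R -> C) (t : R) (l : C) : Prop :=
  @is_derive R_AbsRing C_R_NormedModule u t l.

Lemma is_Rder_cara (u : R -> C) (t : R) (l : C) (q : R -> C) :
  (forall s, u s = (u t + (s - t)%R * q s)%C) -> q t = l -> ccont q t -> is_Rder u t l.
Proof.
  intros Hu Hq Hc. split. apply is_linear_scal_l.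
  intros x Hx.
  assert (E : t = x) by exact (is_filter_lim_locally_unique (V := AbsRing_NormedModule R_AbsRing) t x Hx).
  subst x.
  intros e. rewrite ccont_R_eps in Hc. destruct (Hc e (cond_pos e)) as (d & Hd & H1).
  exists (mkposreal d Hd). intros s Hs. specialize (H1 s Hs).
  match goal with |- norm ?X <= _ => set (Y := X) end.
  assert (E : Y = ((q s - q t) * (s - t)%R)%C).
  { unfold Y. rewrite (Hu s). rewrite <- Hq. unfold minus, plus, opp, scal; simpl.
    unfold prod_plus, prod_opp, prod_scal, scal, plus, opp; simpl. unfold mult; simpl.
    destruct (u t), (q s), (q t); apply injective_projections; simpl; ring. }
  rewrite E. clear E. refine (Rle_trans _ _ _ (Req_le _ _ (eq_sym (Cmod_norm _))) _).
  rewrite Cmod_mult, Cmod_R. apply Rmult_le_compat_r. apply Rabs_pos. lra.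
Qed.

Lemma is_Rder_cara_ex (u : R -> C) (t : R) (l : C) :
  is_derive (fun s => fst (u s)) t (fst l) -> is_derive (fun s => snd (u s)) t (snd l) ->
  exists q, (forall s, u s = (u t + (s - t)%R * q s)%C) /\ q t = l /\ ccont q t.
Proof.
  intros H1 H2.
  set (q := fun s => if Req_EM_T s t then l else ((u s - u t) / (s - t)%R)%C).
  assert (Hq : q t = l) by (unfold q; destruct (Req_EM_T t t); congruence).
  exists q. split; [|split; trivial].
  - intros s. unfold q. destruct (Req_EM_T s t) as [->|Hs].
    replace (t - t) with 0 by ring. ring.
    field. intros E. apply RtoC_inj in E. lra.
  - apply ccont_R_eps. intros e He. rewrite Hq.
    apply is_derive_Reals in H1, H2.
    destruct (H1 (e / 2)) as [d1 Hd1]. lra.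
    destruct (H2 (e / 2)) as [d2 Hd2]. lra.
    exists (Rmin d1 d2). split. apply Rmin_glb_lt; apply cond_pos.
    intros s Hs. unfold q. destruct (Req_EM_T s t) as [->|Hn].
    { replace (l - l)%C with (RtoC 0) by ring. rewrite Cmod_0. lra. }
    assert (Hn' : s - t <> 0) by lra.
    specialize (Hd1 (s - t) Hn' (Rlt_le_trans _ _ _ Hs (Rmin_l _ _))).
    specialize (Hd2 (s - t) Hn' (Rlt_le_trans _ _ _ Hs (Rmin_r _ _))).
    replace (t + (s - t)) with s in Hd1, Hd2 by ring.
    set (X := ((u s - u t) / (s - t)%R - l)%C).
    assert (EX : X = ((fst (u s) - fst (u t)) / (s - t) - fst l,
                      (snd (u s) - snd (u t)) / (s - t) - snd l)).
    { unfold X. destruct (u s), (u t), l. apply injective_projections; simpl; field; lra. }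
    assert (T : forall a b : R, Cmod (a, b) <= Rabs a + Rabs b).
    { intros a b. replace (a, b) with (RtoC a + Ci * RtoC b)%C
        by (apply injective_projections; simpl; ring).
      eapply Rle_trans. apply Cmod_triangle. rewrite Cmod_mult, Cmod_Ci, !Cmod_R. lra. }
    rewrite EX. eapply Rle_lt_trans. apply T. lra.
Qed.

Lemma is_Rder_pair (u : R -> C) (t : R) (l : C) :
  is_derive (fun s => fst (u s)) t (fst l) -> is_derive (fun s => snd (u s)) t (snd l) ->
  is_Rder u t l.
Proof.
  intros H1 H2. destruct (is_Rder_cara_ex _ _ _ H1 H2) as (q & Ha & Hb & Hc).
  now apply is_Rder_cara with q.
Qed.

Lemma is_Rder_comp (f : C -> C) (u : R -> C) (t : R) (l m : C) :
  is_derive (fun s => fst (u s)) t (fst m) -> is_derive (fun s => snd (u s)) t (snd m) ->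
  is_Cder f (u t) l -> is_Rder (fun s => f (u s)) t (m * l)%C.
Proof.
  intros H1 H2 Hf. destruct (is_Rder_cara_ex _ _ _ H1 H2) as (q & Ha & Hb & Hc).
  apply is_Cder_cara in Hf. destruct Hf as (q' & Ha' & Hb' & Hc').
  assert (Hu : ccont u t).
  { apply ccont_ext with (fun s => (u t + (s - t)%R * q s)%C). intros; now rewrite <- Ha.
    apply ccont_plus. apply ccont_const. apply ccont_mult; trivial. apply ccont_RtoC.
    apply (ex_derive_continuous (V := R_NormedModule)). auto_derive; auto. }
  apply is_Rder_cara with (fun s => (q s * q' (u s))%C).
  - intros s. rewrite (Ha' (u s)). rewrite (Ha s) at 1; ring.
  - now rewrite Hb, Hb'.
  - apply ccont_mult; trivial. now apply ccont_comp.
Qed.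

Lemma CInt_FTC (f df : R -> C) (a b : R) : a <= b ->
  (forall t, a <= t <= b -> is_Rder f t (df t)) ->
  (forall t, a <= t <= b -> ccont df t) ->
  CInt df a b = (f b - f a)%C.
Proof.
  intros Hab H1 H2. apply CInt_unique.
  apply (is_RInt_derive (V := C_R_CompleteNormedModule) f df a b);
    rewrite Rmin_left, Rmax_right by lra; assumption.
Qed.

(** The radius is a parameter because dilates and factors are analytic on discs slightly larger than
    the circle on which they are integrated; [ana 1] unfolds to [analytic_on_disc]. *)
Definition ana (rho : R) (f : C -> C) : Prop :=
  forall z : C, Cmod z < rho -> @ex_derive C_AbsRing C_NormedModule f z.

Lemma ana_der (rho : R) (f : C -> C) (z : C) :
  ana rho f -> Cmod z < rho -> exists l, is_Cder f z l.
Proof. intros H Hz. now destruct (H z Hz) as [l Hl]; exists l. Qed.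

Lemma ana_ccont (rho : R) (f : C -> C) (z : C) :
  ana rho f -> Cmod z < rho -> ccont (U := C_UniformSpace) f z.
Proof. intros H Hz. destruct (H z Hz) as [l Hl]. now apply is_Cder_ccont with l. Qed.

Lemma ana_le (rho rho' : R) (f : C -> C) : rho' <= rho -> ana rho f -> ana rho' f.
Proof. intros Hr H z Hz. apply H. lra. Qed.

Lemma ana_plus (rho : R) (f g : C -> C) :
  ana rho f -> ana rho g -> ana rho (fun z => (f z + g z)%C).
Proof.
  intros Hf Hg z Hz. destruct (Hf z Hz) as [l Hl]. destruct (Hg z Hz) as [m Hm].
  exists (l + m)%C. now apply is_Cder_plus.
Qed.

Lemma ana_minus (rho : R) (f g : C -> C) :
  ana rho f -> ana rho g -> ana rho (fun z => (f z - g z)%C).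
Proof.
  intros Hf Hg z Hz. destruct (Hf z Hz) as [l Hl]. destruct (Hg z Hz) as [m Hm].
  exists (l - m)%C. now apply is_Cder_minus.
Qed.

Lemma ana_mult (rho : R) (f g : C -> C) :
  ana rho f -> ana rho g -> ana rho (fun z => (f z * g z)%C).
Proof.
  intros Hf Hg z Hz. destruct (Hf z Hz) as [l Hl]. destruct (Hg z Hz) as [m Hm].
  exists (l * g z + f z * m)%C. now apply is_Cder_mult.
Qed.

Lemma ana_const (rho : R) (c : C) : ana rho (fun _ => c).
Proof. intros z Hz. exists (RtoC 0). apply is_Cder_const. Qed.

Lemma ana_id (rho : R) : ana rho (fun z => z).
Proof. intros z Hz. exists (RtoC 1). apply is_Cder_id. Qed.

Lemma ana_pow (rho : R) (n : nat) : ana rho (fun z => (z ^ n)%C).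
Proof.
  induction n; simpl. apply ana_const. apply ana_mult; trivial. apply ana_id.
Qed.

Lemma ana_inv (rho : R) (f : C -> C) :
  ana rho f -> (forall z, Cmod z < rho -> f z <> RtoC 0) -> ana rho (fun z => (/ f z)%C).
Proof.
  intros Hf H0 z Hz. destruct (Hf z Hz) as [l Hl].
  exists (- l / (f z * f z))%C. apply is_Cder_inv; auto.
Qed.

Lemma ana_comp_scal (rho rho' : R) (c : C) (f : C -> C) :
  Cmod c * rho' <= rho -> 0 < Cmod c -> ana rho f -> ana rho' (fun z => f (c * z)%C).
Proof.
  intros Hr Hc Hf z Hz.
  destruct (Hf (c * z)%C) as [l Hl]. rewrite Cmod_mult. nra.
  exists (l * (c * 1))%C. apply (is_Cder_comp f (fun z => (c * z)%C)).
  apply is_Cder_scal, is_Cder_id. exact Hl.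
Qed.

(** * Integrals along segments *)

(** Recursion on pairs of a point and a proof of its invariant. Both the invariant P and the step
    relation Q may depend on the stage; this builds the nested triangles of Goursat's theorem as
    well as subsequences. *)
Lemma dep_choice {A : Type} (P : nat -> A -> Prop) (Q : nat -> A -> A -> Prop) (x0 : A) :
  P O x0 -> (forall n x, P n x -> exists y, P (S n) y /\ Q n x y) ->
  exists u : nat -> A, u O = x0 /\ forall n, P n (u n) /\ Q n (u n) (u (S n)).
Proof.
  intros H0 H.
  set (next := fun n (s : {x | P n x}) =>
    constructive_indefinite_description _ (H n (proj1_sig s) (proj2_sig s))).
  set (s := nat_rect (fun n => {x | P n x}) (exist _ x0 H0)
     (fun n s => exist (P (S n)) (proj1_sig (next n s)) (proj1 (proj2_sig (next n s))))).
  exists (fun n => proj1_sig (s n)). split. reflexivity.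
  intros n. split. apply (proj2_sig (s n)).
  simpl. exact (proj2 (proj2_sig (next n (s n)))).
Qed.

Lemma C_cauchy_lim (u : nat -> C) :
  (forall e, 0 < e -> exists N, forall n m, (N <= n)%nat -> (N <= m)%nat -> Cmod (u n - u m) < e) ->
  exists l, forall e, 0 < e -> exists N, forall n, (N <= n)%nat -> Cmod (u n - l) < e.
Proof.
  intros H.
  assert (H1 : ex_finite_lim_seq (fun n => fst (u n))).
  { apply ex_lim_seq_cauchy_corr. intros e. destruct (H e (cond_pos e)) as [N HN].
    exists N. intros n m Hn Hm. eapply Rle_lt_trans; [|apply (HN n m Hn Hm)].
    apply (re_le_Cmod (u n - u m)%C). }
  assert (H2 : ex_finite_lim_seq (fun n => snd (u n))).
  { apply ex_lim_seq_cauchy_corr. intros e. destruct (H e (cond_pos e)) as [N HN].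
    exists N. intros n m Hn Hm. eapply Rle_lt_trans; [|apply (HN n m Hn Hm)].
    eapply Rle_trans; [|apply Rmax_Cmod]. apply Rmax_r. }
  destruct H1 as [l1 H1], H2 as [l2 H2]. exists (l1, l2). intros e He.
  apply is_lim_seq_spec in H1, H2. assert (He2 : 0 < e / 2) by lra.
  destruct (H1 (mkposreal _ He2)) as [N1 HN1], (H2 (mkposreal _ He2)) as [N2 HN2].
  exists (max N1 N2). intros n Hn. specialize (HN1 n ltac:(lia)). specialize (HN2 n ltac:(lia)).
  simpl in HN1, HN2.
  replace (u n - (l1, l2))%C with (RtoC (fst (u n) - l1) + Ci * RtoC (snd (u n) - l2))%C
    by (destruct (u n); apply injective_projections; simpl; ring).
  eapply Rle_lt_trans. apply Cmod_triangle. rewrite Cmod_mult, Cmod_Ci, !Cmod_R. lra.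
Qed.

Lemma Rle_eps (x y : R) : (forall e, 0 < e -> x <= y + e) -> x <= y.
Proof.
  intros H. apply Rnot_lt_le. intros Hn. specialize (H ((x - y) / 2)). lra.
Qed.

Lemma C_geom_lim (u : nat -> C) (S0 : R) : 0 <= S0 ->
  (forall n, Cmod (u (S n) - u n) <= S0 * (/ 2) ^ n) ->
  exists l, forall n, Cmod (u n - l) <= 2 * S0 * (/ 2) ^ n.
Proof.
  intros HS H.
  assert (Hp : forall n, 0 < (/ 2) ^ n) by (intros n; apply pow_lt; lra).
  assert (H1 : forall n k, Cmod (u (n + k)%nat - u n) <= 2 * S0 * ((/ 2) ^ n - (/ 2) ^ (n + k))).
  { intros n k. induction k.
    rewrite Nat.add_0_r. replace (u n - u n)%C with (RtoC 0) by ring. rewrite Cmod_0. lra.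
    rewrite Nat.add_succ_r.
    replace (u (S (n + k)) - u n)%C with ((u (S (n + k)) - u (n + k)%nat) + (u (n + k)%nat - u n))%C by ring.
    eapply Rle_trans. apply Cmod_triangle. specialize (H (n + k)%nat). simpl.
    nra. }
  assert (H2 : forall n m, (n <= m)%nat -> Cmod (u m - u n) <= 2 * S0 * (/ 2) ^ n).
  { intros n m Hm. replace m with (n + (m - n))%nat by lia. specialize (H1 n (m - n)%nat).
    specialize (Hp (n + (m - n))%nat). nra. }
  destruct (C_cauchy_lim u) as [l Hl].
  { intros e He. destruct (pow_lt_1_zero (/ 2)) with (y := e / (4 * S0 + 4)) as [N HN].
    rewrite Rabs_right; lra. apply Rdiv_lt_0_compat; lra.
    exists N. intros n m Hn Hm. specialize (HN N ltac:(lia)).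
    rewrite Rabs_right in HN by (specialize (Hp N); lra).
    assert (HN' : (/ 2) ^ N * (4 * S0 + 4) < e).
    { apply (Rmult_lt_compat_r (4 * S0 + 4)) in HN; [|lra].
      unfold Rdiv in HN. rewrite Rmult_assoc, Rinv_l in HN; lra. }
    replace (u n - u m)%C with ((u n - u N) - (u m - u N))%C by ring.
    unfold Cminus at 1. eapply Rle_lt_trans. apply Cmod_triangle. rewrite Cmod_opp.
    assert (A := H2 N n Hn). assert (B := H2 N m Hm). specialize (Hp N). nra. }
  exists l. intros n. apply Rle_eps. intros e He. destruct (Hl e He) as [N HN].
  specialize (HN (max n N) ltac:(lia)). specialize (H2 n (max n N) ltac:(lia)).
  replace (u n - l)%C with ((u (max n N) - l) - (u (max n N) - u n))%C by ring.
  unfold Cminus at 1. eapply Rle_trans. apply Cmod_triangle. rewrite Cmod_opp. lra.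
Qed.

Definition seg (a b : C) (t : R) : C := (a + RtoC t * (b - a))%C.
Definition seg_int (f : C -> C) (a b : C) : C := ((b - a) * CInt (fun t => f (seg a b t)) 0 1)%C.
Definition tri_int (f : C -> C) (a b c : C) : C := (seg_int f a b + seg_int f b c + seg_int f c a)%C.

Lemma ccont_seg (a b : C) (t : R) : ccont (seg a b) t.
Proof.
  unfold seg. apply ccont_plus. apply ccont_const. apply ccont_mult.
  apply ccont_RtoC, continuous_id. apply ccont_const.
Qed.

Definition cont_on (D : C -> Prop) (f : C -> C) : Prop :=
  forall z, D z -> ccont (U := C_UniformSpace) f z.
Definition cvx (D : C -> Prop) : Prop :=
  forall x y t, D x -> D y -> 0 <= t <= 1 -> D (seg x y t).

Lemma ex_seg_int (D : C -> Prop) (f : C -> C) (a b : C) (s t : R) :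
  cont_on D f -> cvx D -> D a -> D b -> 0 <= s -> s <= t -> t <= 1 ->
  ex_CInt (fun t => f (seg a b t)) s t.
Proof.
  intros Hf HD Ha Hb H0 H1 H2. apply ex_CInt_cont; trivial.
  intros x Hx. apply ccont_comp. apply ccont_seg. apply Hf, HD; trivial. lra.
Qed.

(** The factor k multiplies the integral instead of dividing the other side, so the degenerate case
    k = 0 is included; it occurs when a segment is cut at one of its ends. *)
Lemma CInt_lin (u : R -> C) (k v : R) : ex_CInt u v (k + v) ->
  Cmult (RtoC k) (CInt (fun t => u (k * t + v)) 0 1) = CInt u v (k + v).
Proof.
  intros H. destruct (Req_dec k 0) as [->|Hk].
  { rewrite Rplus_0_l, (RInt_point (V := C_R_CompleteNormedModule)).
    transitivity (RtoC 0); [ring | reflexivity]. }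
  assert (H1 : is_RInt (V := C_R_NormedModule) (fun t => (RtoC k * u (k * t + v)%R)%C) 0 1 (CInt u v (k + v))).
  { apply CInt_is in H.
    replace v with (k * 0 + v) in H at 1 by ring. replace (k + v) with (k * 1 + v) in H at 1 by ring.
    apply (is_RInt_comp_lin (V := C_R_NormedModule)) in H.
    refine (is_RInt_ext _ _ _ _ _ _ H).
    intros t _. ceq. destruct (u (k * t + v)). apply injective_projections; simpl;
    unfold scal; simpl; unfold mult; simpl; ring. }
  assert (Hk' : RtoC k <> RtoC 0) by (intros E; apply RtoC_inj in E; lra).
  apply (is_CInt_scal (/ RtoC k)%C) in H1.
  assert (H2 : is_RInt (V := C_R_NormedModule) (fun t => u (k * t + v)) 0 1 (Cmult (/ RtoC k) (CInt u v (k + v)))).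
  { refine (is_RInt_ext _ _ _ _ _ _ H1). intros t _. ceq. field; trivial. }
  rewrite (CInt_unique _ _ _ _ H2). field; trivial.
Qed.

Lemma seg_int_split (D : C -> Prop) (f : C -> C) (a b : C) (s : R) :
  cont_on D f -> cvx D -> D a -> D b -> 0 <= s <= 1 ->
  seg_int f a b = (seg_int f a (seg a b s) + seg_int f (seg a b s) b)%C.
Proof.
  intros Hf HD Ha Hb Hs. unfold seg_int at 1.
  assert (E1 := ex_seg_int D f a b 0 s Hf HD Ha Hb ltac:(lra) ltac:(lra) ltac:(lra)).
  assert (E2 := ex_seg_int D f a b s 1 Hf HD Ha Hb ltac:(lra) ltac:(lra) ltac:(lra)).
  rewrite <- (CInt_Chasles _ 0 s 1 E1 E2).
  replace 1 with ((1 - s) + s) in E2 |- * at 1 by ring.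
  rewrite <- (CInt_lin _ (1 - s) s E2).
  replace s with (s + 0) in E1 by ring. assert (E3 := CInt_lin _ s 0 E1).
  rewrite Rplus_0_r in E3 at 1. replace (s + 0) with s in E3 by ring. rewrite <- E3.
  unfold seg_int.
  replace (CInt (fun t => f (seg a (seg a b s) t)) 0 1) with
    (CInt (fun t => f (seg a b (s * t + 0))) 0 1).
  replace (CInt (fun t => f (seg (seg a b s) b t)) 0 1) with
    (CInt (fun t => f (seg a b ((1 - s) * t + s))) 0 1).
  replace (seg a b s - a)%C with (RtoC s * (b - a))%C by (unfold seg; ring).
  replace (b - seg a b s)%C with (RtoC (1 - s) * (b - a))%C by (unfold seg; rewrite RtoC_minus; ring).
  ring.
  apply CInt_ext. lra. intros t _. f_equal. unfold seg.
  rewrite RtoC_plus, RtoC_mult, RtoC_minus. ring.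
  apply CInt_ext. lra. intros t _. f_equal. unfold seg.
  rewrite RtoC_plus, RtoC_mult. ring.
Qed.

Lemma seg_int_rev (D : C -> Prop) (f : C -> C) (a b : C) :
  cont_on D f -> cvx D -> D a -> D b -> seg_int f b a = (- seg_int f a b)%C.
Proof.
  intros Hf HD Ha Hb. unfold seg_int.
  assert (E1 := ex_seg_int D f a b 0 1 Hf HD Ha Hb ltac:(lra) ltac:(lra) ltac:(lra)).
  assert (E2 := ex_RInt_swap _ _ _ E1).
  replace 0 with (-1 + 1) in E2 by ring. assert (E3 := CInt_lin _ (-1) 1 E2).
  replace (-1 + 1) with 0 in E3 by ring.
  rewrite <- (opp_RInt_swap (V := C_R_CompleteNormedModule) (fun t => f (seg a b t)) 0 1 E1) in E3.
  replace (CInt (fun t => f (seg b a t)) 0 1) with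
    (CInt (fun t => f (seg a b (-1 * t + 1))) 0 1).
  assert (E4 : CInt (fun t => f (seg a b (-1 * t + 1))) 0 1 =
    (- (RtoC (-1) * CInt (fun t => f (seg a b (-1 * t + 1)%R)) 0 1))%C).
  { apply injective_projections; simpl; ring. }
  rewrite E4, E3. change opp with Copp. ring.
  apply CInt_ext. lra. intros t _. f_equal. unfold seg.
  rewrite RtoC_plus, RtoC_mult. replace (RtoC (-1)) with (- RtoC 1)%C
    by (apply injective_projections; simpl; ring). ring.
Qed.

(** An affine function integrates over a segment to (b - a) times its value at the midpoint. Around
    a triangle these main terms cancel, and only the deviation of f from its tangent remains. *)
Lemma seg_int_affine (f : C -> C) (a b al be : C) (e : R) :
  0 <= e -> ex_CInt (fun t => f (seg a b t)) 0 1 ->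
  (forall t, 0 <= t <= 1 -> Cmod (f (seg a b t) - (al + be * (seg a b t))) <= e) ->
  Cmod (seg_int f a b - (b - a) * (al + be * (a + b) / 2)) <= Cmod (b - a) * e.
Proof.
  intros He Hex H.
  assert (E : CInt (fun t => (al + be * seg a b t)%C) 0 1 = (al + be * (a + b) / 2)%C).
  { rewrite (CInt_FTC (fun t => (al * t + be * (a * t + (b - a) * (t * t / 2)%R))%C)).
    - replace (1 * 1 / 2) with (/ 2) by field. replace (0 * 0 / 2) with 0 by field.
      rewrite RtoC_inv by lra. ceq. field.
    - lra.
    - intros t _. unfold seg. apply is_Rder_pair; simpl; auto_derive; auto;
      destruct al, be, a, b; simpl; req; field.
    - intros t _. apply ccont_plus. apply ccont_const.
      apply ccont_mult. apply ccont_const. apply ccont_seg. }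
  rewrite <- E. unfold seg_int.
  assert (Hex2 : ex_CInt (fun t => (al + be * seg a b t)%C) 0 1).
  { apply ex_CInt_cont. lra. intros t _. apply ccont_plus. apply ccont_const.
    apply ccont_mult. apply ccont_const. apply ccont_seg. }
  replace ((b - a) * CInt (fun t => f (seg a b t)) 0 1 -
     (b - a) * CInt (fun t => (al + be * seg a b t)%C) 0 1)%C with
    ((b - a) * (CInt (fun t => f (seg a b t)) 0 1 - CInt (fun t => (al + be * seg a b t)%C) 0 1))%C by ring.
  rewrite Cmod_mult. apply Rmult_le_compat_l. apply Cmod_ge_0.
  rewrite <- CInt_minus by trivial.
  replace e with ((1 - 0) * e) by ring. apply CInt_norm_const. lra.
  apply (ex_RInt_minus (V := C_R_NormedModule)); trivial. exact H.
Qed.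

Lemma seg_int_const_bound (f : C -> C) (a b c : C) (e : R) :
  0 <= e -> ex_CInt (fun t => f (seg a b t)) 0 1 ->
  (forall t, 0 <= t <= 1 -> Cmod (f (seg a b t) - c) <= e) ->
  Cmod (seg_int f a b - (b - a) * c) <= Cmod (b - a) * e.
Proof.
  intros He Hex H.
  replace ((b - a) * c)%C with ((b - a) * (c + 0 * (a + b) / 2))%C by field.
  apply seg_int_affine; trivial.
  intros t Ht. replace (c + 0 * seg a b t)%C with c by ring. now apply H.
Qed.

Lemma seg_dist (a b x : C) (t d : R) : 0 <= t <= 1 ->
  Cmod (a - x) <= d -> Cmod (b - x) <= d -> Cmod (seg a b t - x) <= d.
Proof.
  intros Ht Ha Hb. unfold seg.
  replace (a + t * (b - a) - x)%C with (RtoC (1 - t) * (a - x) + RtoC t * (b - x))%C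
    by (rewrite RtoC_minus; ring).
  eapply Rle_trans. apply Cmod_triangle. rewrite !Cmod_mult, !Cmod_R, !Rabs_right by lra. nra.
Qed.

(** * Goursat's theorem *)

Definition midp (a b : C) : C := seg a b (/ 2).

Lemma midp_eq (a b : C) : midp a b = ((a + b) / 2)%C.
Proof. unfold midp, seg. rewrite RtoC_inv by lra. field. Qed.

Lemma Cmod_half (z : C) : Cmod (z / 2) = Cmod z / 2.
Proof.
  unfold Cdiv. rewrite Cmod_mult, <- RtoC_inv, Cmod_R, Rabs_right by lra. reflexivity.
Qed.

Lemma tri_int_bisect (D : C -> Prop) (f : C -> C) (a b c : C) :
  cont_on D f -> cvx D -> D a -> D b -> D c ->
  tri_int f a b c = (tri_int f a (midp a b) (midp c a) + tri_int f b (midp b c) (midp a b)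
              + tri_int f c (midp c a) (midp b c) + tri_int f (midp a b) (midp b c) (midp c a))%C.
Proof.
  intros Hf HD Ha Hb Hc.
  assert (Hh : 0 <= / 2 <= 1) by lra.
  assert (H1 : D (midp a b)) by now apply HD.
  assert (H2 : D (midp b c)) by now apply HD.
  assert (H3 : D (midp c a)) by now apply HD.
  unfold tri_int.
  rewrite (seg_int_split D f a b (/ 2) Hf HD Ha Hb Hh), (seg_int_split D f b c (/ 2) Hf HD Hb Hc Hh),
    (seg_int_split D f c a (/ 2) Hf HD Hc Ha Hh). fold (midp a b) (midp b c) (midp c a).
  rewrite (seg_int_rev D f (midp c a) (midp a b)), (seg_int_rev D f (midp a b) (midp b c)),
    (seg_int_rev D f (midp b c) (midp c a)) by assumption.
  ring.
Qed.

Definition cclosed (D : C -> Prop) : Prop :=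
  forall x, (forall e, 0 < e -> exists y, D y /\ Cmod (y - x) < e) -> D x.

(** Repeated bisection of the triangle. The triangle is not described as a set: D is any closed
    convex set, convexity keeps the midpoints in D and closedness keeps the limit point of the
    vertices in D, where f is differentiable. *)
Lemma goursat (D : C -> Prop) (f : C -> C) (a b c : C) :
  cvx D -> cclosed D -> (forall z, D z -> exists l, is_Cder f z l) ->
  D a -> D b -> D c -> tri_int f a b c = RtoC 0.
Proof.
  intros HD Hcl Hf Ha Hb Hc.
  assert (Hcont : cont_on D f).
  { intros z Hz. destruct (Hf z Hz) as [l Hl]. now apply is_Cder_ccont with l. }
  (* The perimeter, plus 1 so that it is positive for a degenerate triangle. *)
  set (S0 := Cmod (b - a) + Cmod (c - b) + Cmod (a - c) + 1).
  assert (P1 := Cmod_ge_0 (b - a)). assert (P2 := Cmod_ge_0 (c - b)).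
  assert (P3 := Cmod_ge_0 (a - c)).
  assert (HS0 : 0 < S0) by (unfold S0; lra).
  apply Cmod_eq_0. apply Rle_antisym; [|apply Cmod_ge_0].
  apply Rle_eps. intros e0 He0. rewrite Rplus_0_l.
  set (e := e0 / (S0 ^ 2)).
  assert (HS2 : 0 < S0 ^ 2) by (apply pow_lt; lra).
  assert (He : 0 < e) by (unfold e; now apply Rdiv_lt_0_compat).
  replace e0 with (e * S0 ^ 2) by (unfold e; field; lra).
  apply Rnot_lt_le. intros Hbad.
  (* Sides at most s and an integral above [e * s ^ 2]: halving s divides this threshold by 4, and
     one of the four subtriangles keeps at least a quarter of the integral. *)
  set (P := fun (n : nat) (t : C * C * C) => let '(x, y, z) := t in
     let s := S0 * (/ 2) ^ n in
     D x /\ D y /\ D z /\ Cmod (y - x) <= s /\ Cmod (z - y) <= s /\ Cmod (x - z) <= s /\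
     e * s ^ 2 < Cmod (tri_int f x y z)).
  set (Q := fun (n : nat) (t u : C * C * C) => Cmod (fst (fst u) - fst (fst t)) <= S0 * (/ 2) ^ n).
  destruct (dep_choice P Q (a, b, c)) as (u & Hu0 & Hu).
  { simpl. rewrite Rmult_1_r. unfold S0 at 1 2 3. repeat split; try assumption; lra. }
  { intros n [[x y] z]. unfold P at 1. intros (Hx & Hy & Hz & Hxy & Hyz & Hzx & HT).
    set (s := S0 * (/ 2) ^ n) in *.
    assert (Es : S0 * (/ 2) ^ S n = s / 2) by (unfold s; simpl; field).
    assert (Hs : 0 <= s) by (eapply Rle_trans; [apply Cmod_ge_0 | exact Hxy]).
    assert (Hh : 0 <= / 2 <= 1) by lra.
    assert (Dm1 : D (midp x y)) by now apply HD.
    assert (Dm2 : D (midp y z)) by now apply HD.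
    assert (Dm3 : D (midp z x)) by now apply HD.
    rewrite (tri_int_bisect D f x y z) in HT by assumption.
    assert (Side : forall p q : C, Cmod (p - q) <= s -> Cmod ((p - q) / 2) <= s / 2)
      by (intros; rewrite Cmod_half; lra).
    assert (Hyx : Cmod (x - y) <= s) by now rewrite Cmod_minus_sym.
    assert (Hzy : Cmod (y - z) <= s) by now rewrite Cmod_minus_sym.
    assert (Hxz : Cmod (z - x) <= s) by now rewrite Cmod_minus_sym.
    assert (Sides : forall p q r : C, Cmod (p - q) <= s -> Cmod (q - r) <= s -> Cmod (r - p) <= s ->
       Cmod (midp p q - p) <= s / 2 /\ Cmod (midp r p - midp p q) <= s / 2 /\ Cmod (p - midp r p) <= s / 2).
    { intros p q r Hpq Hqr Hrp. rewrite Cmod_minus_sym in Hpq, Hqr, Hrp. rewrite !midp_eq. split; [|split].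
      replace ((p + q) / 2 - p)%C with ((q - p) / 2)%C by field. auto.
      replace ((r + p) / 2 - (p + q) / 2)%C with ((r - q) / 2)%C by field. auto.
      replace (p - (r + p) / 2)%C with ((p - r) / 2)%C by field. auto. }
    assert (Hcase : e * (s / 2) ^ 2 < Cmod (tri_int f x (midp x y) (midp z x)) \/
      e * (s / 2) ^ 2 < Cmod (tri_int f y (midp y z) (midp x y)) \/
      e * (s / 2) ^ 2 < Cmod (tri_int f z (midp z x) (midp y z)) \/
      e * (s / 2) ^ 2 < Cmod (tri_int f (midp x y) (midp y z) (midp z x))).
    { apply NNPP. intros Hn. apply not_or_and in Hn. destruct Hn as [N1 Hn].
      apply not_or_and in Hn. destruct Hn as [N2 Hn]. apply not_or_and in Hn. destruct Hn as [N3 N4].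
      apply Rnot_lt_le in N1, N2, N3, N4.
      match type of HT with _ < Cmod (?A + ?B + ?X + ?Y) =>
        assert (U1 := Cmod_triangle (A + B + X) Y);
        assert (U2 := Cmod_triangle (A + B) X);
        assert (U3 := Cmod_triangle A B) end.
      replace (e * s ^ 2) with (4 * (e * (s / 2) ^ 2)) in HT by field. lra. }
    unfold P, Q. rewrite Es.
    destruct Hcase as [K|[K|[K|K]]].
    - exists (x, midp x y, midp z x). destruct (Sides x y z) as (A1 & A2 & A3); trivial.
      repeat split; trivial. simpl. replace (x - x)%C with (RtoC 0) by ring. now rewrite Cmod_0.
    - exists (y, midp y z, midp x y). destruct (Sides y z x) as (A1 & A2 & A3); trivial.
      repeat split; trivial.
    - exists (z, midp z x, midp y z). destruct (Sides z x y) as (A1 & A2 & A3); trivial.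
      repeat split; trivial.
    - exists (midp x y, midp y z, midp z x). repeat split; trivial; simpl.
      rewrite !midp_eq. replace ((y + z) / 2 - (x + y) / 2)%C with ((z - x) / 2)%C by field. auto.
      rewrite !midp_eq. replace ((z + x) / 2 - (y + z) / 2)%C with ((x - y) / 2)%C by field. auto.
      rewrite !midp_eq. replace ((x + y) / 2 - (z + x) / 2)%C with ((y - z) / 2)%C by field. auto.
      rewrite midp_eq. replace ((x + y) / 2 - x)%C with ((y - x) / 2)%C by field.
      apply Rle_trans with (s / 2). auto. change (s / 2 <= s). lra. }
  destruct (C_geom_lim (fun n => fst (fst (u n))) S0) as [x Hx]. lra.
  { intros n. exact (proj2 (Hu n)). }
  assert (Hpow : forall d, 0 < d -> exists n, 3 * S0 * (/ 2) ^ n < d).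
  { intros d Hd. destruct (pow_lt_1_zero (/ 2)) with (y := d / (3 * S0)) as [N HN].
    rewrite Rabs_right; lra. apply Rdiv_lt_0_compat; lra.
    exists N. specialize (HN N ltac:(lia)). assert (0 < (/ 2) ^ N) by (apply pow_lt; lra).
    rewrite Rabs_right in HN by lra.
    apply (Rmult_lt_compat_l (3 * S0)) in HN; [|lra].
    replace (3 * S0 * (d / (3 * S0))) with d in HN by (field; lra). exact HN. }
  assert (Dx : D x).
  { apply Hcl. intros d Hd. destruct (Hpow d Hd) as [n Hn].
    exists (fst (fst (u n))). destruct (Hu n) as [Hun _]. destruct (u n) as [[x' y'] z'] eqn:E.
    simpl. split. apply Hun. specialize (Hx n). rewrite E in Hx. simpl in Hx.
    assert (0 < S0 * (/ 2) ^ n) by (apply Rmult_lt_0_compat; [lra | apply pow_lt; lra]). lra. }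
  destruct (Hf x Dx) as [l Hl]. rewrite is_Cder_eps in Hl.
  (* All vertices lie within 3 s of x, so f deviates from its tangent by at most e / 9 * 3 s; three
     sides of length at most s then contribute at most [e * s ^ 2], against the strict inequality of
     the invariant. *)
  destruct (Hl (e / 9)) as (d & Hd & Hd1). lra.
  destruct (Hpow d Hd) as [n Hn]. specialize (Hx n).
  destruct (Hu n) as [Hun _]. destruct (u n) as [[x' y'] z']. simpl in Hx.
  destruct Hun as (Hx' & Hy' & Hz' & Hxy & Hyz & Hzx & HT).
  set (s := S0 * (/ 2) ^ n) in *. replace (2 * S0 * (/ 2) ^ n) with (2 * s) in Hx by (unfold s; ring).
  replace (3 * S0 * (/ 2) ^ n) with (3 * s) in Hn by (unfold s; ring).
  assert (Hs : 0 < s). { unfold s. apply Rmult_lt_0_compat. lra. apply pow_lt. lra. }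
  assert (Bx : Cmod (x' - x) <= 3 * s) by lra.
  assert (By : Cmod (y' - x) <= 3 * s).
  { replace (y' - x)%C with ((y' - x') + (x' - x))%C by ring.
    eapply Rle_trans. apply Cmod_triangle. lra. }
  assert (Bz : Cmod (z' - x) <= 3 * s).
  { replace (z' - x)%C with ((x' - x) - (x' - z'))%C by ring. unfold Cminus at 1.
    eapply Rle_trans. apply Cmod_triangle. rewrite Cmod_opp. lra. }
  assert (Est : forall p q, D p -> D q -> Cmod (p - x) <= 3 * s -> Cmod (q - x) <= 3 * s ->
    Cmod (q - p) <= s ->
    Cmod (seg_int f p q - (q - p) * ((f x - x * l) + l * (p + q) / 2)) <= s * (e / 9 * (3 * s))).
  { intros p q Hp Hq Bp Bq Bpq. eapply Rle_trans. apply seg_int_affine with (e := e / 9 * (3 * s)); trivial.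
    nra. apply (ex_seg_int D); trivial; lra.
    intros t Ht. assert (Ht1 := seg_dist p q x t _ Ht Bp Bq).
    replace (f (seg p q t) - (f x - x * l + l * seg p q t))%C with
      (f (seg p q t) - f x - (seg p q t - x) * l)%C by ring.
    eapply Rle_trans. apply Hd1. lra. apply Rmult_le_compat_l; lra.
    apply Rmult_le_compat_r; nra. }
  assert (E1 := Est x' y' Hx' Hy' Bx By Hxy). assert (E2 := Est y' z' Hy' Hz' By Bz Hyz).
  assert (E3 := Est z' x' Hz' Hx' Bz Bx Hzx).
  match type of E1 with Cmod ?A <= _ => match type of E2 with Cmod ?B <= _ =>
    match type of E3 with Cmod ?G <= _ =>
    assert (ET : tri_int f x' y' z' = (A + B + G)%C) by (unfold tri_int; field);
    assert (U1 := Cmod_triangle (A + B) G); assert (U2 := Cmod_triangle A B) end end end.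
  rewrite ET in HT. assert (0 < e * s ^ 2) by (apply Rmult_lt_0_compat; nra). nra.
Qed.

Lemma cvx_disc (rho : R) : cvx (fun z => Cmod z < rho).
Proof.
  intros x y t Hx Hy Ht. simpl.
  set (M := Rmax (Cmod x) (Cmod y)).
  apply Rle_lt_trans with M. 2: { unfold M. now apply Rmax_lub_lt. }
  replace (seg x y t) with (seg x y t - 0)%C by ring.
  apply seg_dist; trivial.
  replace (x - 0)%C with x by ring. apply Rmax_l.
  replace (y - 0)%C with y by ring. apply Rmax_r.
Qed.

Lemma Cmod_cont_diff (x y : C) : Rabs (Cmod x - Cmod y) <= Cmod (x - y).
Proof.
  assert (H1 : Cmod x <= Cmod (x - y) + Cmod y).
  { replace x with ((x - y) + y)%C at 1 by ring. apply Cmod_triangle. }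
  assert (H2 : Cmod y <= Cmod (x - y) + Cmod x).
  { rewrite Cmod_minus_sym. replace y with ((y - x) + x)%C at 1 by ring. apply Cmod_triangle. }
  apply Rabs_le. lra.
Qed.

(** Made for the difference quotient in Cauchy's formula, which at a is only known to be continuous.
    The corner of the triangle at a is cut off at a small scale e: the rest is covered by two
    triangles that avoid a, and the corner has a small perimeter on which f is bounded. *)
Lemma goursat_punctured_aux (rho : R) (f : C -> C) (a z w : C) :
  cont_on (fun z => Cmod z < rho) f ->
  (forall z, Cmod z < rho -> z <> a -> exists l, is_Cder f z l) ->
  Cmod a < rho -> Cmod z < rho -> Cmod w < rho -> Cmod (w - z) < Cmod (z - a) ->
  tri_int f a z w = RtoC 0.
Proof.
  intros Hc Hd Ha Hz Hw Hwz.
  assert (HD := cvx_disc rho).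
  (* A multiple of the coordinate of x - a in the direction z - a: it vanishes at a, is positive at
     z, and is positive at w because |w - z| < |z - a|. *)
  set (ell := fun x : C => Re ((x - a) * Cconj (z - a))%C).
  assert (Lz : ell z = Cmod (z - a) ^ 2).
  { unfold ell. rewrite Cmod2_alt. destruct (z - a)%C. simpl. ring. }
  assert (Hza : 0 < Cmod (z - a)) by (eapply Rle_lt_trans; [apply Cmod_ge_0 | exact Hwz]).
  assert (Lw : 0 < ell w).
  { assert (E : ell w = ell z + Re ((w - z) * Cconj (z - a))%C).
    { unfold ell. replace (w - a)%C with ((z - a) + (w - z))%C by ring.
      destruct (z - a)%C, (w - z)%C. simpl. ring. }
    assert (A := re_le_Cmod ((w - z) * Cconj (z - a))%C).
    rewrite Cmod_mult, Cmod_conj in A. apply Rabs_le_between in A. rewrite E, Lz. nra. }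
  assert (Lz' : 0 < ell z) by (rewrite Lz; nra).
  assert (Hfa := Hc a Ha). rewrite ccont_C_eps in Hfa.
  destruct (Hfa 1 Rlt_0_1) as (d & Hd0 & Hd1).
  set (L := Cmod (z - a) + Cmod (w - a) + 1).
  assert (HL1 := Cmod_ge_0 (w - a)).
  assert (HL : 0 < L) by (unfold L; lra).
  assert (HB := Cmod_ge_0 (f a)).
  set (B := Cmod (f a) + 1).
  apply Cmod_eq_0. apply Rle_antisym; [|apply Cmod_ge_0].
  apply Rle_eps. intros e0 He0. rewrite Rplus_0_l.
  (* The second term keeps the corner inside the disc around a where |f| <= B; the third makes the
     three short sides, each contributing at most e L B, negligible against e0. *)
  set (e := Rmin (/ 2) (Rmin (d / (2 * L)) (e0 / (4 * L * B)))).
  assert (He : 0 < e).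
  { unfold e. repeat apply Rmin_glb_lt. lra. apply Rdiv_lt_0_compat; lra.
    apply Rdiv_lt_0_compat; trivial. unfold B. apply Rmult_lt_0_compat; lra. }
  assert (He1 : e <= / 2) by apply Rmin_l.
  assert (He2 : e * (2 * L) <= d).
  { apply Rle_trans with (d / (2 * L) * (2 * L)). apply Rmult_le_compat_r. lra.
    unfold e. eapply Rle_trans. apply Rmin_r. apply Rmin_l. right; field; lra. }
  assert (He3 : e * (4 * L * B) <= e0).
  { apply Rle_trans with (e0 / (4 * L * B) * (4 * L * B)). apply Rmult_le_compat_r.
    unfold B. apply Rmult_le_pos; lra.
    unfold e. eapply Rle_trans. apply Rmin_r. apply Rmin_r. right; field. unfold B. lra. }
  assert (He01 : 0 <= e <= 1) by lra.
  set (a' := seg a z e). set (w' := seg a w e).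
  assert (Da' : Cmod a' < rho) by now apply HD.
  assert (Dw' : Cmod w' < rho) by now apply HD.
  set (R0 := Rmax (Cmod a) (Rmax (Cmod z) (Cmod w))).
  assert (HR0 : R0 < rho) by (unfold R0; repeat apply Rmax_lub_lt; trivial).
  set (kap := e * Rmin (ell z) (ell w)).
  assert (Hk : 0 < kap) by (unfold kap; apply Rmult_lt_0_compat; trivial; now apply Rmin_glb_lt).
  assert (Hk1 : kap <= e * ell z) by (unfold kap; apply Rmult_le_compat_l; [lra | apply Rmin_l]).
  assert (Hk2 : kap <= e * ell w) by (unfold kap; apply Rmult_le_compat_l; [lra | apply Rmin_r]).
  (* A closed convex set that omits a, since ell a = 0 < kap, and contains z, w and the two cut
     points a' and w'. *)
  set (D := fun x : C => Cmod x <= R0 /\ kap <= ell x).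
  assert (Rsub : forall x, Cmod x <= R0 <-> Cmod (x - 0) <= R0).
  { intros x. replace (x - 0)%C with x by ring. tauto. }
  assert (Ra : Cmod a <= R0) by apply Rmax_l.
  assert (Rz : Cmod z <= R0) by (eapply Rle_trans; [apply Rmax_l | apply Rmax_r]).
  assert (Rw : Cmod w <= R0) by (eapply Rle_trans; [apply Rmax_r | apply Rmax_r]).
  assert (Dcv : cvx D).
  { intros x y t [Hx1 Hx2] [Hy1 Hy2] Ht. split.
    apply (proj2 (Rsub _)). apply seg_dist; trivial; now apply (proj1 (Rsub _)).
    assert (E : ell (seg x y t) = (1 - t) * ell x + t * ell y).
    { unfold ell, seg. destruct x, y, a, z. simpl. ring. }
    rewrite E. nra. }
  assert (Dcl : cclosed D).
  { intros x Hx. split.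
    - apply Rle_eps. intros eps Heps. destruct (Hx eps Heps) as (y & [Hy1 _] & Hy).
      assert (A := Cmod_cont_diff y x). apply Rabs_le_between in A. lra.
    - apply Rle_eps. intros eps Heps. destruct (Hx (eps / Cmod (z - a))) as (y & [_ Hy2] & Hy).
      now apply Rdiv_lt_0_compat.
      assert (E : ell y = ell x + Re ((y - x) * Cconj (z - a))%C).
      { unfold ell. destruct y, x, a, z; simpl; ring. }
      assert (A := re_le_Cmod ((y - x) * Cconj (z - a))%C).
      rewrite Cmod_mult, Cmod_conj in A. apply Rabs_le_between in A.
      apply (Rmult_lt_compat_r (Cmod (z - a))) in Hy; trivial.
      unfold Rdiv in Hy. rewrite Rmult_assoc, Rinv_l in Hy by lra. lra. }
  assert (Dd : forall x, D x -> exists l, is_Cder f x l).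
  { intros x [Hx1 Hx2]. apply Hd. lra. intros ->. unfold ell in Hx2.
    replace (a - a)%C with (RtoC 0) in Hx2 by ring. simpl in Hx2. lra. }
  assert (Dz : D z). { split; trivial. nra. }
  assert (Dw : D w). { split; trivial. nra. }
  assert (Dda' : D a').
  { split. apply (proj2 (Rsub _)). apply seg_dist; trivial; now apply (proj1 (Rsub _)).
    assert (E : ell a' = e * ell z).
    { unfold ell, a', seg. destruct a, z; simpl; ring. } lra. }
  assert (Ddw' : D w').
  { split. apply (proj2 (Rsub _)). apply seg_dist; trivial; now apply (proj1 (Rsub _)).
    assert (E : ell w' = e * ell w).
    { unfold ell, w', seg. destruct a, z, w; simpl; ring. } lra. }
  assert (G1 := goursat D f a' z w Dcv Dcl Dd Dda' Dz Dw).
  assert (G2 := goursat D f a' w w' Dcv Dcl Dd Dda' Dw Ddw').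
  assert (Sz := seg_int_split _ f a z e Hc HD Ha Hz He01). fold a' in Sz.
  assert (Sw := seg_int_split _ f a w e Hc HD Ha Hw He01). fold w' in Sw.
  assert (Rw1 := seg_int_rev _ f a w Hc HD Ha Hw).
  assert (Rw2 := seg_int_rev _ f a' w Hc HD Da' Hw).
  assert (Rw3 := seg_int_rev _ f w' w Hc HD Dw' Hw).
  assert (E : tri_int f a z w = (seg_int f a a' - seg_int f a w' - seg_int f w' a')%C).
  { unfold tri_int in *. rewrite Rw1, Sz, Sw. rewrite Rw2 in G1. rewrite Rw3 in G2.
    transitivity (seg_int f a a' - seg_int f a w' - seg_int f w' a' + (seg_int f a' z + seg_int f z w + - seg_int f a' w) +
       (seg_int f a' w + - seg_int f w' w + seg_int f w' a'))%C. ring. rewrite G1, G2. ring. }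
  assert (Small : forall p q, Cmod p < rho -> Cmod q < rho -> Cmod (p - a) <= e * L -> Cmod (q - a) <= e * L ->
     Cmod (q - p) <= e * L -> Cmod (seg_int f p q) <= e * L * B).
  { intros p q Hp Hq Bp Bq Bpq.
    replace (seg_int f p q) with (seg_int f p q - (q - p) * 0)%C by ring.
    eapply Rle_trans. apply (seg_int_const_bound f p q 0 B). unfold B; lra.
    apply (ex_seg_int (fun z => Cmod z < rho)); trivial; lra.
    intros t Ht. replace (f (seg p q t) - 0)%C with ((f (seg p q t) - f a) + f a)%C by ring.
    eapply Rle_trans. apply Cmod_triangle. unfold B. rewrite Rplus_comm. apply Rplus_le_compat_l.
    apply Rlt_le, Hd1. eapply Rle_lt_trans. apply seg_dist with (d := e * L); trivial. nra.
    apply Rmult_le_compat_r; trivial. unfold B; lra. }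
  assert (Ba' : Cmod (a' - a) = e * Cmod (z - a)).
  { unfold a', seg. replace (a + e * (z - a) - a)%C with (e * (z - a))%C by ring.
    rewrite Cmod_mult, Cmod_R, Rabs_right; lra. }
  assert (Bw' : Cmod (w' - a) = e * Cmod (w - a)).
  { unfold w', seg. replace (a + e * (w - a) - a)%C with (e * (w - a))%C by ring.
    rewrite Cmod_mult, Cmod_R, Rabs_right; lra. }
  assert (Baw : Cmod (a' - w') <= e * L).
  { replace (a' - w')%C with ((a' - a) - (w' - a))%C by ring. unfold Cminus at 1.
    eapply Rle_trans. apply Cmod_triangle. rewrite Cmod_opp, Ba', Bw'. unfold L. nra. }
  assert (B0 : Cmod (a - a) <= e * L).
  { replace (a - a)%C with (RtoC 0) by ring. rewrite Cmod_0. nra. }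
  assert (B1 : Cmod (a' - a) <= e * L) by (rewrite Ba'; unfold L; nra).
  assert (B2 : Cmod (w' - a) <= e * L) by (rewrite Bw'; unfold L; nra).
  rewrite E. unfold Cminus. eapply Rle_trans. apply Cmod_triangle. rewrite Cmod_opp.
  assert (U := Cmod_triangle (seg_int f a a') (- seg_int f a w')). rewrite Cmod_opp in U.
  assert (V1 := Small a a' Ha Da' B0 B1 B1). assert (V2 := Small a w' Ha Dw' B0 B2 B2).
  assert (V3 := Small w' a' Dw' Da' B2 B1 Baw).
  assert (0 < e * L * B). { unfold B. repeat apply Rmult_lt_0_compat; lra. } nra.
Qed.

(** The increment of the primitive from z to w is the integral over [z, w] by the triangle a, z, w.
    That triangle is admissible when |w - z| < |z - a|, whence d'; at z = a the increment is the
    segment integral itself. *)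
Lemma primitive_punctured (rho : R) (f : C -> C) (a z : C) :
  cont_on (fun z => Cmod z < rho) f ->
  (forall z, Cmod z < rho -> z <> a -> exists l, is_Cder f z l) ->
  Cmod a < rho -> Cmod z < rho -> is_Cder (seg_int f a) z (f z).
Proof.
  intros Hc Hd Ha Hz. assert (HD := cvx_disc rho).
  apply is_Cder_eps. intros e He.
  assert (Hfz := Hc z Hz). rewrite ccont_C_eps in Hfz.
  destruct (Hfz e He) as (d & Hd0 & Hd1).
  set (d' := if excluded_middle_informative (z = a) then 1 else Cmod (z - a)).
  assert (Hd' : 0 < d').
  { unfold d'. destruct (excluded_middle_informative (z = a)). lra.
    now apply Cmod_pos_neq, Cminus_neq_0. }
  exists (Rmin d (Rmin d' (rho - Cmod z))). split.
  { repeat apply Rmin_glb_lt; trivial; lra. }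
  intros w Hw. assert (Hw1 := Rlt_le_trans _ _ _ Hw (Rmin_l _ _)).
  assert (Hw2 := Rlt_le_trans _ _ _ Hw (Rmin_r _ _)).
  assert (Hw3 := Rlt_le_trans _ _ _ Hw2 (Rmin_l _ _)).
  assert (Hw4 := Rlt_le_trans _ _ _ Hw2 (Rmin_r _ _)).
  assert (Hwr : Cmod w < rho).
  { assert (A := Cmod_cont_diff w z). apply Rabs_le_between in A. lra. }
  assert (E : (seg_int f a w - seg_int f a z = seg_int f z w)%C).
  { unfold d' in Hw3. destruct (excluded_middle_informative (z = a)) as [->|Hn].
    - unfold seg_int at 2. replace (a - a)%C with (RtoC 0) by ring. ring.
    - assert (G := goursat_punctured_aux rho f a z w Hc Hd Ha Hz Hwr Hw3).
      unfold tri_int in G. rewrite (seg_int_rev _ f a w Hc HD Ha Hwr) in G.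
      transitivity (seg_int f a w - seg_int f a z + (seg_int f a z + seg_int f z w + - seg_int f a w))%C. rewrite G. ring. ring. }
  rewrite E. rewrite (Rmult_comm e). apply seg_int_const_bound. lra.
  apply (ex_seg_int _ f z w 0 1 Hc HD); trivial; lra.
  intros t Ht. apply Rlt_le, Hd1. apply Rle_lt_trans with (2 := Hw1).
  apply seg_dist; trivial. 2: lra. replace (z - z)%C with (RtoC 0) by ring.
  rewrite Cmod_0. apply Cmod_ge_0.
Qed.

(** * Cauchy's formula *)

Definition pcont (u : R -> C) : Prop := forall t, ccont u t.
Definition cmean (u : R -> C) : C := (RtoC (/ (2 * PI)) * CInt u 0 (2 * PI))%C.
Definition rmean (u : R -> R) : R := / (2 * PI) * RInt u 0 (2 * PI).

Lemma two_PI_pos : 0 < 2 * PI.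
Proof. assert (H := PI_RGT_0). lra. Qed.

Lemma inv_two_PI_pos : 0 < / (2 * PI).
Proof. apply Rinv_0_lt_compat, two_PI_pos. Qed.

Lemma pcont_ex (u : R -> C) (a b : R) : a <= b -> pcont u -> ex_CInt u a b.
Proof. intros Hab H. apply ex_CInt_cont; trivial. Qed.

Lemma rcont_ex (u : R -> R) (a b : R) : a <= b -> (forall t, continuous u t) -> ex_RInt u a b.
Proof. intros Hab H. apply ex_RInt_cont; trivial. Qed.

Lemma cmean_ext (u v : R -> C) : (forall t, u t = v t) -> cmean u = cmean v.
Proof. intros H. unfold cmean. f_equal. apply CInt_ext. assert (P := two_PI_pos); lra. auto. Qed.

Lemma cmean_plus (u v : R -> C) : pcont u -> pcont v ->
  cmean (fun t => (u t + v t)%C) = (cmean u + cmean v)%C.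
Proof.
  intros Hu Hv. unfold cmean. assert (P := two_PI_pos).
  rewrite CInt_plus by (apply pcont_ex; trivial; lra). ring.
Qed.

Lemma cmean_minus (u v : R -> C) : pcont u -> pcont v ->
  cmean (fun t => (u t - v t)%C) = (cmean u - cmean v)%C.
Proof.
  intros Hu Hv. unfold cmean. assert (P := two_PI_pos).
  rewrite CInt_minus by (apply pcont_ex; trivial; lra). ring.
Qed.

Lemma cmean_scal (c : C) (u : R -> C) : pcont u ->
  cmean (fun t => (c * u t)%C) = (c * cmean u)%C.
Proof.
  intros Hu. unfold cmean. assert (P := two_PI_pos).
  rewrite CInt_scal by (apply pcont_ex; trivial; lra). ring.
Qed.

Lemma cmean_const (c : C) : cmean (fun _ => c) = c.
Proof.
  unfold cmean. rewrite CInt_const. assert (P := PI_RGT_0).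
  rewrite Rminus_0_r, Cmult_assoc, <- RtoC_mult, Rinv_l by lra. ring.
Qed.

Lemma rmean_const (c : R) : rmean (fun _ => c) = c.
Proof. unfold rmean. rewrite RInt_const_R. field. assert (P := PI_RGT_0). lra. Qed.

Lemma rmean_le (u v : R -> R) : (forall t, continuous u t) -> (forall t, continuous v t) ->
  (forall t, u t <= v t) -> rmean u <= rmean v.
Proof.
  intros Hu Hv H. unfold rmean. assert (P := two_PI_pos). assert (Q := inv_two_PI_pos).
  apply Rmult_le_compat_l. lra. apply RInt_le. lra. apply rcont_ex; trivial; lra.
  apply rcont_ex; trivial; lra. auto.
Qed.

Lemma rmean_plus (u v : R -> R) : (forall t, continuous u t) -> (forall t, continuous v t) ->
  rmean (fun t => u t + v t) = rmean u + rmean v.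
Proof.
  intros Hu Hv. unfold rmean. assert (P := two_PI_pos).
  rewrite (RInt_plus (V := R_CompleteNormedModule)) by (apply rcont_ex; trivial; lra).
  unfold plus; simpl. ring.
Qed.

Lemma rmean_scal (c : R) (u : R -> R) : (forall t, continuous u t) ->
  rmean (fun t => c * u t) = c * rmean u.
Proof.
  intros Hu. unfold rmean. assert (P := two_PI_pos).
  rewrite (RInt_scal (V := R_CompleteNormedModule)) by (apply rcont_ex; trivial; lra).
  unfold scal; simpl. unfold mult; simpl. ring.
Qed.

Lemma rmean_ge0 (u : R -> R) : (forall t, continuous u t) -> (forall t, 0 <= u t) -> 0 <= rmean u.
Proof.
  intros Hu H. rewrite <- (rmean_const 0). apply rmean_le; trivial.
  intros t. apply continuous_const.
Qed.

Lemma cmean_norm (u : R -> C) (m : R -> R) : pcont u -> (forall t, continuous m t) ->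
  (forall t, Cmod (u t) <= m t) -> Cmod (cmean u) <= rmean m.
Proof.
  intros Hu Hm H. unfold cmean, rmean. assert (P := two_PI_pos). assert (Q := inv_two_PI_pos).
  rewrite Cmod_mult, Cmod_R, Rabs_right by lra. apply Rmult_le_compat_l. lra.
  apply CInt_norm. lra. apply pcont_ex; trivial; lra. apply rcont_ex; trivial; lra. auto.
Qed.

Lemma cmean_conj (u : R -> C) : pcont u -> cmean (fun t => Cconj (u t)) = Cconj (cmean u).
Proof.
  intros Hu. unfold cmean. assert (P := two_PI_pos).
  assert (E : CInt (fun t => Cconj (u t)) 0 (2 * PI) = Cconj (CInt u 0 (2 * PI))).
  { assert (Hex : ex_CInt u 0 (2 * PI)) by (apply pcont_ex; trivial; lra).
    apply CInt_unique. apply is_CInt_pair; simpl. split. now apply CInt_fst.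
    apply (is_RInt_opp (V := R_NormedModule)). now apply CInt_snd. }
  rewrite E. apply injective_projections; simpl; ring.
Qed.

Lemma cmean_RtoC (u : R -> R) : (forall t, continuous u t) ->
  cmean (fun t => RtoC (u t)) = RtoC (rmean u).
Proof.
  intros Hu. unfold cmean, rmean. assert (P := two_PI_pos).
  rewrite CInt_RtoC by (apply rcont_ex; trivial; lra). now rewrite RtoC_mult.
Qed.

Lemma Cmod_circle_pt (r t : R) : 0 <= r -> Cmod (circle_pt r t) = r.
Proof.
  intros Hr. unfold Cmod, circle_pt. simpl.
  replace (r * cos t * (r * cos t * 1) + r * sin t * (r * sin t * 1))
    with (r * r * (Rsqr (sin t) + Rsqr (cos t))) by (unfold Rsqr; ring).
  rewrite sin2_cos2, Rmult_1_r. now apply sqrt_square.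
Qed.

Lemma circle_pt_scal (r s t : R) : circle_pt (r * s) t = (RtoC r * circle_pt s t)%C.
Proof. unfold circle_pt. apply injective_projections; simpl; ring. Qed.

Lemma circle_pt_2PI (r : R) : circle_pt r (2 * PI) = circle_pt r 0.
Proof. unfold circle_pt. now rewrite cos_2PI, sin_2PI, cos_0, sin_0. Qed.

Lemma circle_pt_conj (r t : R) :
  (circle_pt r t * Cconj (circle_pt r t))%C = RtoC (r * r).
Proof.
  unfold circle_pt. apply injective_projections; simpl. 2: ring.
  transitivity (r * r * (Rsqr (sin t) + Rsqr (cos t))). unfold Rsqr; ring.
  rewrite sin2_cos2. ring.
Qed.

Lemma is_Rder_circle (Q : C -> C) (r t : R) (l : C) :
  is_Cder Q (circle_pt r t) l ->
  is_Rder (fun s => Q (circle_pt r s)) t (Ci * circle_pt r t * l)%C.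
Proof.
  intros H. apply is_Rder_comp; trivial; unfold circle_pt; simpl; auto_derive; auto; ring.
Qed.

Lemma pcont_circle (r : R) : pcont (fun t => circle_pt r t).
Proof. intros t. apply ccont_circle_pt. Qed.

(** On the circle dz = i z dt, so the mean of z f(z) is the contour integral of f divided by 2 PI i,
    and a primitive makes it vanish. *)
Lemma closed_circle (rho R0 : R) (f Q : C -> C) :
  0 < R0 < rho -> cont_on (fun z => Cmod z < rho) f ->
  (forall z, Cmod z < rho -> is_Cder Q z (f z)) ->
  cmean (fun t => (circle_pt R0 t * f (circle_pt R0 t))%C) = RtoC 0.
Proof.
  intros HR Hf HQ. assert (P := two_PI_pos).
  assert (Hc : pcont (fun t => (circle_pt R0 t * f (circle_pt R0 t))%C)).
  { intros t. apply ccont_mult. apply pcont_circle. apply ccont_comp. apply pcont_circle.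
    apply Hf. rewrite Cmod_circle_pt; lra. }
  assert (E : CInt (fun t => (Ci * circle_pt R0 t * f (circle_pt R0 t))%C) 0 (2 * PI) = RtoC 0).
  { rewrite (CInt_FTC (fun t => Q (circle_pt R0 t))).
    - rewrite circle_pt_2PI. ceq. ring.
    - lra.
    - intros t _. apply is_Rder_circle, HQ. rewrite Cmod_circle_pt; lra.
    - intros t _. apply ccont_ext with (fun t => (Ci * (circle_pt R0 t * f (circle_pt R0 t)))%C).
      intros; ring. apply ccont_mult. apply ccont_const. apply Hc. }
  rewrite (CInt_ext _ (fun t => (Ci * (circle_pt R0 t * f (circle_pt R0 t)))%C)) in E;
    [|lra|intros; ceq; ring].
  rewrite CInt_scal in E by (apply pcont_ex; trivial; lra).
  unfold cmean. replace (CInt (fun t => (circle_pt R0 t * f (circle_pt R0 t))%C) 0 (2 * PI))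
    with (- Ci * (Ci * CInt (fun t => (circle_pt R0 t * f (circle_pt R0 t))%C) 0 (2 * PI)))%C.
  rewrite E. ring. apply injective_projections; simpl; ring.
Qed.

Lemma is_Cder_ext_loc (f g : C -> C) (z l : C) (d : R) : 0 < d ->
  (forall w, Cmod (w - z) < d -> f w = g w) -> is_Cder f z l -> is_Cder g z l.
Proof.
  intros Hd H. rewrite !is_Cder_eps. intros H1 e He. destruct (H1 e He) as (d' & Hd' & H2).
  exists (Rmin d d'). split. now apply Rmin_glb_lt. intros w Hw.
  rewrite <- !H. apply H2. eapply Rlt_le_trans; [exact Hw | apply Rmin_r].
  replace (z - z)%C with (RtoC 0) by ring. now rewrite Cmod_0.
  eapply Rlt_le_trans; [exact Hw | apply Rmin_l].
Qed.

Lemma circle_neq (R0 t : R) (a : C) : 0 <= R0 -> Cmod a < R0 -> (circle_pt R0 t - a)%C <> RtoC 0.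
Proof.
  intros HR Ha. apply Cminus_neq_0. intros E. rewrite <- E, Cmod_circle_pt in Ha; lra.
Qed.

Lemma pcont_kernel (R0 : R) (a : C) : 0 <= R0 -> Cmod a < R0 ->
  pcont (fun t => (/ (circle_pt R0 t - a))%C).
Proof.
  intros HR Ha t. apply ccont_inv. apply ccont_minus. apply pcont_circle. apply ccont_const.
  now apply circle_neq.
Qed.

Lemma pcont_mult (u v : R -> C) : pcont u -> pcont v -> pcont (fun t => (u t * v t)%C).
Proof. intros Hu Hv t. now apply ccont_mult. Qed.

Lemma pcont_minus (u v : R -> C) : pcont u -> pcont v -> pcont (fun t => (u t - v t)%C).
Proof. intros Hu Hv t. now apply ccont_minus. Qed.

Lemma pcont_plus (u v : R -> C) : pcont u -> pcont v -> pcont (fun t => (u t + v t)%C).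
Proof. intros Hu Hv t. now apply ccont_plus. Qed.

Lemma pcont_const (c : C) : pcont (fun t => c).
Proof. intros t. apply ccont_const. Qed.

Ltac pc := repeat match goal with
  | H : pcont ?u |- pcont ?u => exact H
  | |- pcont (fun _ => ?c) => apply pcont_const
  | |- pcont (fun t => circle_pt _ t) => apply pcont_circle
  | |- pcont (fun t => (@?u t * @?v t)%C) => apply (pcont_mult u v)
  | |- pcont (fun t => (@?u t + @?v t)%C) => apply (pcont_plus u v)
  | |- pcont (fun t => (@?u t - @?v t)%C) => apply (pcont_minus u v)
  end; try assumption.

Lemma pcont_ana (rho R0 : R) (f : C -> C) : 0 <= R0 < rho -> ana rho f ->
  pcont (fun t => f (circle_pt R0 t)).
Proof.
  intros HR Hf t. apply ccont_comp. apply pcont_circle. apply ana_ccont with rho; trivial.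
  rewrite Cmod_circle_pt; lra.
Qed.

(** The difference quotient q of f at a is continuous on the disc and differentiable off a, hence
    has a primitive, and the mean of z q(z) is zero. Written out, this is Cauchy's formula up to the
    value of the mean of the kernel. *)
Lemma cauchy_aux (rho R0 : R) (f : C -> C) (a : C) :
  ana rho f -> 0 < R0 < rho -> Cmod a < R0 ->
  cmean (fun t => (f (circle_pt R0 t) * (circle_pt R0 t / (circle_pt R0 t - a)))%C) =
  (f a * cmean (fun t => (circle_pt R0 t / (circle_pt R0 t - a))%C))%C.
Proof.
  intros Hf HR Ha.
  destruct (ana_der rho f a Hf) as [l Hl]. lra.
  apply is_Cder_cara in Hl. destruct Hl as (q & Hq1 & Hq2 & Hq3).
  assert (Hqv : forall z, z <> a -> q z = ((f z - f a) / (z - a))%C).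
  { intros z Hz. rewrite (Hq1 z). field. now apply Cminus_neq_0. }
  assert (Hqd : forall z, Cmod z < rho -> z <> a -> exists l, is_Cder q z l).
  { intros z Hz Hn. destruct (ana_der rho f z Hf Hz) as [m Hm].
    eexists. apply is_Cder_ext_loc with (f := fun w => ((f w - f a) * / (w - a))%C) (d := Cmod (z - a)).
    apply Cmod_pos_neq. now apply Cminus_neq_0.
    - intros w Hw. symmetry. apply Hqv. intros ->. rewrite Cmod_minus_sym in Hw. lra.
    - apply is_Cder_mult. apply is_Cder_minus. exact Hm. apply is_Cder_const.
      apply is_Cder_inv. now apply Cminus_neq_0.
      apply is_Cder_minus. apply is_Cder_id. apply is_Cder_const. }
  assert (Hqc : cont_on (fun z => Cmod z < rho) q).
  { intros z Hz. destruct (classic (z = a)) as [->|Hn]; trivial.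
    destruct (Hqd z Hz Hn) as [m Hm]. now apply is_Cder_ccont with m. }
  assert (E := closed_circle rho R0 q (seg_int q a) HR Hqc
    (fun z Hz => primitive_punctured rho q a z Hqc Hqd ltac:(lra) Hz)).
  assert (Hk : pcont (fun t => (circle_pt R0 t / (circle_pt R0 t - a))%C)).
  { apply pcont_mult. apply pcont_circle. apply pcont_kernel; lra. }
  assert (Hfc : pcont (fun t => f (circle_pt R0 t))) by (apply (pcont_ana rho); trivial; lra).
  rewrite <- cmean_scal by trivial.
  rewrite (cmean_ext _ (fun t => (f (circle_pt R0 t) * (circle_pt R0 t / (circle_pt R0 t - a))
     - f a * (circle_pt R0 t / (circle_pt R0 t - a)))%C)) in E.
  rewrite cmean_minus in E; try (apply pcont_mult; trivial; apply pcont_const).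
  match type of E with (?A - ?B)%C = _ => transitivity ((A - B) + B)%C end.
  ring. rewrite E. ring.
  intros t. assert (Hn := circle_neq R0 t a ltac:(lra) Ha). rewrite Hqv. field; trivial.
  intros E'. apply Hn. rewrite E'. ring.
Qed.

(** [cauchy_aux] is applied to h at the point 0, where the kernel is identically 1: the mean of h is
    h 0 = 1, and the mean sought is its conjugate. *)
Lemma cmean_cauchy_kernel (R0 : R) (a : C) : 0 < R0 -> Cmod a < R0 ->
  cmean (fun t => (circle_pt R0 t / (circle_pt R0 t - a))%C) = RtoC 1.
Proof.
  intros HR Ha. assert (HRn : RtoC R0 <> RtoC 0) by (intros E; apply RtoC_inj in E; lra).
  (* on the circle the conjugate of the kernel is [h], which is analytic across it *)
  set (h := fun z : C => (/ (1 - Cconj a * z / (R0 * R0)))%C).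
  assert (Hna := Cmod_ge_0 a).
  (* The pole of h has modulus R0^2 / |a|. Enlarging |a| to (R0 + |a|) / 2 gives a radius still
     greater than R0, also for a = 0. *)
  set (rho := R0 * R0 / ((R0 + Cmod a) / 2)).
  assert (Hrho : R0 < rho).
  { unfold rho. apply Rmult_lt_reg_r with ((R0 + Cmod a) / 2). lra.
    unfold Rdiv at 2. rewrite Rmult_assoc, Rinv_l by lra. nra. }
  assert (Hh0 : forall z, Cmod z < rho -> (1 - Cconj a * z / (R0 * R0))%C <> RtoC 0).
  { intros z Hz. apply Cminus_neq_0. intros E.
    assert (E1 : Cmod (Cconj a * z / (R0 * R0)) = 1) by (rewrite <- E; apply Cmod_1).
    rewrite Cmod_div in E1 by (now apply Cmult_neq_0).
    rewrite !Cmod_mult, Cmod_conj, Cmod_R, Rabs_right in E1 by lra.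
    assert (E2 : Cmod a * Cmod z = R0 * R0).
    { replace (Cmod a * Cmod z) with (Cmod a * Cmod z / (R0 * R0) * (R0 * R0)) by (field; lra).
      rewrite E1. ring. }
    assert (E3 : rho * ((R0 + Cmod a) / 2) = R0 * R0) by (unfold rho; field; lra).
    assert (Hz0 := Cmod_ge_0 z). nra. }
  assert (Hh : ana rho h).
  { apply ana_inv; trivial. apply ana_minus. apply ana_const.
    unfold Cdiv. apply ana_mult. apply ana_mult. apply ana_const. apply ana_id. apply ana_const. }
  assert (E := cauchy_aux rho R0 h 0 Hh ltac:(lra) ltac:(rewrite Cmod_0; lra)).
  assert (Hc1 : forall t, circle_pt R0 t <> RtoC 0).
  { intros t E'. assert (A := Cmod_circle_pt R0 t ltac:(lra)). rewrite E', Cmod_0 in A. lra. }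
  rewrite (cmean_ext _ (fun t => Cconj (circle_pt R0 t / (circle_pt R0 t - a)))%C) in E.
  rewrite cmean_conj in E.
  rewrite (cmean_ext (fun t => (circle_pt R0 t / (circle_pt R0 t - 0))%C) (fun _ => RtoC 1)) in E.
  rewrite cmean_const in E.
  replace (h 0 * 1)%C with (RtoC 1) in E.
  match type of E with Cconj ?A = _ => transitivity (Cconj (Cconj A)) end.
  destruct (cmean _); unfold Cconj; simpl; now rewrite Ropp_involutive.
  rewrite E. unfold Cconj; simpl. apply injective_projections; simpl; ring.
  unfold h. field. exact HRn.
  intros t. field. replace (circle_pt R0 t - 0)%C with (circle_pt R0 t) by ring. apply Hc1.
  apply pcont_mult. apply pcont_circle. apply pcont_kernel; lra.
  intros t. rewrite Cdiv_conj, Cminus_conj by (now apply circle_neq; lra).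
  assert (K := circle_pt_conj R0 t).
  assert (Kz : Cconj (circle_pt R0 t) = (R0 * R0 / circle_pt R0 t)%C).
  { rewrite <- RtoC_mult, <- K. field. apply Hc1. }
  assert (Hz := Hh0 (circle_pt R0 t) ltac:(rewrite Cmod_circle_pt; lra)).
  rewrite Kz. unfold h.
  assert (Hz2 : (R0 * R0 - Cconj a * circle_pt R0 t)%C <> RtoC 0).
  { intros E'. apply Hz. transitivity ((R0 * R0 - Cconj a * circle_pt R0 t) / (R0 * R0))%C.
    field; trivial. rewrite E'. field; trivial. }
  specialize (Hc1 t).
  field. repeat split; trivial.
Qed.

Lemma cauchy_formula (rho R0 : R) (f : C -> C) (a : C) :
  ana rho f -> 0 < R0 < rho -> Cmod a < R0 ->
  f a = cmean (fun t => (f (circle_pt R0 t) * circle_pt R0 t * / (circle_pt R0 t - a))%C).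
Proof.
  intros Hf HR Ha.
  rewrite (cmean_ext _ (fun t => (f (circle_pt R0 t) * (circle_pt R0 t / (circle_pt R0 t - a)))%C)).
  rewrite (cauchy_aux rho), cmean_cauchy_kernel; trivial; try lra. ring.
  intros t. unfold Cdiv. ring.
Qed.

(** * Cauchy estimates and Taylor polynomials *)

Lemma pcont_Cmod (u : R -> C) : pcont u -> forall t, continuous (fun t => Cmod (u t)) t.
Proof. intros H t. apply ccont_Cmod, H. Qed.

Lemma cmean_mult_bound (k X : R -> C) (B : R) : pcont k -> pcont X ->
  (forall t, Cmod (X t) <= B) ->
  Cmod (cmean (fun t => (k t * X t)%C)) <= B * rmean (fun t => Cmod (k t)).
Proof.
  intros Hk HX H. rewrite <- rmean_scal by (now apply pcont_Cmod).
  apply cmean_norm. now apply pcont_mult.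
  intros t. apply (continuous_scal_r (V := R_NormedModule)). now apply pcont_Cmod.
  intros t. rewrite Cmod_mult, Rmult_comm. apply Rmult_le_compat_r; trivial. apply Cmod_ge_0.
Qed.

(** Cauchy transform of an arbitrary continuous density on the circle. [CT2] and [CT3] carry the
    squared and cubed kernels, so the first two derivatives of [CT1] are [CT2] and [2 * CT3]. Free
    densities allow its use for outer functions and for Weierstrass's theorem as well. *)
Definition CT1 (R0 : R) (k : R -> C) (a : C) : C :=
  cmean (fun t => (k t * / (circle_pt R0 t - a))%C).
Definition CT2 (R0 : R) (k : R -> C) (a : C) : C :=
  cmean (fun t => (k t * (/ (circle_pt R0 t - a) * / (circle_pt R0 t - a)))%C).
Definition CT3 (R0 : R) (k : R -> C) (a : C) : C :=
  cmean (fun t => (k t * (/ (circle_pt R0 t - a) * / (circle_pt R0 t - a) * / (circle_pt R0 t - a)))%C).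

Lemma kernel_bound (R0 p t : R) (a : C) : 0 <= R0 -> p < R0 -> Cmod a <= p ->
  Cmod (/ (circle_pt R0 t - a)) <= / (R0 - p).
Proof.
  intros HR Hp Ha. rewrite Cmod_inv by (apply circle_neq; lra).
  apply Rinv_le_contravar. lra.
  assert (A := Cmod_cont_diff (circle_pt R0 t) a). rewrite Cmod_circle_pt in A by lra.
  apply Rabs_le_between in A. lra.
Qed.

Lemma CT1_lip (R0 p : R) (k : R -> C) (a b : C) : pcont k -> 0 <= R0 -> p < R0 ->
  Cmod a <= p -> Cmod b <= p ->
  Cmod (CT1 R0 k b - CT1 R0 k a) <= Cmod (b - a) * (/ (R0 - p)) ^ 2 * rmean (fun t => Cmod (k t)).
Proof.
  intros Hk HR Hp Ha Hb. unfold CT1.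
  assert (K1 := pcont_kernel R0 a HR ltac:(lra)). assert (K2 := pcont_kernel R0 b HR ltac:(lra)).
  rewrite <- cmean_minus by pc.
  rewrite (cmean_ext _ (fun t => (k t * ((b - a) * (/ (circle_pt R0 t - a) * / (circle_pt R0 t - b))))%C)).
  apply cmean_mult_bound; trivial.
  pc.
  intros t. rewrite !Cmod_mult. apply Rmult_le_compat_l. apply Cmod_ge_0.
  assert (A1 := kernel_bound R0 p t a HR Hp Ha). assert (A2 := kernel_bound R0 p t b HR Hp Hb).
  assert (B1 := Cmod_ge_0 (/ (circle_pt R0 t - a))). assert (B2 := Cmod_ge_0 (/ (circle_pt R0 t - b))).
  nra.
  intros t. assert (N1 := circle_neq R0 t a HR ltac:(lra)). assert (N2 := circle_neq R0 t b HR ltac:(lra)).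
  field. split; trivial.
Qed.

(** With u = 1/(c - a) and v = 1/(c - b) the remainder of the kernel is exactly (b - a)^2 u^2 v,
    which gives a bound uniform in a and b on the disc of radius p. *)
Lemma CT1_quad (R0 p : R) (k : R -> C) (a b : C) : pcont k -> 0 <= R0 -> p < R0 ->
  Cmod a <= p -> Cmod b <= p ->
  Cmod (CT1 R0 k b - CT1 R0 k a - (b - a) * CT2 R0 k a) <=
  Cmod (b - a) ^ 2 * (/ (R0 - p)) ^ 3 * rmean (fun t => Cmod (k t)).
Proof.
  intros Hk HR Hp Ha Hb. unfold CT1, CT2.
  assert (K1 := pcont_kernel R0 a HR ltac:(lra)). assert (K2 := pcont_kernel R0 b HR ltac:(lra)).
  rewrite <- cmean_scal, <- !cmean_minus by pc.
  rewrite (cmean_ext _ (fun t => (k t * ((b - a) * (b - a) *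
    (/ (circle_pt R0 t - a) * / (circle_pt R0 t - a) * / (circle_pt R0 t - b))))%C)).
  apply cmean_mult_bound; trivial.
  pc.
  intros t. rewrite !Cmod_mult. apply Rle_trans with
    (Cmod (b - a) * Cmod (b - a) * (/ (R0 - p) * / (R0 - p) * / (R0 - p))).
  2: right; ring.
  assert (A1 := kernel_bound R0 p t a HR Hp Ha). assert (A2 := kernel_bound R0 p t b HR Hp Hb).
  assert (B1 := Cmod_ge_0 (/ (circle_pt R0 t - a))). assert (B2 := Cmod_ge_0 (/ (circle_pt R0 t - b))).
  apply Rmult_le_compat_l. apply Rmult_le_pos; apply Cmod_ge_0.
  repeat apply Rmult_le_compat; trivial; apply Rmult_le_pos; trivial.
  intros t. assert (N1 := circle_neq R0 t a HR ltac:(lra)). assert (N2 := circle_neq R0 t b HR ltac:(lra)).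
  field. split; trivial.
Qed.

(** Here the exact remainder is (b - a)^2 u^2 v (v + 2 u), with u = 1/(c - a) and v = 1/(c - b); the
    last factor is the source of the 3. *)
Lemma CT2_quad (R0 p : R) (k : R -> C) (a b : C) : pcont k -> 0 <= R0 -> p < R0 ->
  Cmod a <= p -> Cmod b <= p ->
  Cmod (CT2 R0 k b - CT2 R0 k a - (b - a) * (2 * CT3 R0 k a)) <=
  Cmod (b - a) ^ 2 * (3 * (/ (R0 - p)) ^ 4) * rmean (fun t => Cmod (k t)).
Proof.
  intros Hk HR Hp Ha Hb. unfold CT2, CT3.
  assert (K1 := pcont_kernel R0 a HR ltac:(lra)). assert (K2 := pcont_kernel R0 b HR ltac:(lra)).
  rewrite <- !cmean_scal, <- !cmean_minus by pc.
  rewrite (cmean_ext _ (fun t => (k t * ((b - a) * (b - a) *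
    (/ (circle_pt R0 t - a) * / (circle_pt R0 t - a) * / (circle_pt R0 t - b) *
      (/ (circle_pt R0 t - b) + 2 * / (circle_pt R0 t - a)))))%C)).
  apply cmean_mult_bound; trivial.
  pc.
  intros t. rewrite !Cmod_mult. apply Rle_trans with
    (Cmod (b - a) * Cmod (b - a) * (/ (R0 - p) * / (R0 - p) * / (R0 - p) * (3 * / (R0 - p)))).
  2: right; ring.
  assert (A1 := kernel_bound R0 p t a HR Hp Ha). assert (A2 := kernel_bound R0 p t b HR Hp Hb).
  assert (B1 := Cmod_ge_0 (/ (circle_pt R0 t - a))). assert (B2 := Cmod_ge_0 (/ (circle_pt R0 t - b))).
  apply Rmult_le_compat_l. apply Rmult_le_pos; apply Cmod_ge_0.
  repeat apply Rmult_le_compat; trivial; try (repeat apply Rmult_le_pos; trivial; fail).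
  apply Cmod_ge_0.
  eapply Rle_trans. apply Cmod_triangle. rewrite Cmod_mult, Cmod_R, Rabs_right by lra. lra.
  intros t. assert (N1 := circle_neq R0 t a HR ltac:(lra)). assert (N2 := circle_neq R0 t b HR ltac:(lra)).
  field. split; trivial.
Qed.

Lemma is_Cder_quad (f : C -> C) (z l : C) (d K : R) : 0 < d ->
  (forall w, Cmod (w - z) < d -> Cmod (f w - f z - (w - z) * l) <= Cmod (w - z) ^ 2 * K) ->
  is_Cder f z l.
Proof.
  intros Hd H. apply is_Cder_eps. intros e He.
  assert (HK := Rabs_pos K). assert (HK2 := Rle_abs K).
  exists (Rmin d (e / (Rabs K + 1))). split.
  apply Rmin_glb_lt; trivial. apply Rdiv_lt_0_compat; lra.
  intros w Hw. eapply Rle_trans. apply H. eapply Rlt_le_trans; [exact Hw | apply Rmin_l].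
  assert (Hw2 := Rlt_le_trans _ _ _ Hw (Rmin_r _ _)).
  apply (Rmult_lt_compat_r (Rabs K + 1)) in Hw2; [|lra].
  unfold Rdiv in Hw2. rewrite Rmult_assoc, Rinv_l in Hw2 by lra.
  assert (Hw0 := Cmod_ge_0 (w - z)). simpl. nra.
Qed.

Lemma is_Cder_CT1 (R0 : R) (k : R -> C) (a : C) : pcont k -> Cmod a < R0 ->
  is_Cder (CT1 R0 k) a (CT2 R0 k a).
Proof.
  intros Hk Ha. assert (HR := Cmod_ge_0 a).
  set (p := (Cmod a + R0) / 2).
  apply is_Cder_quad with (d := p - Cmod a) (K := (/ (R0 - p)) ^ 3 * rmean (fun t => Cmod (k t))).
  unfold p; lra.
  intros w Hw. rewrite <- Rmult_assoc. apply CT1_quad; trivial; try (unfold p; lra).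
  assert (A := Cmod_cont_diff w a). apply Rabs_le_between in A. lra.
Qed.

Lemma is_Cder_CT2 (R0 : R) (k : R -> C) (a : C) : pcont k -> Cmod a < R0 ->
  is_Cder (CT2 R0 k) a (2 * CT3 R0 k a).
Proof.
  intros Hk Ha. assert (HR := Cmod_ge_0 a).
  set (p := (Cmod a + R0) / 2).
  apply is_Cder_quad with (d := p - Cmod a) (K := (3 * (/ (R0 - p)) ^ 4) * rmean (fun t => Cmod (k t))).
  unfold p; lra.
  intros w Hw. rewrite <- Rmult_assoc. apply CT2_quad; trivial; try (unfold p; lra).
  assert (A := Cmod_cont_diff w a). apply Rabs_le_between in A. lra.
Qed.

Lemma cauchy_CT (rho R0 : R) (f : C -> C) (a : C) : ana rho f -> 0 < R0 < rho -> Cmod a < R0 ->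
  f a = CT1 R0 (fun t => (f (circle_pt R0 t) * circle_pt R0 t)%C) a.
Proof. intros Hf HR Ha. exact (cauchy_formula rho R0 f a Hf HR Ha). Qed.

Lemma pcont_cauchy_density (rho R0 : R) (f : C -> C) : ana rho f -> 0 <= R0 < rho ->
  pcont (fun t => (f (circle_pt R0 t) * circle_pt R0 t)%C).
Proof. intros Hf HR. apply pcont_mult. now apply (pcont_ana rho). apply pcont_circle. Qed.

Lemma rmean_cauchy_density (rho R0 : R) (f : C -> C) : ana rho f -> 0 <= R0 < rho ->
  rmean (fun t => Cmod (f (circle_pt R0 t) * circle_pt R0 t)) =
  R0 * rmean (fun t => Cmod (f (circle_pt R0 t))).
Proof.
  intros Hf HR. rewrite <- rmean_scal. 2: apply pcont_Cmod; now apply (pcont_ana rho).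
  unfold rmean. f_equal. apply RInt_ext. intros t _. rewrite Cmod_mult, Cmod_circle_pt by lra.
  apply Rmult_comm.
Qed.

Lemma is_Cder_C_derive (f : C -> C) (z l : C) : is_Cder f z l -> C_derive f z = l.
Proof. apply is_C_derive_unique. Qed.

Lemma C_derive_CT (rho R0 : R) (f : C -> C) (a : C) : ana rho f -> 0 < R0 < rho -> Cmod a < R0 ->
  C_derive f a = CT2 R0 (fun t => (f (circle_pt R0 t) * circle_pt R0 t)%C) a.
Proof.
  intros Hf HR Ha. apply is_Cder_C_derive.
  apply is_Cder_ext_loc with (f := CT1 R0 (fun t => (f (circle_pt R0 t) * circle_pt R0 t)%C))
    (d := R0 - Cmod a). lra.
  intros w Hw. symmetry. apply (cauchy_CT rho); trivial.
  assert (A := Cmod_cont_diff w a). apply Rabs_le_between in A. lra.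
  apply is_Cder_CT1; trivial. apply (pcont_cauchy_density rho); trivial; lra.
Qed.

Lemma ana_C_derive (rho : R) (f : C -> C) : ana rho f -> ana rho (C_derive f).
Proof.
  intros Hf a Ha. assert (H0 := Cmod_ge_0 a). set (R0 := (Cmod a + rho) / 2).
  assert (HR : 0 < R0 < rho) by (unfold R0; lra). assert (HR2 : Cmod a < R0) by (unfold R0; lra).
  set (k := fun t => (f (circle_pt R0 t) * circle_pt R0 t)%C).
  exists (2 * CT3 R0 k a)%C.
  apply is_Cder_ext_loc with (f := CT2 R0 k) (d := R0 - Cmod a). lra.
  intros w Hw. symmetry. apply (C_derive_CT rho); trivial.
  assert (A := Cmod_cont_diff w a). apply Rabs_le_between in A. lra.
  apply is_Cder_CT2; trivial. apply (pcont_cauchy_density rho); trivial; lra.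
Qed.

Lemma cauchy_estimate (rho R0 p : R) (f : C -> C) (a : C) : ana rho f -> 0 < R0 < rho ->
  p < R0 -> Cmod a <= p ->
  Cmod (f a) <= R0 / (R0 - p) * rmean (fun t => Cmod (f (circle_pt R0 t))).
Proof.
  intros Hf HR Hp Ha. rewrite (cauchy_CT rho R0 f a) by (trivial; lra).
  unfold Rdiv. rewrite (Rmult_comm R0), Rmult_assoc.
  rewrite <- (rmean_cauchy_density rho) by (trivial; lra).
  apply cmean_mult_bound. apply (pcont_cauchy_density rho); trivial; lra.
  apply pcont_kernel; lra. intros t. apply kernel_bound; lra.
Qed.

Lemma cauchy_lip (rho R0 p : R) (f : C -> C) (a b : C) : ana rho f -> 0 < R0 < rho ->
  p < R0 -> Cmod a <= p -> Cmod b <= p ->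
  Cmod (f b - f a) <=
  Cmod (b - a) * ((/ (R0 - p)) ^ 2 * (R0 * rmean (fun t => Cmod (f (circle_pt R0 t))))).
Proof.
  intros Hf HR Hp Ha Hb.
  rewrite (cauchy_CT rho R0 f a), (cauchy_CT rho R0 f b) by (trivial; lra).
  rewrite <- (rmean_cauchy_density rho), <- Rmult_assoc by (trivial; lra).
  apply CT1_lip; trivial; try lra. apply (pcont_cauchy_density rho); trivial; lra.
Qed.

Lemma rmean_Cmod_ge0 (u : R -> C) : pcont u -> 0 <= rmean (fun t => Cmod (u t)).
Proof. intros Hu. apply rmean_ge0. now apply pcont_Cmod. intros; apply Cmod_ge_0. Qed.

(** A single constant for size, Lipschitz continuity and second order remainder on a closed disc.
    The uniform remainder is what permits differentiation under the improper integral. *)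
Lemma ana_est (rho p : R) (f : C -> C) : ana rho f -> 0 <= p < rho ->
  exists K, 0 <= K /\ forall a b, Cmod a <= p -> Cmod b <= p ->
    Cmod (f a) <= K /\ Cmod (f b - f a) <= K * Cmod (b - a) /\
    Cmod (f b - f a - (b - a) * C_derive f a) <= K * Cmod (b - a) ^ 2.
Proof.
  intros Hf Hp. set (R0 := (p + rho) / 2).
  assert (HR : 0 < R0 < rho) by (unfold R0; lra). assert (HR2 : p < R0) by (unfold R0; lra).
  set (M := rmean (fun t => Cmod (f (circle_pt R0 t)))).
  assert (HM : 0 <= M) by (apply rmean_Cmod_ge0; apply (pcont_ana rho); trivial; lra).
  assert (Hi : 0 < / (R0 - p)) by (apply Rinv_0_lt_compat; lra).
  set (K1 := R0 / (R0 - p) * M). set (K2 := (/ (R0 - p)) ^ 2 * (R0 * M)).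
  set (K3 := (/ (R0 - p)) ^ 3 * (R0 * M)).
  assert (HRM : 0 <= R0 * M) by (apply Rmult_le_pos; lra).
  assert (HK1 : 0 <= K1) by (unfold K1, Rdiv; apply Rmult_le_pos; trivial; nra).
  assert (HK2 : 0 <= K2) by (unfold K2; apply Rmult_le_pos; trivial; apply pow_le; lra).
  assert (HK3 : 0 <= K3) by (unfold K3; apply Rmult_le_pos; trivial; apply pow_le; lra).
  exists (K1 + K2 + K3). split. lra. intros a b Ha Hb.
  assert (B0 := Cmod_ge_0 (b - a)).
  split; [|split].
  - apply Rle_trans with K1. apply (cauchy_estimate rho); trivial. lra.
  - eapply Rle_trans. apply (cauchy_lip rho R0 p); trivial. fold M. fold K2. nra.
  - rewrite (C_derive_CT rho R0), (cauchy_CT rho R0 f a), (cauchy_CT rho R0 f b) by (trivial; lra).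
    eapply Rle_trans. apply CT1_quad with (p := p); trivial; try lra.
    apply (pcont_cauchy_density rho); trivial; lra.
    cbv beta. rewrite (rmean_cauchy_density rho) by (trivial; lra). fold M.
    rewrite Rmult_assoc. fold K3. assert (0 <= Cmod (b - a) ^ 2) by (apply pow_le; lra). nra.
Qed.

(** * Taylor polynomials *)

Fixpoint csum (b : nat -> C) (N : nat) (z : C) : C :=
  match N with O => RtoC 0 | S n => (csum b n z + b n * z ^ n)%C end.

Lemma ana_csum (rho : R) (b : nat -> C) (N : nat) : ana rho (csum b N).
Proof.
  induction N; simpl. apply ana_const. apply ana_plus; trivial.
  apply ana_mult. apply ana_const. apply ana_pow.
Qed.

Lemma pcont_pow (u : R -> C) (n : nat) : pcont u -> pcont (fun t => (u t ^ n)%C).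
Proof. intros Hu. induction n; simpl. apply pcont_const. now apply pcont_mult. Qed.

Lemma Cpow_mult_l (a b : C) (n : nat) : ((a * b) ^ n)%C = (a ^ n * b ^ n)%C.
Proof. induction n; simpl. ring. rewrite IHn. ring. Qed.

(** Expanding the Cauchy kernel as a geometric series, the remainder after N terms is the Cauchy
    integral weighted by (a / z)^N, of modulus at most (p / R0)^N. *)
Lemma taylor (rho R0 p : R) (f : C -> C) : ana rho f -> 0 < R0 < rho -> p < R0 ->
  exists b : nat -> C, forall N a, Cmod a <= p ->
    Cmod (f a - csum b N a) <=
    (p / R0) ^ N * (R0 / (R0 - p)) * rmean (fun t => Cmod (f (circle_pt R0 t))).
Proof.
  intros Hf HR Hp.
  assert (Hc1 : forall t, circle_pt R0 t <> RtoC 0).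
  { intros t E'. assert (A := Cmod_circle_pt R0 t ltac:(lra)). rewrite E', Cmod_0 in A. lra. }
  assert (Hci : pcont (fun t => (/ circle_pt R0 t)%C)).
  { intros t. apply ccont_inv. apply pcont_circle. apply Hc1. }
  assert (Hfc : pcont (fun t => f (circle_pt R0 t))) by (apply (pcont_ana rho); trivial; lra).
  set (b := fun n => cmean (fun t => (f (circle_pt R0 t) * (/ circle_pt R0 t) ^ n)%C)).
  exists b. intros N a Ha.
  assert (Hk := pcont_kernel R0 a ltac:(lra) ltac:(lra)).
  assert (E : f a = (csum b N a + cmean (fun t => (f (circle_pt R0 t) *
    ((a * / circle_pt R0 t) ^ N * (circle_pt R0 t * / (circle_pt R0 t - a))))%C))%C).
  { induction N; simpl csum.
    - rewrite (cauchy_formula rho R0 f a) by (trivial; lra). simpl. rewrite Cplus_0_l.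
      apply cmean_ext. intros t. ring.
    - rewrite IHN. rewrite <- Cplus_assoc. f_equal.
      unfold b. rewrite (Cmult_comm _ (a ^ N)), <- cmean_scal, <- cmean_plus.
      + apply cmean_ext. intros t. rewrite !Cpow_mult_l. simpl.
        assert (N1 := circle_neq R0 t a ltac:(lra) ltac:(lra)). specialize (Hc1 t).
        field. split; trivial.
      + pc. now apply pcont_pow.
      + pc. apply pcont_pow. pc.
      + pc. now apply pcont_pow. }
  rewrite E at 1. match goal with |- Cmod (?A + ?B - ?A') <= _ =>
    replace (A + B - A')%C with B by ring end.
  apply cmean_mult_bound; trivial.
  pc. apply pcont_pow. pc.
  intros t. rewrite !Cmod_mult, Cmod_pow, Cmod_mult, Cmod_inv, Cmod_circle_pt by (trivial; lra).
  assert (A0 := Cmod_ge_0 a). apply Rmult_le_compat.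
  apply pow_le. apply Rmult_le_pos; trivial. apply Rlt_le, Rinv_0_lt_compat; lra.
  apply Rmult_le_pos. lra. apply Cmod_ge_0.
  apply pow_incr. split. apply Rmult_le_pos; trivial. apply Rlt_le, Rinv_0_lt_compat; lra.
  unfold Rdiv. apply Rmult_le_compat_r; trivial. apply Rlt_le, Rinv_0_lt_compat; lra.
  apply Rmult_le_compat_l. lra. apply kernel_bound; lra.
Qed.

Lemma taylor_uniform (rho p e : R) (f : C -> C) : ana rho f -> 0 <= p < rho -> 0 < e ->
  exists b N, forall a, Cmod a <= p -> Cmod (f a - csum b N a) <= e.
Proof.
  intros Hf Hp He. set (R0 := (p + rho) / 2).
  assert (HR : 0 < R0 < rho) by (unfold R0; lra). assert (HR2 : p < R0) by (unfold R0; lra).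
  destruct (taylor rho R0 p f Hf HR HR2) as [b Hb].
  set (M := rmean (fun t => Cmod (f (circle_pt R0 t)))) in *.
  assert (HM : 0 <= M) by (apply rmean_Cmod_ge0; apply (pcont_ana rho); trivial; lra).
  set (X := R0 / (R0 - p) * M).
  assert (HX : 0 <= X).
  { unfold X, Rdiv. apply Rmult_le_pos; trivial. apply Rmult_le_pos. lra.
    apply Rlt_le, Rinv_0_lt_compat; lra. }
  assert (Hq0 : 0 <= p / R0).
  { apply Rmult_le_pos. lra. apply Rlt_le, Rinv_0_lt_compat; lra. }
  destruct (pow_lt_1_zero (p / R0)) with (y := e / (X + 1)) as [N HN].
  rewrite Rabs_right by lra. apply Rmult_lt_reg_r with R0. lra.
  unfold Rdiv. rewrite Rmult_assoc, Rinv_l by lra. lra.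
  apply Rdiv_lt_0_compat; lra.
  exists b, N. intros a Ha. eapply Rle_trans. now apply Hb.
  specialize (HN N ltac:(lia)). rewrite Rabs_right in HN by (apply Rle_ge, pow_le; trivial).
  rewrite Rmult_assoc. fold X.
  apply (Rmult_lt_compat_r (X + 1)) in HN; [|lra].
  unfold Rdiv at 2 in HN. rewrite Rmult_assoc, Rinv_l in HN by lra.
  assert (0 <= (p / R0) ^ N) by (apply pow_le; trivial). nra.
Qed.

(** * Integral means *)

Lemma rpow_pos_eq (x p : R) : 0 < x -> rpow x p = Rpower x p.
Proof. intros Hx. unfold rpow. destruct (Rle_dec x 0); trivial. lra. Qed.

Lemma rpow_npos (x p : R) : x <= 0 -> rpow x p = 0.
Proof. intros Hx. unfold rpow. destruct (Rle_dec x 0); trivial. lra. Qed.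

Lemma rpow_pos (x p : R) : 0 < x -> 0 < rpow x p.
Proof. intros Hx. rewrite rpow_pos_eq by trivial. apply exp_pos. Qed.

Lemma rpow_ge0 (x p : R) : 0 <= rpow x p.
Proof.
  destruct (Rle_dec x 0). rewrite rpow_npos; lra. apply Rlt_le, rpow_pos; lra.
Qed.

Lemma rpow_lt (x y p : R) : 0 < p -> 0 <= x < y -> rpow x p < rpow y p.
Proof.
  intros Hp Hxy. destruct (Req_dec x 0) as [->|Hx].
  rewrite (rpow_npos 0) by lra. apply rpow_pos; lra.
  rewrite !rpow_pos_eq by lra. unfold Rpower. apply exp_increasing.
  apply Rmult_lt_compat_l; trivial. apply ln_increasing; lra.
Qed.

Lemma rpow_le (x y p : R) : 0 < p -> x <= y -> rpow x p <= rpow y p.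
Proof.
  intros Hp Hxy. destruct (Rle_dec x 0). rewrite rpow_npos by trivial. apply rpow_ge0.
  destruct (Req_dec x y) as [->|Hn]. lra. apply Rlt_le, rpow_lt; lra.
Qed.

Lemma rpow_rpow (x a b : R) : rpow (rpow x a) b = rpow x (a * b).
Proof.
  destruct (Rle_dec x 0). rewrite !(rpow_npos x) by trivial. apply rpow_npos; lra.
  rewrite (rpow_pos_eq (rpow x a)) by (apply rpow_pos; lra).
  rewrite !rpow_pos_eq by lra. apply Rpower_mult.
Qed.

Lemma rpow_1 (x : R) : 0 <= x -> rpow x 1 = x.
Proof.
  intros Hx. destruct (Req_dec x 0) as [->|Hn]. apply rpow_npos; lra.
  rewrite rpow_pos_eq by lra. apply Rpower_1; lra.
Qed.

Lemma rpow_mult (x y p : R) : 0 <= x -> 0 <= y -> rpow (x * y) p = rpow x p * rpow y p.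
Proof.
  intros Hx Hy. destruct (Req_dec x 0) as [->|Hnx].
  rewrite Rmult_0_l, (rpow_npos 0) by lra. ring.
  destruct (Req_dec y 0) as [->|Hny].
  rewrite Rmult_0_r, (rpow_npos 0) by lra. ring.
  rewrite !rpow_pos_eq by nra. now rewrite Rpower_mult_distr by lra.
Qed.

Lemma rpow_plus (x a b : R) : rpow x (a + b) = rpow x a * rpow x b.
Proof.
  destruct (Rle_dec x 0). rewrite !(rpow_npos x) by trivial. ring.
  rewrite !rpow_pos_eq by lra. apply Rpower_plus.
Qed.

Lemma rpow_one (p : R) : rpow 1 p = 1.
Proof. rewrite rpow_pos_eq by lra. unfold Rpower. rewrite ln_1, Rmult_0_r. apply exp_0. Qed.

Lemma rpow_2 (x : R) : 0 <= x -> rpow x 2 = x ^ 2.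
Proof.
  intros Hx. replace 2 with (1 + 1) at 1 by ring. rewrite rpow_plus, !rpow_1 by trivial. ring.
Qed.

Lemma rpow_root_le (I B q : R) : 0 < q -> 0 <= B -> rpow I (/ q) <= B <-> I <= rpow B q.
Proof.
  intros Hq HB. assert (Hi := Rinv_0_lt_compat q Hq). split; intros H.
  - destruct (Rle_dec I 0). apply Rle_trans with 0; trivial. apply rpow_ge0.
    apply (rpow_le _ _ q Hq) in H. rewrite rpow_rpow, Rinv_l, rpow_1 in H; lra.
  - apply (rpow_le _ _ (/ q) Hi) in H. rewrite rpow_rpow, Rinv_r, rpow_1 in H; lra.
Qed.

Lemma continuous_rpow (q x : R) : 0 < q -> continuous (fun x => rpow x q) x.
Proof.
  intros Hq. destruct (Rlt_dec 0 x) as [Hx|Hx].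
  - apply continuous_ext_loc with (fun x => exp (q * ln x)).
    + exists (mkposreal x Hx). intros y Hy. unfold ball in Hy; simpl in Hy.
      unfold AbsRing_ball, abs, minus, plus, opp in Hy; simpl in Hy.
      apply Rabs_lt_between in Hy. rewrite rpow_pos_eq by lra. reflexivity.
    + apply (ex_derive_continuous (V := R_NormedModule)). auto_derive. lra.
  - assert (Hx' : x <= 0) by lra. intros P [e He]. rewrite rpow_npos in He by trivial.
    assert (Hd : 0 < rpow e (/ q)) by (apply rpow_pos, cond_pos).
    exists (mkposreal _ Hd). intros y Hy. apply He.
    unfold ball in *; simpl in *. unfold AbsRing_ball, abs, minus, plus, opp in *; simpl in *.
    rewrite Ropp_0, Rplus_0_r, Rabs_right by (apply Rle_ge, rpow_ge0).
    destruct (Rle_dec y 0). rewrite rpow_npos by trivial. apply cond_pos.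
    apply Rabs_lt_between in Hy.
    apply Rlt_le_trans with (rpow (rpow e (/ q)) q). apply rpow_lt; lra.
    rewrite rpow_rpow, Rinv_l, rpow_1. lra. apply Rlt_le, cond_pos. lra.
Qed.

(* Bernoulli, from [1 + ln u <= u] at the two terms of Young's inequality. *)
Lemma rpow_bernoulli (x p : R) : 1 <= p -> 0 <= x -> 1 + p * (x - 1) <= rpow x p.
Proof.
  intros Hp Hx. destruct (Req_dec x 0) as [->|Hn].
  { assert (H := rpow_ge0 0 p). lra. }
  assert (Hx' : 0 < x) by lra. rewrite rpow_pos_eq by trivial.
  set (y := Rpower x p). assert (Hy : 0 < y) by apply exp_pos.
  set (m := (y + (p - 1)) / p).
  assert (Hpi : 0 < / p) by (apply Rinv_0_lt_compat; lra).
  assert (Hm : 0 < m) by (unfold m; apply Rdiv_lt_0_compat; lra).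
  assert (L : forall u, 0 < u -> 1 + ln u <= u).
  { intros u Hu. rewrite <- (exp_ln u) at 2 by trivial. apply exp_ineq1_le. }
  assert (L1 := L (y / m) ltac:(now apply Rdiv_lt_0_compat)).
  assert (L2 := L (/ m) ltac:(now apply Rinv_0_lt_compat)).
  unfold Rdiv in L1. rewrite ln_mult, ln_Rinv in L1 by (trivial; now apply Rinv_0_lt_compat).
  rewrite ln_Rinv in L2 by trivial.
  assert (Ly : ln y = p * ln x) by (unfold y, Rpower; apply ln_exp). rewrite Ly in L1.
  assert (E : y * / m + (p - 1) * / m = p) by (unfold m; field; lra).
  assert (L3 : ln x <= ln m) by nra.
  assert (L4 : x <= m).
  { apply Rnot_lt_le. intros Hlt. apply ln_increasing in Hlt; lra. }
  assert (E2 : p * m = y + (p - 1)) by (unfold m; field; lra). nra.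
Qed.

(** Bernoulli's inequality at x / m, rescaled by m^p. *)
Lemma rpow_tangent (x m p : R) : 1 <= p -> 0 <= x -> 0 <= m ->
  rpow m p + p * rpow m (p - 1) * (x - m) <= rpow x p.
Proof.
  (* [rpow 0 (p - 1)] is 0 even for p = 1, so at m = 0 the tangent line is zero. *)
  intros Hp Hx Hm. destruct (Req_dec m 0) as [->|Hn].
  { rewrite !(rpow_npos 0) by lra. rewrite Rmult_0_r, Rmult_0_l, Rplus_0_l. apply rpow_ge0. }
  assert (B := rpow_bernoulli (x / m) p Hp).
  assert (Hi : 0 < / m) by (apply Rinv_0_lt_compat; lra).
  assert (Hxm : 0 <= x / m) by (unfold Rdiv; nra). specialize (B Hxm).
  assert (E : rpow x p = rpow m p * rpow (x / m) p).
  { rewrite <- rpow_mult by (trivial; lra). f_equal. field; lra. }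
  assert (E2 : rpow m p = m * rpow m (p - 1)).
  { rewrite <- (rpow_1 m) at 2 by trivial. rewrite <- rpow_plus. f_equal. ring. }
  rewrite E. apply Rle_trans with (rpow m p * (1 + p * (x / m - 1))).
  rewrite E2. right. field; lra. apply Rmult_le_compat_l; trivial. apply rpow_ge0.
Qed.

Lemma rpow_convex (x y a b p : R) : 1 <= p -> 0 <= x -> 0 <= y -> 0 <= a -> 0 <= b -> a + b = 1 ->
  rpow (a * x + b * y) p <= a * rpow x p + b * rpow y p.
Proof.
  intros Hp Hx Hy Ha Hb Hab. set (m := a * x + b * y).
  assert (Hm : 0 <= m) by (unfold m; nra).
  assert (T1 := rpow_tangent x m p Hp Hx Hm). assert (T2 := rpow_tangent y m p Hp Hy Hm).
  assert (a * (rpow m p + p * rpow m (p - 1) * (x - m)) <= a * rpow x p)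
    by (apply Rmult_le_compat_l; trivial).
  assert (b * (rpow m p + p * rpow m (p - 1) * (y - m)) <= b * rpow y p)
    by (apply Rmult_le_compat_l; trivial).
  assert (E : a * (rpow m p + p * rpow m (p - 1) * (x - m)) + b * (rpow m p + p * rpow m (p - 1) * (y - m))
    = (a + b) * rpow m p + p * rpow m (p - 1) * ((a * x + b * y) - (a + b) * m)) by ring.
  rewrite Hab in E. fold m in E. replace (m - 1 * m) with 0 in E by ring. lra.
Qed.

(** A relation with a real bound instead of a value in [Rbar]: the properties of a norm can then be
    stated once for finite and infinite exponents. *)
Definition mean_le (p : Rbar) (r : R) (f : C -> C) (B : R) : Prop :=
  Rbar_le (integral_mean p r f) (Finite B).

Definition circ_cont (r : R) (f : C -> C) : Prop := pcont (fun t => f (circle_pt r t)).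

Definition pmean (q r : R) (f : C -> C) : R := rmean (fun t => rpow (Cmod (f (circle_pt r t))) q).

Lemma pmean_cont (q r : R) (f : C -> C) (t : R) : 0 < q -> circ_cont r f ->
  continuous (fun t => rpow (Cmod (f (circle_pt r t))) q) t.
Proof.
  intros Hq Hf. apply (continuous_comp _ (fun x => rpow x q)). now apply pcont_Cmod.
  now apply continuous_rpow.
Qed.

Lemma mean_le_fin (q r : R) (f : C -> C) (B : R) : 0 < q -> 0 <= B ->
  mean_le (Finite q) r f B <-> pmean q r f <= rpow B q.
Proof. intros Hq HB. unfold mean_le. simpl. now apply rpow_root_le. Qed.

Lemma mean_le_inf (r : R) (f : C -> C) (B : R) :
  mean_le p_infty r f B <-> (forall z, Cmod z = r -> Cmod (f z) <= B).
Proof.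
  unfold mean_le. simpl.
  set (E := fun y => exists z : C, Cmod z = r /\ y = Cmod (f z)).
  destruct (Lub_Rbar_correct E) as [H1 H2]. split.
  - intros H z Hz. assert (A : Rbar_le (Finite (Cmod (f z))) (Lub_Rbar E)).
    { apply H1. now exists z. }
    exact (Rbar_le_trans _ _ _ A H).
  - intros H. apply H2. intros y (z & Hz & ->). now apply H.
Qed.

Lemma mean_le_ge0 (p : Rbar) (r : R) (f : C -> C) (B : R) : 0 <= r -> Rbar_le 1 p ->
  mean_le p r f B -> 0 <= B.
Proof.
  intros Hr Hp H. destruct p as [q| |]; simpl in Hp.
  - unfold mean_le in H; simpl in H. eapply Rle_trans; [apply rpow_ge0 | exact H].
  - rewrite mean_le_inf in H. eapply Rle_trans; [apply Cmod_ge_0|].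
    apply (H (RtoC r)). rewrite Cmod_R, Rabs_right; lra.
  - contradiction.
Qed.

Lemma mean_le_mono (p : Rbar) (r : R) (f : C -> C) (B B' : R) :
  B <= B' -> mean_le p r f B -> mean_le p r f B'.
Proof. intros HB H. eapply Rbar_le_trans; [exact H | exact HB]. Qed.

Lemma mean_le_eps (p : Rbar) (r : R) (f : C -> C) (B : R) :
  (forall e, 0 < e -> mean_le p r f (B + e)) -> mean_le p r f B.
Proof.
  intros H. unfold mean_le in *. destruct (integral_mean p r f) as [x| |]; simpl in *; trivial.
  apply Rle_eps. exact H. exact (H 1 Rlt_0_1).
Qed.

Lemma mean_le_ext (p : Rbar) (r : R) (f g : C -> C) (B : R) : 0 <= r ->
  (forall z, Cmod z = r -> f z = g z) -> mean_le p r f B -> mean_le p r g B.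
Proof.
  intros Hr Hfg. destruct p as [q| |].
  - unfold mean_le, integral_mean. intros H. eapply Rbar_le_trans; [|exact H].
    right. f_equal. f_equal. apply RInt_ext. intros t _. rewrite Hfg; trivial.
    now apply Cmod_circle_pt.
  - rewrite !mean_le_inf. intros H z Hz. rewrite <- Hfg by trivial. now apply H.
  - trivial.
Qed.

Lemma mean_le_sup (p : Rbar) (r : R) (f : C -> C) (B : R) : 0 <= r -> Rbar_le 1 p -> circ_cont r f ->
  (forall z, Cmod z = r -> Cmod (f z) <= B) -> mean_le p r f B.
Proof.
  intros Hr Hp Hf H. destruct p as [q| |]; simpl in Hp.
  - assert (HB : 0 <= B).
    { eapply Rle_trans; [apply Cmod_ge_0|]. apply (H (RtoC r)). rewrite Cmod_R, Rabs_right; lra. }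
    apply mean_le_fin; trivial. lra. rewrite <- (rmean_const (rpow B q)).
    apply rmean_le. intros t. apply pmean_cont; trivial; lra. intros t; apply continuous_const.
    intros t. apply rpow_le. lra. apply H. now apply Cmod_circle_pt.
  - now apply mean_le_inf.
  - contradiction.
Qed.

Lemma circ_cont_plus (r : R) (f g : C -> C) : circ_cont r f -> circ_cont r g ->
  circ_cont r (fun z => (f z + g z)%C).
Proof. intros Hf Hg. now apply pcont_plus. Qed.

Lemma circ_cont_minus (r : R) (f g : C -> C) : circ_cont r f -> circ_cont r g ->
  circ_cont r (fun z => (f z - g z)%C).
Proof. intros Hf Hg. now apply pcont_minus. Qed.

Lemma circ_cont_mult (r : R) (f g : C -> C) : circ_cont r f -> circ_cont r g ->
  circ_cont r (fun z => (f z * g z)%C).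
Proof. intros Hf Hg. now apply pcont_mult. Qed.

Lemma continuous_scalR {U : UniformSpace} (c : R) (u : U -> R) (t : U) :
  continuous u t -> continuous (fun t => c * u t) t.
Proof. apply (continuous_scal_r (V := R_NormedModule)). Qed.

Lemma continuous_plusR {U : UniformSpace} (u v : U -> R) (t : U) :
  continuous u t -> continuous v t -> continuous (fun t => u t + v t) t.
Proof. apply (continuous_plus (V := R_NormedModule)). Qed.

(** Minkowski's inequality from the convexity of x^q: (f + g) / (A' + B') is a convex combination of
    f / A' and g / B', whose q-means are at most 1. The slack e makes A' and B' positive. *)
Lemma mean_le_plus (p : Rbar) (r : R) (f g : C -> C) (A B : R) : 0 <= r -> Rbar_le 1 p ->
  circ_cont r f -> circ_cont r g -> mean_le p r f A -> mean_le p r g B ->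
  mean_le p r (fun z => (f z + g z)%C) (A + B).
Proof.
  intros Hr Hp Hf Hg HA HB.
  assert (A0 := mean_le_ge0 _ _ _ _ Hr Hp HA). assert (B0 := mean_le_ge0 _ _ _ _ Hr Hp HB).
  destruct p as [q| |]; simpl in Hp.
  - apply mean_le_eps. intros e He.
    set (A' := A + e / 2). set (B' := B + e / 2).
    assert (HA' : 0 < A') by (unfold A'; lra). assert (HB' : 0 < B') by (unfold B'; lra).
    replace (A + B + e) with (A' + B') by (unfold A', B'; field).
    apply (mean_le_mono _ _ _ _ A') in HA; [|unfold A'; lra].
    apply (mean_le_mono _ _ _ _ B') in HB; [|unfold B'; lra].
    apply mean_le_fin in HA, HB; try lra. apply mean_le_fin; try lra.
    assert (Hs : 0 < / (A' + B')) by (apply Rinv_0_lt_compat; lra).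
    assert (HAi : 0 < / A') by (now apply Rinv_0_lt_compat).
    assert (HBi : 0 < / B') by (now apply Rinv_0_lt_compat).
    set (a := A' * / (A' + B')). set (b := B' * / (A' + B')).
    assert (Hab : a + b = 1) by (unfold a, b; field; lra).
    assert (Ha : 0 <= a) by (apply Rmult_le_pos; lra).
    assert (Hb : 0 <= b) by (apply Rmult_le_pos; lra).
    set (S := rpow (A' + B') q).
    assert (HS : 0 <= S) by apply rpow_ge0.
    apply Rle_trans with (rmean (fun t => S * a * rpow (/ A') q * rpow (Cmod (f (circle_pt r t))) q +
       S * b * rpow (/ B') q * rpow (Cmod (g (circle_pt r t))) q)).
    + apply rmean_le.
      intros t. apply (pmean_cont q r (fun z => (f z + g z)%C)); try lra. now apply circ_cont_plus.
      intros t. apply continuous_plusR; apply continuous_scalR; apply pmean_cont; trivial; lra.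
      intros t. set (x := Cmod (f (circle_pt r t))). set (y := Cmod (g (circle_pt r t))).
      assert (Hx : 0 <= x) by apply Cmod_ge_0. assert (Hy : 0 <= y) by apply Cmod_ge_0.
      assert (Hx' : 0 <= / A' * x) by (apply Rmult_le_pos; lra).
      assert (Hy' : 0 <= / B' * y) by (apply Rmult_le_pos; lra).
      apply Rle_trans with (rpow ((A' + B') * (a * (/ A' * x) + b * (/ B' * y))) q).
      apply rpow_le. lra. eapply Rle_trans. apply Cmod_triangle. fold x y.
      right. unfold a, b. field. lra.
      rewrite rpow_mult; [|lra|apply Rplus_le_le_0_compat; now apply Rmult_le_pos]. fold S.
      assert (Cx := rpow_convex (/ A' * x) (/ B' * y) a b q Hp Hx' Hy' Ha Hb Hab).
      rewrite !rpow_mult in Cx by lra.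
      apply (Rmult_le_compat_l S) in Cx; trivial. eapply Rle_trans; [exact Cx|]. right; ring.
    + rewrite rmean_plus, !rmean_scal; try (intros t; apply pmean_cont; trivial; lra);
        try (intros t; apply continuous_scalR; apply pmean_cont; trivial; lra).
      fold (pmean q r f) (pmean q r g).
      assert (EA : rpow (/ A') q * rpow A' q = 1).
      { rewrite <- rpow_mult, Rinv_l, rpow_one by lra. reflexivity. }
      assert (EB : rpow (/ B') q * rpow B' q = 1).
      { rewrite <- rpow_mult, Rinv_l, rpow_one by lra. reflexivity. }
      assert (PA := rpow_ge0 (/ A') q). assert (PB := rpow_ge0 (/ B') q).
      assert (U : rpow (/ A') q * pmean q r f <= 1) by (rewrite <- EA; now apply Rmult_le_compat_l).
      assert (V : rpow (/ B') q * pmean q r g <= 1) by (rewrite <- EB; now apply Rmult_le_compat_l).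
      assert (Sa : 0 <= S * a) by now apply Rmult_le_pos.
      assert (Sb : 0 <= S * b) by now apply Rmult_le_pos.
      apply Rle_trans with (S * a * 1 + S * b * 1).
      rewrite !(Rmult_assoc (S * _)). apply Rplus_le_compat; now apply Rmult_le_compat_l.
      right. transitivity (S * (a + b)). ring. rewrite Hab. ring.
  - rewrite mean_le_inf in *. intros z Hz. eapply Rle_trans. apply Cmod_triangle.
    apply Rplus_le_compat; auto.
  - contradiction.
Qed.

Lemma mean_le_scal (p : Rbar) (r : R) (c : C) (f : C -> C) (A : R) : 0 <= r -> Rbar_le 1 p ->
  circ_cont r f -> mean_le p r f A -> mean_le p r (fun z => (c * f z)%C) (Cmod c * A).
Proof.
  intros Hr Hp Hf HA.
  assert (A0 := mean_le_ge0 _ _ _ _ Hr Hp HA). assert (C0 := Cmod_ge_0 c).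
  destruct p as [q| |]; simpl in Hp.
  - apply mean_le_fin in HA; try lra. apply mean_le_fin; try lra. now apply Rmult_le_pos.
    rewrite rpow_mult by trivial.
    apply Rle_trans with (rpow (Cmod c) q * pmean q r f).
    + right. unfold pmean. rewrite <- rmean_scal by (intros t; apply pmean_cont; trivial; lra).
      unfold rmean. f_equal. apply RInt_ext. intros t _. rewrite Cmod_mult.
      apply rpow_mult; trivial. apply Cmod_ge_0.
    + apply Rmult_le_compat_l; trivial. apply rpow_ge0.
  - rewrite mean_le_inf in *. intros z Hz. rewrite Cmod_mult. apply Rmult_le_compat_l; auto.
  - contradiction.
Qed.

Lemma circle_pt_rot (r t s : R) : (circle_pt 1 s * circle_pt r t)%C = circle_pt r (t + s).
Proof.
  unfold circle_pt. rewrite cos_plus, sin_plus. apply injective_projections; simpl; ring.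
Qed.

Lemma RInt_shift (u : R -> R) (v a b : R) : (forall t, continuous u t) ->
  RInt (fun t => u (t + v)) a b = RInt u (a + v) (b + v).
Proof.
  intros Hu. assert (H := RInt_comp_lin (V := R_CompleteNormedModule) u 1 v a b).
  rewrite !Rmult_1_l in H.
  rewrite <- H by (apply (ex_RInt_continuous (V := R_CompleteNormedModule)); auto).
  apply RInt_ext. intros t _. change (u (t + v) = 1 * u (1 * t + v)).
  now rewrite !Rmult_1_l.
Qed.

Lemma rmean_shift (u : R -> R) (v : R) : (forall t, continuous u t) ->
  (forall t, u (t + 2 * PI) = u t) -> rmean (fun t => u (t + v)) = rmean u.
Proof.
  intros Hu Hper. unfold rmean. f_equal.
  rewrite RInt_shift by trivial. rewrite Rplus_0_l.
  assert (Hex : forall a b, ex_RInt u a b).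
  { intros a b. apply (ex_RInt_continuous (V := R_CompleteNormedModule)). auto. }
  assert (E : RInt u (2 * PI) (2 * PI + v) = RInt u 0 v).
  { assert (H := RInt_shift u (2 * PI) 0 v Hu).
    rewrite Rplus_0_l, (Rplus_comm v) in H. rewrite <- H.
    apply RInt_ext. intros t _. apply Hper. }
  assert (C1 := RInt_Chasles (V := R_CompleteNormedModule) u 0 v (2 * PI + v) (Hex _ _) (Hex _ _)).
  assert (C2 := RInt_Chasles (V := R_CompleteNormedModule) u 0 (2 * PI) (2 * PI + v) (Hex _ _) (Hex _ _)).
  unfold plus in C1, C2; simpl in C1, C2. rewrite E in C2. lra.
Qed.

Lemma circle_pt_period (r t : R) : circle_pt r (t + 2 * PI) = circle_pt r t.
Proof.
  unfold circle_pt. rewrite cos_plus, sin_plus, cos_2PI, sin_2PI.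
  apply injective_projections; simpl; ring.
Qed.

Lemma mean_le_rot (p : Rbar) (r s : R) (f : C -> C) (A : R) : 0 <= r -> Rbar_le 1 p ->
  circ_cont r f -> mean_le p r f A -> mean_le p r (fun z => f (circle_pt 1 s * z)%C) A.
Proof.
  intros Hr Hp Hf HA. assert (A0 := mean_le_ge0 _ _ _ _ Hr Hp HA).
  destruct p as [q| |]; simpl in Hp.
  - apply mean_le_fin in HA; try lra. apply mean_le_fin; try lra.
    eapply Rle_trans; [|exact HA]. right. unfold pmean.
    rewrite <- (rmean_shift (fun t => rpow (Cmod (f (circle_pt r t))) q) s).
    + unfold rmean. f_equal. apply RInt_ext. intros t _. now rewrite circle_pt_rot.
    + intros t; apply pmean_cont; trivial; lra.
    + intros t. now rewrite circle_pt_period.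
  - rewrite mean_le_inf in *. intros z Hz. apply HA.
    rewrite Cmod_mult, Cmod_circle_pt by lra. lra.
  - contradiction.
Qed.

Lemma mean_le_dil (p : Rbar) (r s : R) (f : C -> C) (A : R) : 0 < s ->
  mean_le p (s * r) f A <-> mean_le p r (fun z => f (RtoC s * z)%C) A.
Proof.
  intros Hs. destruct p as [q| |].
  - unfold mean_le, integral_mean.
    replace (RInt (fun t => rpow (Cmod (f (circle_pt (s * r) t))) q) 0 (2 * PI)) with
      (RInt (fun t => rpow (Cmod (f (RtoC s * circle_pt r t)%C)) q) 0 (2 * PI)). tauto.
    apply RInt_ext. intros t _. now rewrite circle_pt_scal.
  - rewrite !mean_le_inf. split; intros H z Hz.
    + apply H. rewrite Cmod_mult, Cmod_R, Rabs_right, Hz by lra. reflexivity.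
    + replace z with (RtoC s * (RtoC (/ s) * z))%C.
      apply H. rewrite Cmod_mult, Cmod_R, Rabs_right, Hz. field; lra.
      apply Rle_ge, Rlt_le. now apply Rinv_0_lt_compat.
      rewrite Cmult_assoc, <- RtoC_mult, Rinv_r by lra. ring.
  - unfold mean_le; simpl. tauto.
Qed.

(** * Minkowski's integral inequality and the Poisson formula *)

Lemma circle_lip_le (r s t : R) : 0 <= r -> s <= t ->
  Cmod (circle_pt r t - circle_pt r s) <= r * (t - s).
Proof.
  intros Hr Hst.
  rewrite <- (CInt_FTC (fun t => circle_pt r t) (fun t => (Ci * circle_pt r t * 1)%C)); trivial.
  - rewrite (Rmult_comm r). apply CInt_norm_const; trivial.
    apply pcont_ex; trivial. pc.
    intros x _. rewrite !Cmod_mult, Cmod_Ci, Cmod_1, Cmod_circle_pt by trivial. lra.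
  - intros x _. apply (is_Rder_circle (fun z => z)). apply is_Cder_id.
  - intros x _. revert x. change (pcont (fun t => (Ci * circle_pt r t * 1)%C)). pc.
Qed.

Lemma circle_lip (r s t : R) : 0 <= r ->
  Cmod (circle_pt r t - circle_pt r s) <= r * Rabs (t - s).
Proof.
  intros Hr. destruct (Rle_dec s t).
  rewrite Rabs_right by lra. now apply circle_lip_le.
  rewrite Cmod_minus_sym, Rabs_left by lra. rewrite Ropp_minus_distr. apply circle_lip_le; lra.
Qed.

Lemma cos_lip (s t : R) : Rabs (cos t - cos s) <= Rabs (t - s).
Proof.
  assert (H := circle_lip 1 s t ltac:(lra)). rewrite Rmult_1_l in H.
  eapply Rle_trans; [|exact H]. eapply Rle_trans; [|apply re_le_Cmod].
  unfold circle_pt. simpl. right. f_equal. ring.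
Qed.

Lemma lip_ccont (u : R -> C) (L : R) :
  (forall t t', Cmod (u t - u t') <= L * Rabs (t - t')) -> pcont u.
Proof.
  intros H t. apply ccont_R_eps. intros e He.
  assert (HL := Rabs_pos L). assert (HL2 := Rle_abs L).
  exists (e / (Rabs L + 1)). split. apply Rdiv_lt_0_compat; lra.
  intros y Hy. eapply Rle_lt_trans. apply H.
  apply (Rmult_lt_compat_r (Rabs L + 1)) in Hy; [|lra].
  unfold Rdiv in Hy. rewrite Rmult_assoc, Rinv_l in Hy by lra.
  assert (Hy0 := Rabs_pos (y - t)). nra.
Qed.

Lemma lip_continuous (m : R -> R) (L : R) :
  (forall t t', Rabs (m t - m t') <= L * Rabs (t - t')) -> forall t, continuous m t.
Proof.
  intros H t. apply (ccont_fst (fun t => RtoC (m t))).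
  apply lip_ccont with L. intros x y. rewrite <- RtoC_minus, Cmod_R. apply H.
Qed.

Lemma pcont_circ_lip (r L : R) (v : C -> C) : 0 <= r -> 0 <= L ->
  (forall z z', Cmod z = r -> Cmod z' = r -> Cmod (v z - v z') <= L * Cmod (z - z')) -> circ_cont r v.
Proof.
  intros Hr HL H. apply lip_ccont with (L * r). intros t t'. eapply Rle_trans.
  apply H; now apply Cmod_circle_pt. rewrite Rmult_assoc. apply Rmult_le_compat_l; trivial.
  now apply circle_lip.
Qed.

Section IntegralMinkowski.
Variables (p : Rbar) (r L : R) (w : R -> C -> C) (m : R -> R).
Hypothesis (Hp : Rbar_le 1 p) (Hr : 0 <= r) (HL : 0 <= L).
Hypothesis (Hm : forall t, mean_le p r (w t) (m t)).
Hypothesis (Hw : forall t t' z z', Cmod z = r -> Cmod z' = r ->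
  Cmod (w t z - w t' z') <= L * (Rabs (t - t') + Cmod (z - z'))).
Hypothesis (Hml : forall t t', Rabs (m t - m t') <= L * Rabs (t - t')).

Let v (a b : R) (z : C) : C := CInt (fun t => w t z) a b.

Lemma minkowski_pcont (z : C) : Cmod z = r -> pcont (fun t => w t z).
Proof.
  intros Hz. apply lip_ccont with L. intros t t'. eapply Rle_trans. apply Hw; trivial.
  replace (z - z)%C with (RtoC 0) by ring. rewrite Cmod_0. lra.
Qed.

Lemma minkowski_circ_cont (t : R) : circ_cont r (w t).
Proof.
  apply pcont_circ_lip with L; trivial. intros z z' Hz Hz'. eapply Rle_trans. apply Hw; trivial.
  replace (t - t) with 0 by ring. rewrite Rabs_R0. lra.
Qed.

Lemma minkowski_int_circ_cont (a b : R) : a <= b -> circ_cont r (v a b).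
Proof.
  intros Hab. apply pcont_circ_lip with ((b - a) * L); trivial. nra. intros z z' Hz Hz'.
  unfold v. rewrite <- CInt_minus by (apply pcont_ex; trivial; now apply minkowski_pcont).
  rewrite Rmult_assoc. apply CInt_norm_const; trivial.
  apply pcont_ex; trivial. apply pcont_minus; now apply minkowski_pcont.
  intros t _. eapply Rle_trans. apply Hw; trivial.
  replace (t - t) with 0 by ring. rewrite Rabs_R0. lra.
Qed.

(** Freezing w at the left end c costs L (d - c)^2 in the integral of w, uniformly on the circle,
    and the same amount when (d - c) m c is compared with the integral of m; hence the factor 2. *)
Lemma minkowski_piece (c d : R) : c <= d ->
  mean_le p r (v c d) (RInt m c d + 2 * L * (d - c) ^ 2).
Proof.
  intros Hcd.
  assert (Hmc := lip_continuous m L Hml).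
  apply mean_le_mono with ((d - c) * m c + (d - c) * (L * (d - c))).
  { assert (H : (d - c) * (m c - L * (d - c)) <= RInt m c d).
    { rewrite <- RInt_const_R. apply RInt_le; trivial.
      apply (ex_RInt_const (V := R_NormedModule)). apply rcont_ex; trivial.
      intros x Hx. specialize (Hml x c). rewrite (Rabs_right (x - c)) in Hml by lra.
      apply Rabs_le_between in Hml. nra. }
    nra. }
  assert (H0 := minkowski_int_circ_cont c d Hcd).
  assert (H1 := minkowski_circ_cont c).
  apply mean_le_ext with (f := fun z => (RtoC (d - c) * w c z + (v c d z - RtoC (d - c) * w c z))%C); trivial.
  intros; ring.
  assert (H2 : circ_cont r (fun z => (RtoC (d - c) * w c z)%C)).
  { apply pcont_mult; trivial. apply pcont_const. }
  apply mean_le_plus; trivial.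
  - now apply circ_cont_minus.
  - assert (K := mean_le_scal p r (RtoC (d - c)) (w c) (m c) Hr Hp H1 (Hm c)).
    rewrite Cmod_R, Rabs_right in K by lra. exact K.
  - apply mean_le_sup; trivial. now apply circ_cont_minus.
    intros z Hz. assert (Hc := minkowski_pcont z Hz). unfold v.
    replace (RtoC (d - c) * w c z)%C with (CInt (fun _ => w c z) c d) by apply CInt_const.
    rewrite <- CInt_minus by (apply pcont_ex; trivial; apply pcont_const).
    apply CInt_norm_const; trivial. apply pcont_ex; trivial. apply pcont_minus; trivial. apply pcont_const.
    intros t Ht. eapply Rle_trans. apply Hw; trivial.
    replace (z - z)%C with (RtoC 0) by ring. rewrite Cmod_0, Rabs_right by lra.
    apply Rmult_le_compat_l; lra.
Qed.

Lemma minkowski_pieces (a h : R) (n : nat) : 0 <= h ->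
  mean_le p r (v a (a + INR n * h)) (RInt m a (a + INR n * h) + INR n * (2 * L * h ^ 2)).
Proof.
  intros Hh. induction n.
  - apply mean_le_mono with (RInt m a (a + INR 0 * h) + 2 * L * (a + INR 0 * h - a) ^ 2).
    simpl. right; ring. apply minkowski_piece. simpl; lra.
  - assert (Hn := pos_INR n). assert (Hnh : 0 <= INR n * h) by (now apply Rmult_le_pos).
    set (c := a + INR n * h) in *.
    replace (a + INR (S n) * h) with (c + h) by (unfold c; rewrite S_INR; ring).
    assert (Hac : a <= c) by (unfold c; lra). assert (Hch : c <= c + h) by lra.
    assert (Hmc := lip_continuous m L Hml).
    rewrite <- (RInt_Chasles (V := R_CompleteNormedModule) m a c (c + h)) by (now apply rcont_ex).
    apply mean_le_ext with (f := fun z => (v a c z + v c (c + h) z)%C); trivial.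
    { intros z Hz. unfold v. apply CInt_Chasles; apply pcont_ex; trivial; now apply minkowski_pcont. }
    eapply mean_le_mono; [|apply mean_le_plus; [trivial|trivial| | |exact IHn|apply minkowski_piece; exact Hch]];
      try (now apply minkowski_int_circ_cont).
    change (plus (RInt m a c) (RInt m c (c + h))) with (RInt m a c + RInt m c (c + h)).
    rewrite S_INR. replace (c + h - c) with h by ring. right; ring.
Qed.

(** Cut into n equal pieces: the quadratic errors add up to 2 L (b - a)^2 / n, which tends to 0. *)
Lemma minkowski_global (a b : R) : a <= b -> mean_le p r (v a b) (RInt m a b).
Proof.
  intros Hab. apply mean_le_eps. intros e He.
  set (X := 2 * L * (b - a) ^ 2).
  assert (HX : 0 <= X). { unfold X. apply Rmult_le_pos. lra. apply pow_le. lra. }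
  destruct (nfloor_ex (X / e)) as [n [_ Hn]].
  { apply Rmult_le_pos; trivial. apply Rlt_le. now apply Rinv_0_lt_compat. }
  assert (Hn0 := pos_INR n).
  assert (H := minkowski_pieces a ((b - a) / INR (S n)) (S n)).
  rewrite S_INR in H.
  replace (a + (INR n + 1) * ((b - a) / (INR n + 1))) with b in H by (field; lra).
  eapply mean_le_mono; [|apply H].
  apply Rplus_le_compat_l. replace ((INR n + 1) * (2 * L * ((b - a) / (INR n + 1)) ^ 2)) with (X / (INR n + 1)).
  apply Rmult_le_reg_r with (INR n + 1). lra. unfold Rdiv. rewrite Rmult_assoc, Rinv_l, Rmult_1_r by lra.
  apply (Rmult_lt_compat_r e) in Hn; trivial. unfold Rdiv in Hn. rewrite Rmult_assoc, Rinv_l in Hn by lra. lra.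
  unfold X. field. lra.
  apply Rmult_le_pos. lra. apply Rlt_le, Rinv_0_lt_compat; lra.
Qed.
End IntegralMinkowski.

(** Projection onto [a, b]. Precomposing with it extends a Lipschitz family from [a, b] to the line
    with the same constant, as the section above requires. *)
Definition clip (a b t : R) : R := Rmax a (Rmin b t).

Lemma clip_in (a b t : R) : a <= b -> a <= clip a b t <= b.
Proof. intros H. unfold clip, Rmax, Rmin. destruct (Rle_dec b t); destruct (Rle_dec a _); lra. Qed.

Lemma clip_id (a b t : R) : a <= t <= b -> clip a b t = t.
Proof. intros H. unfold clip, Rmax, Rmin. destruct (Rle_dec b t); destruct (Rle_dec a _); lra. Qed.

Lemma clip_lip (a b t t' : R) : a <= b -> Rabs (clip a b t - clip a b t') <= Rabs (t - t').
Proof.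
  intros H. unfold clip, Rmax, Rmin. destruct (Rle_dec b t), (Rle_dec b t');
    repeat destruct (Rle_dec a _); unfold Rabs; repeat destruct (Rcase_abs _); lra.
Qed.

Lemma integral_minkowski (p : Rbar) (r L a b : R) (w : R -> C -> C) (m : R -> R) :
  Rbar_le 1 p -> 0 <= r -> 0 <= L -> a <= b ->
  (forall t, a <= t <= b -> mean_le p r (w t) (m t)) ->
  (forall t t' z z', a <= t <= b -> a <= t' <= b -> Cmod z = r -> Cmod z' = r ->
     Cmod (w t z - w t' z') <= L * (Rabs (t - t') + Cmod (z - z'))) ->
  (forall t t', a <= t <= b -> a <= t' <= b -> Rabs (m t - m t') <= L * Rabs (t - t')) ->
  mean_le p r (fun z => CInt (fun t => w t z) a b) (RInt m a b) /\
  circ_cont r (fun z => CInt (fun t => w t z) a b).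
Proof.
  intros Hp Hr HL Hab H1 H2 H3.
  set (w' := fun t => w (clip a b t)). set (m' := fun t => m (clip a b t)).
  assert (Ew : forall z, CInt (fun t => w t z) a b = CInt (fun t => w' t z) a b).
  { intros z. apply CInt_ext; trivial. intros t Ht. unfold w'. now rewrite clip_id. }
  assert (Em : RInt m a b = RInt m' a b).
  { apply RInt_ext_le; trivial. intros t Ht. unfold m'. now rewrite clip_id. }
  assert (Hc := fun t => clip_in a b t Hab).
  assert (K2 : forall t t' z z', Cmod z = r -> Cmod z' = r ->
     Cmod (w' t z - w' t' z') <= L * (Rabs (t - t') + Cmod (z - z'))).
  { intros t t' z z' Hz Hz'. eapply Rle_trans. apply H2; auto. apply Rmult_le_compat_l; trivial.
    apply Rplus_le_compat_r. now apply clip_lip. }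
  assert (K3 : forall t t', Rabs (m' t - m' t') <= L * Rabs (t - t')).
  { intros t t'. eapply Rle_trans. apply H3; auto. apply Rmult_le_compat_l; trivial. now apply clip_lip. }
  assert (K1 : forall t, mean_le p r (w' t) (m' t)) by (intros; now apply H1).
  split.
  - rewrite Em. apply mean_le_ext with (fun z => CInt (fun t => w' t z) a b); trivial.
    intros z _. now rewrite Ew.
    now apply minkowski_global with L.
  - intros t. apply ccont_ext with (fun t => CInt (fun s => w' s (circle_pt r t)) a b).
    intros; now rewrite Ew. revert t. now apply (minkowski_int_circ_cont r L w').
Qed.

(** * The Poisson kernel of the unit disc and the monotonicity of integral means *)

Definition PK (s t : R) : R := (1 - s ^ 2) / (1 - 2 * s * cos t + s ^ 2).

Lemma PK_den (s t : R) : 0 <= s < 1 -> (1 - s) ^ 2 <= 1 - 2 * s * cos t + s ^ 2.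
Proof. intros Hs. assert (H := COS_bound t). nra. Qed.

Lemma PK_pos (s t : R) : 0 <= s < 1 -> 0 <= PK s t.
Proof.
  intros Hs. assert (H := PK_den s t Hs). unfold PK. apply Rmult_le_pos. nra.
  apply Rlt_le, Rinv_0_lt_compat. nra.
Qed.

Lemma PK_lip (s : R) : 0 <= s < 1 -> exists L, 0 <= L /\ forall t t',
  PK s t <= L /\ Rabs (PK s t - PK s t') <= L * Rabs (t - t').
Proof.
  intros Hs. set (d := (1 - s) ^ 2). assert (Hd : 0 < d) by (unfold d; nra).
  assert (Hdi : 0 < / d) by now apply Rinv_0_lt_compat.
  exists (/ d + 2 * / d * / d). split. nra.
  assert (Hb : forall t, 0 < / (1 - 2 * s * cos t + s ^ 2) <= / d).
  { intros t. assert (H := PK_den s t Hs). fold d in H. split.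
    apply Rinv_0_lt_compat; lra. apply Rinv_le_contravar; lra. }
  intros t t'. split.
  - unfold PK, Rdiv. specialize (Hb t). nra.
  - assert (E : PK s t - PK s t' = (1 - s ^ 2) * (/ (1 - 2 * s * cos t + s ^ 2) *
       / (1 - 2 * s * cos t' + s ^ 2)) * (2 * s) * (cos t - cos t')).
    { unfold PK. assert (A1 := PK_den s t Hs). assert (A2 := PK_den s t' Hs). fold d in A1, A2.
      field. split; lra. }
    rewrite E. set (X := / (1 - 2 * s * cos t + s ^ 2) * / (1 - 2 * s * cos t' + s ^ 2)).
    assert (HX : 0 <= X <= / d * / d).
    { unfold X. assert (B1 := Hb t). assert (B2 := Hb t'). split. nra.
      apply Rmult_le_compat; lra. }
    rewrite Rabs_mult. apply Rmult_le_compat. apply Rabs_pos. apply Rabs_pos.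
    rewrite Rabs_right. apply Rle_trans with (X * (2 * s)).
    rewrite !Rmult_assoc. rewrite <- (Rmult_1_l (X * _)) at 2. apply Rmult_le_compat_r; nra.
    nra. apply Rle_ge. apply Rmult_le_pos; [|lra]. apply Rmult_le_pos; nra.
    apply cos_lip.
Qed.

Lemma circle_1_conj (t : R) : Cconj (circle_pt 1 t) = (/ circle_pt 1 t)%C /\ circle_pt 1 t <> RtoC 0.
Proof.
  assert (H : circle_pt 1 t <> RtoC 0).
  { intros E. assert (A := Cmod_circle_pt 1 t ltac:(lra)). rewrite E, Cmod_0 in A. lra. }
  split; trivial. assert (K := circle_pt_conj 1 t). rewrite Rmult_1_l in K.
  transitivity ((circle_pt 1 t * Cconj (circle_pt 1 t)) * / circle_pt 1 t)%C.
  field; trivial. rewrite K. ring.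
Qed.

(* Cauchy's formula at [s e^(i th)] for the product of [F] and [(1 - s^2) / (1 - s e^(-i th) z)]. *)
Lemma poisson (rho s th : R) (F : C -> C) : ana rho F -> 1 < rho -> 0 <= s < 1 ->
  F (circle_pt s th) = cmean (fun t => (RtoC (PK s (t - th)) * F (circle_pt 1 t))%C).
Proof.
  (* The pole of the second factor has modulus 1 / s, which exceeds 2 / (1 + s) > 1 when s > 0. *)
  intros HF Hrho Hs. set (rho' := Rmin rho (2 / (1 + s))).
  assert (H2s : 1 < 2 / (1 + s)).
  { apply Rmult_lt_reg_r with (1 + s). lra. unfold Rdiv. rewrite Rmult_assoc, Rinv_l; lra. }
  assert (Hr1 : 1 < rho') by (unfold rho'; now apply Rmin_glb_lt).
  assert (Hsr : s * rho' < 1 \/ s = 0).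
  { destruct (Req_dec s 0) as [|Hn]. now right. left.
    apply Rle_lt_trans with (s * (2 / (1 + s))). apply Rmult_le_compat_l. lra. apply Rmin_r.
    apply Rmult_lt_reg_r with (1 + s). lra. unfold Rdiv. rewrite !Rmult_assoc, Rinv_l; lra. }
  set (e := circle_pt 1 th). destruct (circle_1_conj th) as [Hec He0]. fold e in Hec, He0.
  assert (Hemod : Cmod (Cconj e) = 1) by (rewrite Cmod_conj; apply Cmod_circle_pt; lra).
  assert (Hden : forall z, Cmod z < rho' -> (1 - s * Cconj e * z)%C <> RtoC 0).
  { intros z Hz. apply Cminus_neq_0. intros E.
    assert (E1 : Cmod (s * Cconj e * z) = 1) by (rewrite <- E; apply Cmod_1).
    rewrite !Cmod_mult, Cmod_R, Hemod, Rabs_right in E1 by lra.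
    assert (Hz0 := Cmod_ge_0 z). nra. }
  set (G := fun z => (F z * (RtoC (1 - s ^ 2) * / (1 - s * Cconj e * z)))%C).
  assert (HG : ana rho' G).
  { apply ana_mult. apply ana_le with rho; trivial. apply Rmin_l.
    apply ana_mult. apply ana_const. apply ana_inv; trivial. apply ana_minus. apply ana_const.
    apply ana_mult. apply ana_const. apply ana_id. }
  assert (Ese : circle_pt s th = (RtoC s * e)%C).
  { unfold e. rewrite <- circle_pt_scal. f_equal. ring. }
  assert (Ha : Cmod (circle_pt s th) < 1) by (rewrite Cmod_circle_pt; lra).
  assert (C1 := cauchy_formula rho' 1 G (circle_pt s th) HG ltac:(lra) Ha).
  assert (N1 : (1 - s * s)%C <> RtoC 0).
  { rewrite <- RtoC_mult, <- RtoC_minus. intros E. apply RtoC_inj in E. nra. }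
  assert (EG : G (circle_pt s th) = F (circle_pt s th)).
  { unfold G. rewrite Ese, Hec. replace (1 - s * / e * (s * e))%C with (1 - s * s)%C by (field; trivial).
    simpl. rewrite RtoC_minus, !RtoC_mult. field; trivial. }
  rewrite <- EG, C1. apply cmean_ext. intros t. unfold G.
  set (c := circle_pt 1 t). destruct (circle_1_conj t) as [Hcc Hc0]. fold c in Hcc, Hc0.
  assert (Hd := Hden c ltac:(unfold c; rewrite Cmod_circle_pt; lra)).
  assert (Hk := circle_neq 1 t _ ltac:(lra) Ha). fold c in Hk. rewrite Ese in *.
  assert (Ep : RtoC (1 - 2 * s * cos (t - th) + s ^ 2) = ((1 - s * Cconj e * c) * (c - s * e) * / c)%C).
  { assert (E1 : RtoC (2 * cos (t - th)) = (e * Cconj c + Cconj e * c)%C).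
    { unfold c, e, circle_pt. rewrite cos_minus. apply injective_projections; simpl; ring. }
    replace (1 - 2 * s * cos (t - th) + s ^ 2) with (1 - s * (2 * cos (t - th)) + s * s) by ring.
    rewrite RtoC_plus, RtoC_minus, !RtoC_mult, <- RtoC_mult, E1, Hcc, Hec. field. split; trivial. }
  assert (HN : 1 - 2 * s * cos (t - th) + s ^ 2 <> 0).
  { assert (A := PK_den s (t - th) Hs). nra. }
  unfold PK. rewrite RtoC_div by trivial. rewrite Ep. field. repeat split; trivial.
Qed.

Lemma PK_continuous (s th t : R) : 0 <= s < 1 -> continuous (fun t => PK s (t - th)) t.
Proof.
  intros Hs. destruct (PK_lip s Hs) as (L & HL & H). revert t. apply lip_continuous with L.
  intros t t'. replace (t - t') with ((t - th) - (t' - th)) by ring. apply H.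
Qed.

Lemma pcont_PK (s th : R) : 0 <= s < 1 -> pcont (fun t => RtoC (PK s (t - th))).
Proof. intros Hs t. apply ccont_RtoC. now apply PK_continuous. Qed.

Lemma rmean_PK (s th : R) : 0 <= s < 1 -> rmean (fun t => PK s (t - th)) = 1.
Proof.
  intros Hs. apply RtoC_inj. rewrite <- cmean_RtoC by (intros; now apply PK_continuous).
  rewrite (poisson 2 s th (fun _ => RtoC 1)) at 1; try lra; try apply ana_const.
  apply cmean_ext. intros t. ring.
Qed.

Lemma fst_cmean (u : R -> C) : pcont u -> fst (cmean u) = rmean (fun t => fst (u t)).
Proof.
  intros Hu. unfold cmean, rmean. simpl. rewrite Rmult_0_l, Rminus_0_r. f_equal.
  symmetry. apply is_RInt_unique, CInt_fst. apply pcont_ex; trivial. assert (P := two_PI_pos); lra.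
Qed.

(** Poisson's formula for the identity function, rotated back by e^(- i th). It supplies the Poisson
    mean of the squared chord. *)
Lemma rmean_PK_cos (s th : R) : 0 <= s < 1 ->
  rmean (fun t => PK s (t - th) * cos (t - th)) = s.
Proof.
  intros Hs. assert (H := poisson 2 s th (fun z => z) (ana_id 2) ltac:(lra) Hs).
  assert (Hc : pcont (fun t => (RtoC (PK s (t - th)) * circle_pt 1 t)%C)).
  { pc. now apply pcont_PK. }
  assert (E : RtoC s = (Cconj (circle_pt 1 th) * circle_pt s th)%C).
  { assert (E1 : circle_pt s th = (RtoC s * circle_pt 1 th)%C) by (rewrite <- circle_pt_scal; f_equal; ring).
    assert (E2 := circle_pt_conj 1 th). rewrite E1.
    transitivity (s * (circle_pt 1 th * Cconj (circle_pt 1 th)))%C. 2: ring.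
    rewrite E2, Rmult_1_l. ring. }
  rewrite H, <- cmean_scal in E by trivial.
  apply (f_equal fst) in E. rewrite fst_cmean in E by pc.
  symmetry. etransitivity; [exact E|]. unfold rmean. f_equal. apply RInt_ext. intros t _.
  unfold circle_pt. simpl. rewrite cos_minus. req. ring.
Qed.

(** By Poisson's formula for x |-> H(z x), H(s z) is the average of the rotates H(e^(it) z) against
    the Poisson kernel. Rotation preserves means and the kernel has mean 1, so the integral form of
    Minkowski's inequality concludes. *)
Lemma mean_le_radius (p : Rbar) (rho r s B : R) (H : C -> C) : Rbar_le 1 p -> ana rho H ->
  0 < r < rho -> 0 < s < 1 -> mean_le p r H B -> mean_le p (s * r) H B.
Proof.
  intros Hp HH Hr Hs HB. apply mean_le_dil. lra.
  assert (B0 := mean_le_ge0 p r H B ltac:(lra) Hp HB).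
  assert (Hs' : 0 <= s < 1) by lra.
  destruct (PK_lip s Hs') as (L & HL & HPK).
  destruct (ana_est rho r H HH) as (K & HK & HKe). lra.
  set (i := / (2 * PI)). assert (Hi : 0 < i) by apply inv_two_PI_pos.
  set (w := fun t z => (RtoC (i * PK s t) * H (circle_pt 1 t * z)%C)%C).
  set (m := fun t => i * PK s t * B).
  set (M := i * (L * K * (1 + r) + L * K) + i * L * B).
  assert (LK : 0 <= L * K) by now apply Rmult_le_pos.
  assert (HiLB : 0 <= i * L * B) by (repeat apply Rmult_le_pos; lra).
  assert (HM0 : 0 <= i * (L * K * (1 + r) + L * K)).
  { apply Rmult_le_pos. lra. assert (0 <= L * K * (1 + r)) by (apply Rmult_le_pos; lra). lra. }
  assert (Hcirc : circ_cont r H) by (apply (pcont_ana rho); trivial; lra).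
  destruct (integral_minkowski p r M 0 (2 * PI) w m) as [IM _]; trivial; try lra.
  - unfold M. lra.
  - assert (P := two_PI_pos); lra.
  - intros t _. unfold w, m.
    assert (K0 := mean_le_rot p r t H B ltac:(lra) Hp Hcirc HB).
    assert (Hc : circ_cont r (fun z => H (circle_pt 1 t * z)%C)).
    { intros x. apply ccont_ext with (fun x => H (circle_pt r (x + t))).
      intros y. now rewrite circle_pt_rot.
      apply (continuous_comp (V := R_UniformSpace) (W := C_UniformSpace) (fun x => x + t) (fun x => H (circle_pt r x))).
      apply continuous_plusR. apply continuous_id. apply continuous_const. apply Hcirc. }
    apply mean_le_scal with (c := RtoC (i * PK s t)) in K0; trivial; try lra.
    rewrite Cmod_R, Rabs_right in K0. exact K0.
    apply Rle_ge, Rmult_le_pos. lra. now apply PK_pos.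
  - intros t t' z z' _ _ Hz Hz'. unfold w.
    set (u := (circle_pt 1 t * z)%C). set (u' := (circle_pt 1 t' * z')%C).
    assert (Hu : Cmod u <= r) by (unfold u; rewrite Cmod_mult, Cmod_circle_pt; lra).
    assert (Hu' : Cmod u' <= r) by (unfold u'; rewrite Cmod_mult, Cmod_circle_pt; lra).
    assert (Huu : Cmod (u - u') <= r * Rabs (t - t') + Cmod (z - z')).
    { unfold u, u'. replace (circle_pt 1 t * z - circle_pt 1 t' * z')%C with
        ((circle_pt 1 t - circle_pt 1 t') * z + circle_pt 1 t' * (z - z'))%C by ring.
      eapply Rle_trans. apply Cmod_triangle. rewrite !Cmod_mult, Hz, Cmod_circle_pt by lra.
      assert (A := circle_lip 1 t' t ltac:(lra)). nra. }
    destruct (HKe u' u Hu' Hu) as (_ & E2 & _). destruct (HKe u' u' Hu' Hu') as (E1 & _ & _).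
    destruct (HPK t t') as [P1 P2]. assert (P0 := PK_pos s t Hs').
    replace (RtoC (i * PK s t) * H u - RtoC (i * PK s t') * H u')%C with
      (RtoC (i * PK s t) * (H u - H u') + RtoC (i * (PK s t - PK s t')) * H u')%C
      by (rewrite !RtoC_mult, RtoC_minus; ring).
    eapply Rle_trans. apply Cmod_triangle. rewrite !Cmod_mult, !Cmod_R, !Rabs_mult.
    rewrite (Rabs_right i), (Rabs_right (PK s t)) by lra.
    assert (Ht0 := Rabs_pos (t - t')). assert (Hz0 := Cmod_ge_0 (z - z')).
    assert (F1 : i * PK s t * Cmod (H u - H u') <= i * (L * (K * (r * Rabs (t - t') + Cmod (z - z'))))).
    { rewrite Rmult_assoc. apply Rmult_le_compat_l. lra. apply Rmult_le_compat; trivial. apply Cmod_ge_0.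
      eapply Rle_trans. exact E2. now apply Rmult_le_compat_l. }
    assert (F2 : i * Rabs (PK s t - PK s t') * Cmod (H u') <= i * (L * Rabs (t - t') * K)).
    { rewrite Rmult_assoc. apply Rmult_le_compat_l. lra. apply Rmult_le_compat; trivial. apply Rabs_pos. apply Cmod_ge_0. }
    eapply Rle_trans. apply Rplus_le_compat; [exact F1 | exact F2].
    unfold M. assert (G1 : 0 <= i * (L * K)) by (apply Rmult_le_pos; lra).
    assert (G2 : 0 <= i * (L * K) * r) by (apply Rmult_le_pos; lra).
    assert (G3 := Rmult_le_pos _ _ G2 Hz0). assert (G4 := Rmult_le_pos _ _ G1 Hz0).
    assert (G5 := Rmult_le_pos _ _ G1 Ht0). assert (G6 := Rmult_le_pos _ _ HiLB Ht0).
    assert (G7 := Rmult_le_pos _ _ HiLB Hz0). lra.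
  - intros t t' _ _. unfold m. destruct (HPK t t') as [_ P2].
    replace (i * PK s t * B - i * PK s t' * B) with (i * B * (PK s t - PK s t')) by ring.
    assert (HiB : 0 <= i * B) by (apply Rmult_le_pos; lra).
    rewrite Rabs_mult, (Rabs_right (i * B)) by lra.
    apply (Rmult_le_compat_l _ _ _ HiB) in P2. eapply Rle_trans. exact P2.
    unfold M. assert (G := Rmult_le_pos _ _ HM0 (Rabs_pos (t - t'))). lra.
  - assert (Em : RInt m 0 (2 * PI) = B).
    { transitivity (B * rmean (fun t => PK s (t - 0))).
      rewrite <- rmean_scal by (intros; now apply PK_continuous).
      unfold rmean. fold i.
      rewrite <- (RInt_scal (V := R_CompleteNormedModule)).
      2:{ apply rcont_ex. assert (P := two_PI_pos); lra. intros t. apply continuous_scalR. now apply PK_continuous. }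
      apply RInt_ext. intros t _. unfold m. rewrite Rminus_0_r. unfold scal; simpl; unfold mult; simpl. ring.
      rewrite rmean_PK by trivial. req. ring. }
    rewrite Em in IM. refine (mean_le_ext p r _ _ B _ _ IM). lra.
    intros z Hz. set (F := fun x => H (z * x)%C).
    assert (HF : ana (rho / r) F).
    { apply (ana_comp_scal rho); trivial. rewrite Hz. right; field; lra. rewrite Hz; lra. }
    assert (Hrr : 1 < rho / r).
    { apply Rmult_lt_reg_r with r. lra. unfold Rdiv. rewrite Rmult_assoc, Rinv_l; lra. }
    assert (E := poisson (rho / r) s 0 F HF Hrr Hs').
    assert (HFc : pcont (fun t => F (circle_pt 1 t))) by (apply (pcont_ana (rho / r)); trivial; lra).
    replace (RtoC s * z)%C with (z * circle_pt s 0)%C.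
    2:{ unfold circle_pt. rewrite cos_0, sin_0. apply injective_projections; simpl; ring. }
    change (CInt (fun t => w t z) 0 (2 * PI) = F (circle_pt s 0)). rewrite E. unfold cmean. fold i.
    rewrite <- CInt_scal.
    2:{ apply pcont_ex. assert (P := two_PI_pos); lra. apply pcont_mult; trivial. now apply pcont_PK. }
    apply CInt_ext. assert (P := two_PI_pos); lra.
    intros t _. unfold w, F. rewrite Rminus_0_r, RtoC_mult, (Cmult_comm z). ceq. ring.
Qed.

(** * Outer functions and factorization *)

Lemma circle_chord_sq (t th : R) :
  Cmod (circle_pt 1 t - circle_pt 1 th) ^ 2 = 2 - 2 * cos (t - th).
Proof.
  rewrite Cmod2_alt. unfold circle_pt. simpl. rewrite cos_minus.
  assert (S1 := sin2_cos2 t). assert (S2 := sin2_cos2 th). unfold Rsqr in S1, S2. nra.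
Qed.

(* The Poisson mean of the chord length is estimated by AM-GM and the mean [2 - 2 s] of its square. *)
Lemma poisson_approx (w : R -> R) (L s th d : R) : 0 <= L -> 0 <= s < 1 -> 0 < d ->
  (forall t t', Rabs (w t - w t') <= L * Cmod (circle_pt 1 t - circle_pt 1 t')) ->
  Rabs (rmean (fun t => PK s (t - th) * w t) - w th) <= L * (d / 2 + (1 - s) / d).
Proof.
  intros HL Hs Hd Hw.
  assert (Hwc : forall t, continuous w t).
  { apply lip_continuous with L. intros t t'. eapply Rle_trans. apply Hw.
    apply Rmult_le_compat_l; trivial. rewrite <- (Rmult_1_l (Rabs _)). apply circle_lip; lra. }
  assert (HP := fun t => PK_continuous s th t Hs).
  assert (Hcos : forall t, continuous (fun t => cos (t - th)) t).
  { intros t. apply (ex_derive_continuous (V := R_NormedModule)). auto_derive; auto. }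
  assert (Hm : forall u v : R -> R, (forall t, continuous u t) -> (forall t, continuous v t) ->
     forall t, continuous (fun t => u t * v t) t).
  { intros u v Hu Hv t. now apply (continuous_mult (K := R_AbsRing)). }
  set (D := fun t => d / 2 + (2 - 2 * cos (t - th)) / (2 * d)).
  assert (HD : forall t, Rabs (w t - w th) <= L * D t).
  { intros t. eapply Rle_trans. apply Hw. apply Rmult_le_compat_l; trivial.
    unfold D. rewrite <- circle_chord_sq. set (x := Cmod _).
    assert (Hx : 0 <= (x - d) ^ 2) by apply pow2_ge_0.
    apply Rmult_le_reg_r with (2 * d). lra.
    replace ((d / 2 + x ^ 2 / (2 * d)) * (2 * d)) with (d ^ 2 + x ^ 2) by (field; lra). nra. }
  assert (ED : rmean (fun t => PK s (t - th) * D t) = d / 2 + (1 - s) / d).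
  { transitivity (rmean (fun t => (d / 2 + / d) * PK s (t - th) + - / d * (PK s (t - th) * cos (t - th)))).
    unfold rmean. f_equal. apply RInt_ext. intros t _. unfold D. req. field. lra.
    rewrite rmean_plus, !rmean_scal, rmean_PK, rmean_PK_cos; trivial; try (now apply Hm).
    field; lra.
    intros t; now apply continuous_scalR. intros t; apply continuous_scalR; now apply Hm. }
  assert (HDc : forall t, continuous D t).
  { intros t. unfold D. apply (ex_derive_continuous (V := R_NormedModule)). auto_derive; auto. }
  assert (Up : forall k, k = 1 \/ k = -1 -> k * (rmean (fun t => PK s (t - th) * w t) - w th) <= L * (d / 2 + (1 - s) / d)).
  { intros k Hk. rewrite <- ED. rewrite <- rmean_scal by (now apply Hm).
    replace (k * (rmean (fun t => PK s (t - th) * w t) - w th)) with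
      (rmean (fun t => k * (PK s (t - th) * w t) + - k * w th * PK s (t - th))).
    2:{ rewrite rmean_plus, !rmean_scal, rmean_PK; trivial; try (now apply Hm). ring.
        intros t; apply continuous_scalR; now apply Hm. intros t; now apply continuous_scalR. }
    apply rmean_le.
    - intros t. apply continuous_plusR; apply continuous_scalR; trivial. now apply Hm.
    - intros t; apply continuous_scalR; now apply Hm.
    - intros t. specialize (HD t). apply Rabs_le_between in HD.
      assert (HP0 := PK_pos s (t - th) Hs).
      replace (k * (PK s (t - th) * w t) + - k * w th * PK s (t - th)) with
        (PK s (t - th) * (k * (w t - w th))) by ring.
      replace (L * (PK s (t - th) * D t)) with (PK s (t - th) * (L * D t)) by ring.
      apply Rmult_le_compat_l; trivial. destruct Hk as [-> | ->]; lra. }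
  apply Rabs_le. assert (U1 := Up 1 ltac:(lra)). assert (U2 := Up (-1) ltac:(lra)). lra.
Qed.

(** W is the Herglotz integral of w evaluated at s z with s < 1: it is analytic across the unit
    circle, and its real part there is the Poisson mean of w, close to w for s near 1. *)
Lemma outer (w : R -> R) (L eta : R) : 0 <= L -> 0 < eta ->
  (forall t t', Rabs (w t - w t') <= L * Cmod (circle_pt 1 t - circle_pt 1 t')) ->
  exists rho W, 1 < rho /\ ana rho W /\ forall t, Rabs (fst (W (circle_pt 1 t)) - w t) <= eta.
Proof.
  intros HL He Hw.
  assert (Hwc : forall t, continuous w t).
  { apply lip_continuous with L. intros t t'. eapply Rle_trans. apply Hw.
    apply Rmult_le_compat_l; trivial. rewrite <- (Rmult_1_l (Rabs _)). apply circle_lip; lra. }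
  (* With 1 - s <= d^2 / 2 both terms d / 2 and (1 - s) / d of the approximation error are at most d
     / 2, and L d <= eta. *)
  set (d := eta / (L + 1)). assert (Hd : 0 < d) by (unfold d; apply Rdiv_lt_0_compat; lra).
  assert (HLd : L * d <= eta).
  { assert (E : (L + 1) * d = eta) by (unfold d; field; lra). nra. }
  set (x := Rmin (/ 2) (d * d / 2)).
  assert (Hx : 0 < x) by (unfold x; apply Rmin_glb_lt; nra).
  assert (Hx1 : x <= / 2) by apply Rmin_l. assert (Hx2 : x <= d * d / 2) by apply Rmin_r.
  set (s := 1 - x). assert (Hs : 0 <= s < 1) by (unfold s; lra). assert (Hs0 : 0 < s) by (unfold s; lra).
  set (k := fun t => (RtoC (w t) * circle_pt 1 t)%C).
  assert (Hk : pcont k). { apply pcont_mult. intros t; now apply ccont_RtoC. apply pcont_circle. }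
  assert (Hwp : pcont (fun t => RtoC (w t))) by (intros t; now apply ccont_RtoC).
  (* Under the mean, 2 c / (c - s z) - 1 = (c + s z) / (c - s z). *)
  set (W := fun z => (2 * CT1 1 k (s * z) - cmean (fun t => RtoC (w t)))%C).
  exists (/ s), W. split; [|split].
  - apply Rmult_lt_reg_l with s; trivial. rewrite Rinv_r; lra.
  - assert (HC : ana (/ s) (fun z => CT1 1 k (s * z)%C)).
    { apply (ana_comp_scal 1). rewrite Cmod_R, Rabs_right by lra. right; apply Rinv_r; lra.
      rewrite Cmod_R, Rabs_right; lra.
      intros z Hz. eexists. now apply is_Cder_CT1. }
    apply ana_minus. apply ana_mult; trivial. apply ana_const. apply ana_const.
  - intros t0.
    assert (Hsz : Cmod (s * circle_pt 1 t0) < 1).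
    { rewrite Cmod_mult, Cmod_R, Cmod_circle_pt, Rabs_right; lra. }
    assert (E : fst (W (circle_pt 1 t0)) = rmean (fun t => PK s (t - t0) * w t)).
    { unfold W, CT1.
      assert (Hker := pcont_kernel 1 _ ltac:(lra) Hsz).
      assert (Hc : pcont (fun t => (k t * / (circle_pt 1 t - s * circle_pt 1 t0))%C)) by pc.
      rewrite <- cmean_scal, <- cmean_minus by pc. rewrite fst_cmean by pc.
      unfold rmean. f_equal. apply RInt_ext. intros t _.
      (* the real part of [(c + s e) / (c - s e)] is the Poisson kernel *)
      set (c := circle_pt 1 t). set (e := circle_pt 1 t0).
      assert (Hd0 := circle_neq 1 t _ ltac:(lra) Hsz). fold c e in Hd0.
      assert (EQ : (2 * (k t * / (c - s * e)) - w t)%C =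
         (RtoC (w t / (1 - 2 * s * cos (t - t0) + s ^ 2)) * ((c + s * e) * Cconj (c - s * e)))%C).
      { assert (EN : RtoC (1 - 2 * s * cos (t - t0) + s ^ 2) = ((c - s * e) * Cconj (c - s * e))%C).
        { unfold c, e, circle_pt. rewrite cos_minus.
          assert (S1 := sin2_cos2 t). assert (S2 := sin2_cos2 t0). unfold Rsqr in S1, S2.
          apply injective_projections; simpl. 2: ring. nra. }
        assert (HN : 1 - 2 * s * cos (t - t0) + s ^ 2 <> 0).
        { assert (A := PK_den s (t - t0) Hs). nra. }
        assert (Hcj : Cconj (c - s * e) <> RtoC 0).
        { intros E0. rewrite E0, Cmult_0_r in EN. apply RtoC_inj in EN. contradiction. }
        rewrite RtoC_div by trivial. rewrite EN. unfold k. fold c. field. split; trivial. }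
      match goal with |- fst ?A = _ => transitivity (fst (RtoC (w t / (1 - 2 * s * cos (t - t0) + s ^ 2)) * ((c + s * e) * Cconj (c - s * e)))%C) end.
      f_equal. exact EQ.
      unfold c, e, circle_pt, PK. rewrite cos_minus.
      assert (S1 := sin2_cos2 t). assert (S2 := sin2_cos2 t0). unfold Rsqr in S1, S2.
      simpl. unfold Rdiv.
      match goal with |- w t * ?i * ?X - 0 * ?Y = _ => replace X with (1 - s * (s * 1)) end.
      ring. nra. }
    rewrite E. eapply Rle_trans. apply poisson_approx with (L := L) (d := d); trivial.
    replace (1 - s) with x by (unfold s; ring).
    assert (x / d <= d / 2).
    { apply Rmult_le_reg_r with d; trivial. unfold Rdiv at 1. rewrite Rmult_assoc, Rinv_l by lra. lra. }
    apply Rle_trans with (L * d); trivial. apply Rmult_le_compat_l; lra.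
Qed.

(** * The complex exponential *)

Definition cexp (z : C) : C := (exp (fst z) * cos (snd z), exp (fst z) * sin (snd z)).

Lemma exp_mono (x y : R) : x <= y -> exp x <= exp y.
Proof. intros [H | ->]. now apply Rlt_le, exp_increasing. apply Rle_refl. Qed.

Lemma cexp_plus (a b : C) : cexp (a + b) = (cexp a * cexp b)%C.
Proof.
  unfold cexp. simpl. rewrite exp_plus, cos_plus, sin_plus.
  apply injective_projections; simpl; ring.
Qed.

Lemma cexp_0 : cexp 0 = RtoC 1.
Proof. unfold cexp. simpl. rewrite exp_0, cos_0, sin_0. apply injective_projections; simpl; ring. Qed.

Lemma Cmod_cexp (z : C) : Cmod (cexp z) = exp (fst z).
Proof.
  unfold Cmod, cexp. simpl.
  replace (exp (fst z) * cos (snd z) * (exp (fst z) * cos (snd z) * 1) +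
    exp (fst z) * sin (snd z) * (exp (fst z) * sin (snd z) * 1)) with
    (exp (fst z) * exp (fst z) * (Rsqr (sin (snd z)) + Rsqr (cos (snd z)))) by (unfold Rsqr; ring).
  rewrite sin2_cos2, Rmult_1_r. apply sqrt_square. apply Rlt_le, exp_pos.
Qed.

Lemma cexp_ccont (z : C) : ccont (U := C_UniformSpace) cexp z.
Proof.
  assert (Hid := ccont_id z).
  assert (H1 := ccont_fst (fun y => y) z Hid). assert (H2 := ccont_snd (fun y => y) z Hid).
  assert (Hc : forall (h : R -> R) (u : C_UniformSpace -> R), (forall x, ex_derive h x) ->
    continuous u z -> continuous (fun y => h (u y)) z).
  { intros h u Hh Hu. apply (continuous_comp u h); trivial.
    now apply (ex_derive_continuous (V := R_NormedModule)). }
  apply ccont_pair; apply (continuous_mult (K := R_AbsRing)); apply Hc; trivial;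
    intros x; auto_derive; auto.
Qed.

(** At 0, cexp w - 1 is the integral over [0, 1] of w cexp(t w), and continuity of [cexp] suffices;
    the addition formula moves the result to any z. *)
Lemma is_Cder_cexp (z : C) : is_Cder cexp z (cexp z).
Proof.
  assert (H0 : is_Cder cexp 0 1).
  { apply is_Cder_eps. intros e He.
    assert (Hc := cexp_ccont 0). rewrite ccont_C_eps in Hc. destruct (Hc e He) as (d & Hd & H1).
    exists d. split; trivial. intros w Hw. rewrite cexp_0 in *.
    replace (w - 0)%C with w in * by ring.
    assert (Hpc : pcont (fun t => (w * cexp (RtoC t * w))%C)).
    { apply pcont_mult. apply pcont_const. intros t. apply ccont_comp.
      apply ccont_mult. apply ccont_RtoC, continuous_id. apply ccont_const. apply cexp_ccont. }
    assert (E : CInt (fun t => (w * cexp (RtoC t * w))%C) 0 1 = (cexp w - 1)%C).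
    { rewrite (CInt_FTC (fun t => cexp (RtoC t * w))).
      - rewrite Cmult_1_l, Cmult_0_l, cexp_0. reflexivity.
      - lra.
      - intros t _. unfold cexp. destruct w as [a b]. apply is_Rder_pair; simpl; auto_derive; auto;
        req; unfold Rminus; simpl; ring_simplify; repeat rewrite Rmult_0_l; ring.
      - intros t _. apply Hpc. }
    rewrite <- E.
    replace (w * 1)%C with (CInt (fun _ => w) 0 1).
    2:{ rewrite CInt_const. rewrite Rminus_0_r. ceq. ring. }
    rewrite <- CInt_minus; try (apply pcont_ex; trivial; try lra; apply pcont_const).
    replace (e * Cmod w) with ((1 - 0) * (e * Cmod w)) by ring. apply CInt_norm_const. lra.
    apply pcont_ex. lra. apply pcont_minus; trivial. apply pcont_const.
    intros t Ht. replace (w * cexp (RtoC t * w) - w)%C with ((cexp (RtoC t * w) - 1) * w)%C by ring.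
    rewrite Cmod_mult. apply Rmult_le_compat_r. apply Cmod_ge_0. apply Rlt_le.
    apply H1. replace (t * w - 0)%C with (t * w)%C by ring.
    rewrite Cmod_mult, Cmod_R, Rabs_right by lra. assert (A := Cmod_ge_0 w). nra. }
  assert (H1 := is_Cder_scal (cexp z) _ _ _ (is_Cder_comp cexp (fun w => (w - z)%C) z 1 (1 - 0)
    (is_Cder_minus _ _ _ _ _ (is_Cder_id z) (is_Cder_const z z))
    ltac:(cbv beta; replace (z - z)%C with (RtoC 0) by ring; exact H0))).
  replace (cexp z * (1 * (1 - 0)))%C with (cexp z) in H1 by ring.
  apply is_Cder_ext_loc with (d := 1) (3 := H1). lra.
  intros w _. rewrite <- cexp_plus. f_equal. ring.
Qed.

Lemma ana_cexp (rho : R) (f : C -> C) : ana rho f -> ana rho (fun z => cexp (f z)).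
Proof.
  intros Hf z Hz. destruct (ana_der rho f z Hf Hz) as [l Hl].
  exists (cexp (f z) * l)%C. apply (is_Cder_comp cexp f); trivial. apply is_Cder_cexp.
Qed.

(** W approximates ln(|f| + e1) on the circle. The added e1 makes this logarithm Lipschitz even if f
    vanishes there, and G is zero-free whatever the zeros of f are: they all stay in K = f exp(- W /
    2), where |K|^2 is about |f|^2 / (|f| + e1) <= |f|. *)
Lemma factorization (rho r e : R) (f : C -> C) : ana rho f -> 0 < r < rho -> 0 < e ->
  exists rho1 G K, r < rho1 <= rho /\ ana rho1 G /\ ana rho1 K /\
    (forall z, f z = (G z * K z)%C) /\
    forall t, Cmod (G (circle_pt r t)) ^ 2 <= Cmod (f (circle_pt r t)) + e /\
              Cmod (K (circle_pt r t)) ^ 2 <= Cmod (f (circle_pt r t)) + e.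
Proof.
  intros Hf Hr He. destruct (ana_est rho r f Hf) as (M & HM & HMe). lra.
  set (e1 := e / 2). assert (He1 : 0 < e1) by (unfold e1; lra).
  set (w := fun t => ln (Cmod (f (circle_pt r t)) + e1)).
  assert (Hx0 : forall t, 0 <= Cmod (f (circle_pt r t))) by (intros; apply Cmod_ge_0).
  assert (Hx1 : forall t, Cmod (circle_pt r t) <= r) by (intros; rewrite Cmod_circle_pt; lra).
  assert (Hln : forall x y, 0 <= x -> 0 <= y -> ln (x + e1) - ln (y + e1) <= / e1 * Rabs (x - y)).
  { intros x y Hx Hy. unfold Rminus at 1. rewrite <- ln_Rinv, <- ln_mult; try lra.
    2: apply Rinv_0_lt_compat; lra.
    assert (Hq : 0 < (x + e1) * / (y + e1)) by (apply Rmult_lt_0_compat; [lra | apply Rinv_0_lt_compat; lra]).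
    assert (A := exp_ineq1_le (ln ((x + e1) * / (y + e1)))). rewrite exp_ln in A by trivial.
    assert (E : (x + e1) * / (y + e1) = 1 + (x - y) * / (y + e1)) by (field; lra).
    assert (B : (x - y) * / (y + e1) <= / e1 * Rabs (x - y)).
    { rewrite Rmult_comm. apply Rle_trans with (/ (y + e1) * Rabs (x - y)).
      apply Rmult_le_compat_l. apply Rlt_le, Rinv_0_lt_compat; lra. apply Rle_abs.
      apply Rmult_le_compat_r. apply Rabs_pos. apply Rinv_le_contravar; lra. }
    lra. }
  assert (Hei : 0 < / e1) by now apply Rinv_0_lt_compat.
  set (L := / e1 * (M * r)).
  assert (HL : 0 <= L) by (unfold L; apply Rmult_le_pos; [lra | apply Rmult_le_pos; lra]).
  assert (Hw : forall t t', Rabs (w t - w t') <= L * Cmod (circle_pt 1 t - circle_pt 1 t')).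
  { intros t t'.
    assert (B : / e1 * Rabs (Cmod (f (circle_pt r t)) - Cmod (f (circle_pt r t'))) <= L * Cmod (circle_pt 1 t - circle_pt 1 t')).
    { unfold L. rewrite Rmult_assoc. apply Rmult_le_compat_l. lra.
      eapply Rle_trans. apply Cmod_cont_diff.
      destruct (HMe (circle_pt r t') (circle_pt r t) (Hx1 _) (Hx1 _)) as (_ & B & _).
      eapply Rle_trans. exact B. rewrite Rmult_assoc. apply Rmult_le_compat_l; trivial.
      replace r with (r * 1) by ring. rewrite !circle_pt_scal.
      replace (r * circle_pt 1 t - r * circle_pt 1 t')%C with (r * (circle_pt 1 t - circle_pt 1 t'))%C by ring.
      rewrite Cmod_mult, Cmod_R, Rabs_right by lra. lra. }
    assert (A1 := Hln _ _ (Hx0 t) (Hx0 t')). assert (A2 := Hln _ _ (Hx0 t') (Hx0 t)).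
    rewrite Rabs_minus_sym in A2. unfold w. apply Rabs_le. lra. }
  (* Chosen so that (x + e1) exp eta <= x + 2 e1 = x + e for 0 <= x <= M. *)
  set (eta := ln (1 + e1 / (M + e1))).
  assert (Hq : 0 < e1 / (M + e1)) by (apply Rdiv_lt_0_compat; lra).
  assert (Heta : 0 < eta) by (unfold eta; rewrite <- ln_1; apply ln_increasing; lra).
  assert (Hexp : exp eta = 1 + e1 / (M + e1)) by (apply exp_ln; lra).
  destruct (outer w L eta HL Heta Hw) as (rhoW & W & HrW & HW & HWe).
  assert (Hri : 0 < / r) by (apply Rinv_0_lt_compat; lra).
  set (V := fun z => W (RtoC (/ r) * z)%C).
  assert (HV : ana (rhoW * r) V).
  { apply (ana_comp_scal rhoW); trivial. rewrite Cmod_R, Rabs_right by lra. right; field; lra.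
    rewrite Cmod_R, Rabs_right; lra. }
  exists (Rmin (rhoW * r) rho), (fun z => cexp (V z * (/ 2)%R)), (fun z => (f z * cexp (V z * (- / 2)%R))%C).
  assert (HV' : ana (Rmin (rhoW * r) rho) V) by (apply ana_le with (rhoW * r); trivial; apply Rmin_l).
  split; [|split; [|split; [|split]]].
  - split. apply Rmin_glb_lt; nra. apply Rmin_r.
  - apply ana_cexp, ana_mult; trivial. apply ana_const.
  - apply ana_mult. apply ana_le with rho; trivial. apply Rmin_r.
    apply ana_cexp, ana_mult; trivial. apply ana_const.
  - intros z. transitivity (f z * (cexp (V z * (/ 2)%R) * cexp (V z * (- / 2)%R)))%C. 2: ring.
    rewrite <- cexp_plus. replace (V z * (/ 2)%R + V z * (- / 2)%R)%C with (RtoC 0).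
    rewrite cexp_0. ring. rewrite RtoC_opp. ring.
  - intros t. set (x := Cmod (f (circle_pt r t))). specialize (Hx0 t). fold x in Hx0.
    assert (HxM : x <= M) by (apply (HMe (circle_pt r t) (circle_pt r t)); trivial).
    assert (EV : V (circle_pt r t) = W (circle_pt 1 t)).
    { unfold V. rewrite <- circle_pt_scal. f_equal. f_equal. field; lra. }
    assert (B := HWe t). apply Rabs_le_between in B. unfold w in B. fold x in B.
    assert (Hb : (x + e1) * exp eta <= x + e).
    { rewrite Hexp. apply Rle_trans with (x + e1 + e1).
      2: unfold e1; lra.
      assert ((x + e1) * (e1 / (M + e1)) <= e1).
      { apply Rle_trans with ((M + e1) * (e1 / (M + e1))). apply Rmult_le_compat_r; lra. right; field; lra. }
      lra. }
    set (v := fst (W (circle_pt 1 t))) in *.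
    assert (Hsq : forall y, exp (y / 2) ^ 2 = exp y).
    { intros y. simpl. rewrite Rmult_1_r, <- exp_plus. f_equal. field. }
    rewrite Cmod_mult, !Cmod_cexp, EV. fold x.
    replace (fst (W (circle_pt 1 t) * (/ 2)%R)%C) with (v / 2) by (simpl; fold v; unfold Rdiv; ring).
    replace (fst (W (circle_pt 1 t) * (- / 2)%R)%C) with ((- v) / 2) by (simpl; fold v; unfold Rdiv; ring).
    rewrite Rpow_mult_distr, !Hsq.
    assert (Hlo : exp v <= (x + e1) * exp eta).
    { rewrite <- (exp_ln (x + e1)) by lra. rewrite <- exp_plus. apply exp_mono. lra. }
    assert (Hhi : exp (- v) <= / (x + e1) * exp eta).
    { rewrite <- (exp_ln (x + e1)) by lra. rewrite <- exp_Ropp, <- exp_plus. apply exp_mono. lra. }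
    split. lra. apply Rle_trans with (x ^ 2 * (/ (x + e1) * exp eta)).
    apply Rmult_le_compat_l; trivial. apply pow_le; lra.
    apply Rle_trans with (2 := Hb). rewrite <- Rmult_assoc. apply Rmult_le_compat_r. apply Rlt_le, exp_pos.
    apply Rmult_le_reg_r with (x + e1). lra. rewrite Rmult_assoc, Rinv_l by lra. nra.
Qed.

(** * Fejer-Riesz inequality *)

Lemma is_Cder_conj (F : C -> C) (z l : C) : is_Cder F (Cconj z) l ->
  is_Cder (fun w => Cconj (F (Cconj w))) z (Cconj l).
Proof.
  rewrite !is_Cder_eps. intros H e He. destruct (H e He) as (d & Hd & H1).
  exists d. split; trivial. intros w Hw.
  assert (E : Cmod (Cconj w - Cconj z) = Cmod (w - z)).
  { rewrite <- Cminus_conj. apply Cmod_conj. }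
  specialize (H1 (Cconj w)). rewrite E in H1. specialize (H1 Hw).
  rewrite <- Cmod_conj. eapply Rle_trans; [|exact H1]. right. f_equal.
  rewrite !Cminus_conj, Cmult_conj, Cminus_conj, !Cconj_conj. reflexivity.
Qed.

Lemma ana_conj (rho : R) (F : C -> C) : ana rho F -> ana rho (fun z => Cconj (F (Cconj z))).
Proof.
  intros HF z Hz. destruct (ana_der rho F (Cconj z) HF) as [l Hl]. now rewrite Cmod_conj.
  exists (Cconj l). now apply is_Cder_conj.
Qed.

Lemma ccont_real (rho : R) (F : C -> C) (t : R) : ana rho F -> Rabs t < rho ->
  ccont (fun t => F (RtoC t)) t.
Proof.
  intros HF Ht. apply ccont_comp. apply ccont_RtoC, continuous_id.
  apply ana_ccont with rho; trivial. now rewrite Cmod_R.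
Qed.

Lemma is_Rder_real (F : C -> C) (t : R) (l : C) : is_Cder F (RtoC t) l ->
  is_Rder (fun t => F (RtoC t)) t l.
Proof.
  intros H. replace l with (1 * l)%C by ring.
  apply (is_Rder_comp F (fun t => RtoC t)); trivial; simpl.
  apply (is_derive_id (K := R_AbsRing)). apply (is_derive_const (K := R_AbsRing) (V := R_NormedModule)).
Qed.

Lemma ana_primitive (rho : R) (F : C -> C) (z : C) : ana rho F -> 0 < rho -> Cmod z < rho ->
  is_Cder (seg_int F 0) z (F z).
Proof.
  intros HF Hr Hz. apply (primitive_punctured rho); trivial.
  - intros w Hw. now apply ana_ccont with rho.
  - intros w Hw _. now apply ana_der with rho.
  - rewrite Cmod_0. lra.
Qed.

(* [F conj(F(conj z))] is analytic and equals [|F|^2] on the real axis: move the integral from the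
   diameter to the upper half circle. *)
Lemma fejer_riesz_2 (rho r : R) (F : C -> C) : ana rho F -> 0 < r < rho ->
  RInt (fun t => Cmod (F (RtoC t)) ^ 2) 0 r <= PI * r * rmean (fun t => Cmod (F (circle_pt r t)) ^ 2).
Proof.
  intros HF Hr. set (FF := fun z => (F z * Cconj (F (Cconj z)))%C).
  assert (HFF : ana rho FF) by (apply ana_mult; trivial; now apply ana_conj).
  set (A := seg_int FF 0).
  assert (HA : forall z, Cmod z < rho -> is_Cder A z (FF z)) by (intros; apply (ana_primitive rho); trivial; lra).
  assert (HPI := PI_RGT_0).
  assert (Habs : forall t, - r <= t <= r -> Rabs t < rho) by (intros t Ht; apply Rabs_lt_between; lra).
  assert (Hsq : forall x, continuous (fun y => y ^ 2) x).
  { intros x. apply (ex_derive_continuous (V := R_NormedModule)). auto_derive; auto. }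
  assert (Hline : forall t, - r <= t <= r -> continuous (fun t => Cmod (F (RtoC t)) ^ 2) t).
  { intros t Ht. apply (continuous_comp _ (fun y => y ^ 2)); trivial. apply ccont_Cmod.
    apply (ccont_real rho); auto. }
  assert (E1 : CInt (fun t => FF (RtoC t)) (- r) r = (A (RtoC r) - A (RtoC (- r)))%C).
  { apply (CInt_FTC (fun t => A (RtoC t))). lra.
    - intros t Ht. apply is_Rder_real, HA. rewrite Cmod_R; auto.
    - intros t Ht. apply (ccont_real rho); auto. }
  assert (E2 : CInt (fun t => RtoC (Cmod (F (RtoC t)) ^ 2)) (- r) r = CInt (fun t => FF (RtoC t)) (- r) r).
  { apply CInt_ext. lra. intros t Ht. unfold FF. rewrite Cmod2_conj.
    f_equal. f_equal. f_equal. apply injective_projections; simpl; ring. }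
  rewrite CInt_RtoC in E2 by (apply ex_RInt_cont; trivial; lra).
  set (c := fun t => circle_pt r t).
  assert (Hfc : pcont (fun t => F (c t))) by (apply (pcont_ana rho); trivial; lra).
  assert (Hg : pcont (fun t => (Ci * c t * FF (c t))%C)).
  { apply pcont_mult. apply pcont_mult. apply pcont_const. apply pcont_circle.
    apply (pcont_ana rho); trivial; lra. }
  assert (E3 : CInt (fun t => (Ci * c t * FF (c t))%C) 0 PI = (A (RtoC (- r)) - A (RtoC r))%C).
  { rewrite (CInt_FTC (fun t => A (c t))).
    - unfold c, circle_pt. rewrite cos_PI, sin_PI, cos_0, sin_0.
      f_equal; [|f_equal]; f_equal; apply injective_projections; simpl; ring.
    - lra.
    - intros t Ht. apply is_Rder_circle, HA. unfold c; rewrite Cmod_circle_pt; lra.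
    - intros t Ht. apply Hg. }
  set (v := fun t => Cmod (F (c t)) ^ 2).
  assert (Hv : forall t, continuous v t).
  { intros t. apply (continuous_comp _ (fun y => y ^ 2)); trivial. now apply pcont_Cmod. }
  assert (Hvn : forall t, continuous (fun t => v (- t)) t).
  { intros t. apply (continuous_comp (fun t => - t) v); trivial.
    apply (ex_derive_continuous (V := R_NormedModule)). auto_derive; auto. }
  assert (Hconj : forall t, Cconj (c t) = c (- t)).
  { intros t. unfold c, circle_pt. rewrite cos_neg, sin_neg. apply injective_projections; simpl; ring. }
  (* On the half circle |F(c) F(conj c)| is at most half the sum of the squares at t and - t, and
     the two halves together make up the full circle. *)
  assert (B1 : Cmod (CInt (fun t => (Ci * c t * FF (c t))%C) 0 PI) <= RInt (fun t => r / 2 * (v t + v (- t))) 0 PI).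
  { apply CInt_norm. lra. apply pcont_ex; trivial; lra.
    apply rcont_ex. lra. intros t. apply continuous_scalR, continuous_plusR; trivial.
    intros t _. unfold FF. rewrite !Cmod_mult, Cmod_Ci, Cmod_conj, Hconj. unfold v.
    replace (Cmod (c t)) with r by (unfold c; rewrite Cmod_circle_pt; lra).
    set (x := Cmod (F (c t))). set (y := Cmod (F (c (- t)))).
    assert (0 <= (x - y) ^ 2) by apply pow2_ge_0. nra. }
  assert (Hex : forall (u : R -> R) a b, (forall t, continuous u t) -> ex_RInt u a b).
  { intros u a b Hu. apply (ex_RInt_continuous (V := R_CompleteNormedModule)). auto. }
  assert (B2 : RInt (fun t => r / 2 * (v t + v (- t))) 0 PI = r / 2 * RInt v 0 (2 * PI)).
  { rewrite (RInt_scal (V := R_CompleteNormedModule)) by (apply Hex; intros; now apply continuous_plusR).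
    rewrite (RInt_plus (V := R_CompleteNormedModule)) by (now apply Hex).
    assert (S1 : RInt (fun t => v (- t)) 0 PI = RInt v (- PI) 0).
    { assert (S := RInt_comp_lin (V := R_CompleteNormedModule) v (-1) 0 0 PI (Hex _ _ _ Hv)).
      replace (-1 * 0 + 0) with 0 in S by ring. replace (-1 * PI + 0) with (- PI) in S by ring.
      rewrite <- (opp_RInt_swap (V := R_CompleteNormedModule) v) in S by (now apply Hex).
      assert (S2 : RInt (fun t => scal (-1) (v (-1 * t + 0))) 0 PI = - RInt (fun t => v (- t)) 0 PI).
      { rewrite <- (RInt_opp (V := R_CompleteNormedModule)) by (now apply Hex).
        apply RInt_ext. intros t _. unfold scal, opp; simpl; unfold mult; simpl.
        replace (-1 * t + 0) with (- t) by ring. req. ring. }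
      assert (S' : - RInt (fun t => v (- t)) 0 PI = - RInt v (- PI) 0) by exact (eq_trans (eq_sym S2) S).
      lra. }
    assert (S3 : RInt v (- PI) 0 = RInt v PI (2 * PI)).
    { rewrite <- (RInt_ext (fun t => v (t + 2 * PI))).
      rewrite RInt_shift by trivial. f_equal; ring.
      intros t _. unfold v, c. now rewrite circle_pt_period. }
    assert (S4 := RInt_Chasles (V := R_CompleteNormedModule) v 0 PI (2 * PI) (Hex _ _ _ Hv) (Hex _ _ _ Hv)).
    rewrite <- S4, S1, S3. reflexivity. }
  assert (B3 : RInt (fun t => Cmod (F (RtoC t)) ^ 2) (- r) r <= r / 2 * RInt v 0 (2 * PI)).
  { rewrite <- B2. eapply Rle_trans; [|exact B1]. rewrite E3.
    rewrite Cmod_minus_sym, <- E1, <- E2, Cmod_R. apply Rle_abs. }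
  (* The bound so far is for the whole diameter; the part over [- r, 0] is nonnegative. *)
  assert (B4 : RInt (fun t => Cmod (F (RtoC t)) ^ 2) 0 r <= RInt (fun t => Cmod (F (RtoC t)) ^ 2) (- r) r).
  { set (u := fun t => Cmod (F (RtoC t)) ^ 2) in *.
    assert (S : RInt u (- r) 0 + RInt u 0 r = RInt u (- r) r).
    { apply (RInt_Chasles (V := R_CompleteNormedModule)); apply ex_RInt_cont; try lra;
        intros t Ht; apply Hline; lra. }
    assert (0 <= RInt u (- r) 0).
    { apply RInt_ge_0. lra. apply ex_RInt_cont; [lra | intros t Ht; apply Hline; lra].
      intros t _. apply pow2_ge_0. }
    lra. }
  eapply Rle_trans. exact B4. eapply Rle_trans. exact B3. right.
  unfold rmean. fold c. fold v. field. lra.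
Qed.

Lemma fejer_riesz_1 (rho r : R) (f : C -> C) : ana rho f -> 0 < r < rho ->
  RInt (fun t => Cmod (f (RtoC t))) 0 r <= PI * r * rmean (fun t => Cmod (f (circle_pt r t))).
Proof.
  intros Hf Hr. assert (HPI := PI_RGT_0). assert (HPr : 0 < PI * r) by (apply Rmult_lt_0_compat; lra).
  apply Rle_eps. intros e He.
  (* Fejer-Riesz multiplies the tolerance by PI r, which turns it into e. *)
  destruct (factorization rho r (e / (PI * r)) f Hf Hr) as (rho1 & G & K & Hr1 & HG & HK & HGK & Hb).
  now apply Rdiv_lt_0_compat.
  assert (FG := fejer_riesz_2 rho1 r G HG ltac:(lra)). assert (FK := fejer_riesz_2 rho1 r K HK ltac:(lra)).
  assert (Hsq : forall x, continuous (fun y => y ^ 2) x).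
  { intros x. apply (ex_derive_continuous (V := R_NormedModule)). auto_derive; auto. }
  assert (Habs : forall t, 0 <= t <= r -> Rabs t < rho1) by (intros t Ht; apply Rabs_lt_between; lra).
  assert (Habs' : forall t, 0 <= t <= r -> Rabs t < rho) by (intros t Ht; apply Rabs_lt_between; lra).
  assert (Hline : forall H, ana rho1 H -> ex_RInt (fun t => Cmod (H (RtoC t)) ^ 2) 0 r).
  { intros H HH. apply ex_RInt_cont. lra. intros t Ht.
    apply (continuous_comp _ (fun y => y ^ 2)); trivial. apply ccont_Cmod. apply (ccont_real rho1); auto. }
  assert (Hfc : forall t, continuous (fun t => Cmod (f (circle_pt r t))) t).
  { apply pcont_Cmod, (pcont_ana rho); trivial; lra. }
  assert (Hmean : forall H, ana rho1 H -> (forall t, Cmod (H (circle_pt r t)) ^ 2 <= Cmod (f (circle_pt r t)) + e / (PI * r)) ->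
    rmean (fun t => Cmod (H (circle_pt r t)) ^ 2) <= rmean (fun t => Cmod (f (circle_pt r t))) + e / (PI * r)).
  { intros H HH HB. rewrite <- (rmean_const (e / (PI * r))) at 1.
    rewrite <- rmean_plus; trivial. 2: intros t; apply continuous_const.
    apply rmean_le; trivial.
    - intros t. apply (continuous_comp _ (fun y => y ^ 2)); trivial. apply pcont_Cmod.
      apply (pcont_ana rho1); trivial; lra.
    - intros t. apply continuous_plusR; trivial. apply continuous_const. }
  assert (MG := Hmean G HG (fun t => proj1 (Hb t))). assert (MK := Hmean K HK (fun t => proj2 (Hb t))).
  apply Rle_trans with (RInt (fun t => / 2 * (Cmod (G (RtoC t)) ^ 2 + Cmod (K (RtoC t)) ^ 2)) 0 r).
  - apply RInt_le. lra.
    + apply ex_RInt_cont. lra. intros t Ht. apply ccont_Cmod, (ccont_real rho); auto.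
    + apply (ex_RInt_scal (V := R_NormedModule)), (ex_RInt_plus (V := R_NormedModule)); auto.
    + intros t Ht. rewrite HGK, Cmod_mult. set (x := Cmod (G t)). set (y := Cmod (K t)).
      assert (0 <= (x - y) ^ 2) by apply pow2_ge_0. nra.
  - rewrite (RInt_scal (V := R_CompleteNormedModule)), (RInt_plus (V := R_CompleteNormedModule)); auto.
    2: apply (ex_RInt_plus (V := R_NormedModule)); auto.
    unfold scal, plus; simpl; unfold mult; simpl. simpl in *.
    set (M := rmean (fun t => Cmod (f (circle_pt r t)))) in *.
    apply (Rmult_le_compat_l (PI * r)) in MG, MK; try lra.
    replace (PI * r * (M + e / (PI * r))) with (PI * r * M + e) in MG, MK by (field; lra). lra.
Qed.

(** * Improper integrals against functions of the Hardy space *)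

Lemma Hardy_norm_le (p : Rbar) (f : C -> C) (B : R) :
  Rbar_le (Hardy_norm p f) (Finite B) <-> (forall r, 0 < r < 1 -> mean_le p r f B).
Proof.
  unfold Hardy_norm.
  set (E := fun m => exists r : R, 0 < r < 1 /\ m = integral_mean p r f).
  unfold Rbar_lub. destruct (Rbar_ex_lub E) as [l [H1 H2]]. simpl proj1_sig. split.
  - intros H r Hr. unfold mean_le. apply Rbar_le_trans with (2 := H). apply H1. now exists r.
  - intros H. apply H2. intros m (r & Hr & ->). now apply H.
Qed.

Lemma Hardy_norm_ge0 (p : Rbar) (f : C -> C) : Rbar_le 1 p -> Rbar_le 0 (Hardy_norm p f).
Proof.
  intros Hp. destruct (Hardy_norm p f) as [x| |] eqn:E; simpl; trivial.
  - apply (mean_le_ge0 p (/ 2) f); trivial; try lra.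
    apply (proj1 (Hardy_norm_le p f x)). rewrite E. apply Rbar_le_refl. lra.
  (* The value [m_infty] would make -1 a bound for a mean. *)
  - assert (K : forall B, mean_le p (/ 2) f B).
    { intros B. apply (proj1 (Hardy_norm_le p f B)). rewrite E. exact I. lra. }
    assert (A := mean_le_ge0 p (/ 2) f (-1) ltac:(lra) Hp (K _)). lra.
Qed.

Lemma Hardy_finite (p : Rbar) (f : C -> C) : Rbar_le 1 p -> Hardy p f ->
  exists N, 0 <= N /\ Hardy_norm p f = Finite N /\ forall r, 0 < r < 1 -> mean_le p r f N.
Proof.
  intros Hp [Hf Hlt]. assert (H0 := Hardy_norm_ge0 p f Hp).
  destruct (Hardy_norm p f) as [x| |] eqn:E; simpl in *; try contradiction.
  exists x. split; trivial. split; trivial. apply Hardy_norm_le. rewrite E. apply Rbar_le_refl.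
Qed.

Lemma Hardy_intro (p : Rbar) (f : C -> C) (B : R) : ana 1 f ->
  (forall r, 0 < r < 1 -> mean_le p r f B) -> Hardy p f.
Proof.
  intros Hf H. split. exact Hf. apply Hardy_norm_le in H.
  eapply Rbar_le_lt_trans. exact H. exact I.
Qed.

Lemma mean_le_1 (r : R) (f : C -> C) (B : R) : 0 <= B -> circ_cont r f ->
  mean_le (Finite 1) r f B <-> rmean (fun t => Cmod (f (circle_pt r t))) <= B.
Proof.
  intros HB Hf. rewrite mean_le_fin, rpow_1 by lra. unfold pmean.
  replace (rmean (fun t => rpow (Cmod (f (circle_pt r t))) 1)) with
    (rmean (fun t => Cmod (f (circle_pt r t)))). tauto.
  unfold rmean. f_equal. apply RInt_ext. intros t _. rewrite rpow_1; trivial. apply Cmod_ge_0.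
Qed.

(* Jensen for [x |-> x^p], through its tangent at 1. *)
Lemma mean_le_rmean (p : Rbar) (r : R) (f : C -> C) (B : R) : 0 <= r -> Rbar_le 1 p ->
  circ_cont r f -> mean_le p r f B -> rmean (fun t => Cmod (f (circle_pt r t))) <= B.
Proof.
  intros Hr Hp Hf HB. assert (B0 := mean_le_ge0 p r f B Hr Hp HB).
  destruct p as [q| |]; simpl in Hp.
  - apply Rle_eps. intros e He. set (B' := B + e). assert (HB' : 0 < B') by (unfold B'; lra).
    apply (mean_le_mono _ _ _ _ B') in HB; [|unfold B'; lra].
    apply mean_le_fin in HB; try lra.
    assert (Hi : 0 < / B') by now apply Rinv_0_lt_compat.
    assert (HF : forall t, continuous (fun t => Cmod (f (circle_pt r t))) t) by now apply pcont_Cmod.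
    assert (HG := fun t => pmean_cont q r f t ltac:(lra) Hf).
    assert (E : rmean (fun t => (1 - q) + q * / B' * Cmod (f (circle_pt r t))) <=
      rmean (fun t => rpow (/ B') q * rpow (Cmod (f (circle_pt r t))) q)).
    { apply rmean_le.
      intros t. apply continuous_plusR. apply continuous_const. now apply continuous_scalR.
      intros t. now apply continuous_scalR.
      intros t. rewrite <- rpow_mult by (lra || apply Cmod_ge_0).
      assert (A := rpow_bernoulli (/ B' * Cmod (f (circle_pt r t))) q Hp).
      assert (C0 := Cmod_ge_0 (f (circle_pt r t))). specialize (A ltac:(nra)). lra. }
    rewrite rmean_plus, rmean_const, !rmean_scal in E; trivial.
    2: intros t; apply continuous_const. 2: intros t; now apply continuous_scalR.
    fold (pmean q r f) in E.
    assert (P1 : rpow (/ B') q * pmean q r f <= 1).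
    { apply Rle_trans with (rpow (/ B') q * rpow B' q). apply Rmult_le_compat_l; trivial. apply rpow_ge0.
      rewrite <- rpow_mult, Rinv_l, rpow_one by lra. lra. }
    set (M := rmean (fun t => Cmod (f (circle_pt r t)))) in *.
    assert (P2 : q * (/ B' * M) <= q * 1) by lra.
    apply Rmult_le_reg_l in P2; [|lra].
    apply (Rmult_le_compat_l B') in P2; [|lra]. rewrite <- Rmult_assoc, Rinv_r in P2; lra.
  - rewrite mean_le_inf in HB. rewrite <- (rmean_const B). apply rmean_le.
    now apply pcont_Cmod. intros t; apply continuous_const.
    intros t. apply HB. now apply Cmod_circle_pt.
  - contradiction.
Qed.

(** N is any bound of the means, not necessarily the norm, so that estimates carry real numbers and
    pass to differences with the bound N + M. *)
Definition in_H1 (f : C -> C) (N : R) : Prop :=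
  ana 1 f /\ 0 <= N /\ forall r, 0 < r < 1 -> rmean (fun t => Cmod (f (circle_pt r t))) <= N.

Lemma H1_Hardy (f : C -> C) : Hardy (Finite 1) f ->
  exists N, in_H1 f N /\ Hardy_norm (Finite 1) f = Finite N.
Proof.
  intros Hf. destruct (Hardy_finite (Finite 1) f (Rbar_le_refl 1) Hf) as (N & HN & E & H).
  destruct Hf as [Hf _]. exists N. split; trivial. split; trivial. split; trivial.
  intros r Hr. apply (mean_le_rmean (Finite 1)); try lra. apply Rbar_le_refl.
  apply (pcont_ana 1); trivial; lra. now apply H.
Qed.

Lemma Hardy_H1 (f : C -> C) (N : R) : in_H1 f N ->
  Hardy (Finite 1) f /\ Rbar_le (Hardy_norm (Finite 1) f) (Finite N).
Proof.
  intros (Hf & HN & H).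
  assert (K : forall r, 0 < r < 1 -> mean_le (Finite 1) r f N).
  { intros r Hr. apply mean_le_1; trivial. apply (pcont_ana 1); trivial; lra. now apply H. }
  split. now apply Hardy_intro with N. now apply Hardy_norm_le.
Qed.

Lemma H1_minus (f g : C -> C) (N M : R) : in_H1 f N -> in_H1 g M -> in_H1 (fun z => (f z - g z)%C) (N + M).
Proof.
  intros (Hf & HN & Hf1) (Hg & HM & Hg1). split; [|split]. now apply ana_minus. lra.
  intros r Hr.
  assert (Fc : pcont (fun t => f (circle_pt r t))) by (apply (pcont_ana 1); trivial; lra).
  assert (Gc : pcont (fun t => g (circle_pt r t))) by (apply (pcont_ana 1); trivial; lra).
  apply Rle_trans with (rmean (fun t => Cmod (f (circle_pt r t)) + Cmod (g (circle_pt r t)))).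
  - apply rmean_le. apply pcont_Cmod. now apply pcont_minus.
    intros t; apply continuous_plusR; now apply pcont_Cmod.
    intros t. unfold Cminus. eapply Rle_trans. apply Cmod_triangle. rewrite Cmod_opp. lra.
  - rewrite rmean_plus by (now apply pcont_Cmod). apply Rplus_le_compat; auto.
Qed.

Definition unit_cont (u : R -> C) : Prop := forall t, 0 <= t < 1 -> ccont u t.

Lemma unit_cont_ana (f : C -> C) : ana 1 f -> unit_cont (fun t => f (RtoC t)).
Proof. intros Hf t Ht. apply (ccont_real 1); trivial. rewrite Rabs_right; lra. Qed.

Lemma unit_cont_mult (u v : R -> C) : unit_cont u -> unit_cont v -> unit_cont (fun t => (u t * v t)%C).
Proof. intros Hu Hv t Ht. apply ccont_mult; auto. Qed.

Lemma unit_cont_ex (u : R -> C) (a b : R) : unit_cont u -> 0 <= a -> a <= b -> b < 1 -> ex_CInt u a b.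
Proof. intros Hu Ha Hab Hb. apply ex_CInt_cont; trivial. intros t Ht. apply Hu. lra. Qed.

Lemma unit_cont_ex_mod (u : R -> C) (a b : R) : unit_cont u -> 0 <= a -> a <= b -> b < 1 ->
  ex_RInt (fun t => Cmod (u t)) a b.
Proof. intros Hu Ha Hab Hb. apply ex_RInt_cont; trivial. intros t Ht. apply ccont_Cmod, Hu. lra. Qed.

Lemma H1_int (f : C -> C) (N s : R) : in_H1 f N -> 0 <= s < 1 ->
  RInt (fun t => Cmod (f (RtoC t))) 0 s <= PI * N.
Proof.
  intros (Hf & HN & H) Hs. assert (HPI := PI_RGT_0).
  destruct (Req_dec s 0) as [->|Hn].
  - rewrite (RInt_point (V := R_CompleteNormedModule)). apply Rmult_le_pos; lra.
  - eapply Rle_trans. apply (fejer_riesz_1 1); trivial; lra.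
    specialize (H s ltac:(lra)). set (M := rmean _) in *.
    assert (0 <= M) by (apply rmean_Cmod_ge0, (pcont_ana 1); trivial; lra).
    rewrite Rmult_assoc. apply Rmult_le_compat_l. lra. nra.
Qed.

(** The integrals of |f| over [0, s] increase with s and are bounded by Fejer-Riesz, so some s0
    brings them within e of their supremum. *)
Lemma H1_tail (f : C -> C) (N e : R) : in_H1 f N -> 0 < e ->
  exists s0, 0 <= s0 < 1 /\ forall s s', s0 <= s -> s <= s' -> s' < 1 ->
    RInt (fun t => Cmod (f (RtoC t))) s s' <= e.
Proof.
  intros Hf He. assert (Hfa : ana 1 f) by apply Hf.
  set (A := fun s => RInt (fun t => Cmod (f (RtoC t))) 0 s).
  set (E := fun x => exists s, 0 <= s < 1 /\ x = A s).
  destruct (completeness E) as [l [Hl1 Hl2]].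
  { exists (PI * N). intros x (s & Hs & ->). now apply H1_int. }
  { exists (A 0). exists 0. split; trivial. lra. }
  assert (K : exists s, 0 <= s < 1 /\ l - e < A s).
  { apply NNPP. intros Hn. assert (B : l <= l - e). { apply Hl2. intros x (s & Hs & ->).
    apply Rnot_lt_le. intros Hlt. apply Hn. now exists s. } lra. }
  destruct K as (s0 & Hs0 & HA). exists s0. split; trivial. intros s s' H H' Hs'.
  assert (Hu := unit_cont_ana f Hfa).
  assert (Ch : forall a b, 0 <= a -> a <= b -> b < 1 -> A a + RInt (fun t => Cmod (f (RtoC t))) a b = A b).
  { intros a b Ha Hab Hb. apply (RInt_Chasles (V := R_CompleteNormedModule));
      apply (unit_cont_ex_mod (fun t => f (RtoC t))); trivial; lra. }
  assert (C1 := Ch s s' ltac:(lra) H' Hs'). assert (C2 := Ch s0 s ltac:(lra) H ltac:(lra)).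
  assert (P : 0 <= RInt (fun t => Cmod (f (RtoC t))) s0 s).
  { apply RInt_ge_0; trivial. apply (unit_cont_ex_mod (fun t => f (RtoC t))); trivial; lra.
    intros; apply Cmod_ge_0. }
  assert (U : A s' <= l) by (apply Hl1; exists s'; split; trivial; lra). lra.
Qed.

Definition is_lim1 (h : R -> C) (l : C) : Prop :=
  forall e, 0 < e -> exists s0, 0 <= s0 < 1 /\ forall s, s0 <= s < 1 -> Cmod (h s - l) <= e.

Lemma RInt_gen_lim1 (v : R -> C) (l : C) : unit_cont v -> is_lim1 (fun s => CInt v 0 s) l ->
  @RInt_gen C_R_CompleteNormedModule v (at_point 0) (at_left 1) = l.
Proof.
  intros Hv Hl. apply (is_RInt_gen_unique (V := C_R_CompleteNormedModule)).
  intros P HP. destruct HP as [eps HP].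
  destruct (Hl (eps / 2)) as (s0 & Hs0 & H). assert (A := cond_pos eps). lra.
  unfold filtermapi. apply Filter_prod with (Q := fun a => a = 0) (R := fun s => s0 <= s < 1).
  - reflexivity.
  - unfold at_left, within. assert (Hd : 0 < 1 - s0) by lra.
    exists (mkposreal _ Hd). intros y Hy Hy1. unfold ball in Hy; simpl in Hy.
    unfold AbsRing_ball, abs, minus, plus, opp in Hy; simpl in Hy.
    apply Rabs_lt_between in Hy. lra.
  - intros a s -> Hs. exists (CInt v 0 s). split.
    + simpl. apply CInt_is, unit_cont_ex; trivial; lra.
    + apply HP. apply (C_ball_Cmod l). eapply Rle_lt_trans. apply H; trivial.
      assert (A := cond_pos eps). lra.
Qed.

Lemma is_lim1_unique (h : R -> C) (l m : C) : is_lim1 h l -> is_lim1 h m -> l = m.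
Proof.
  intros Hl Hm. assert (E : (l - m)%C = RtoC 0).
  { apply Cmod_eq_0. apply Rle_antisym; [|apply Cmod_ge_0]. apply Rle_eps. intros e He.
    destruct (Hl (e / 2)) as (s1 & Hs1 & H1'). lra. destruct (Hm (e / 2)) as (s2 & Hs2 & H2). lra.
    assert (Hx : Rmax s1 s2 < 1) by (apply Rmax_lub_lt; lra).
    specialize (H1' (Rmax s1 s2) (conj (Rmax_l _ _) Hx)). specialize (H2 (Rmax s1 s2) (conj (Rmax_r _ _) Hx)).
    set (x := h (Rmax s1 s2)) in *. replace (l - m)%C with ((x - m) - (x - l))%C by ring.
    unfold Cminus at 1. eapply Rle_trans. apply Cmod_triangle. rewrite Cmod_opp. lra. }
  replace l with ((l - m) + m)%C by ring. rewrite E. ring.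
Qed.

(** The weight u is kept apart from f: it is t |-> k(t z) for the operator and t |-> t^j for the
    moments of f. *)
Definition unit_int (f : C -> C) (u : R -> C) : C :=
  @RInt_gen C_R_CompleteNormedModule (fun t => (f (RtoC t) * u t)%C) (at_point 0) (at_left 1).

Lemma H1_int_bound (f : C -> C) (u : R -> C) (B a b : R) : ana 1 f -> unit_cont u ->
  (forall t, 0 <= t < 1 -> Cmod (u t) <= B) -> 0 <= a -> a <= b -> b < 1 ->
  Cmod (CInt (fun t => (f (RtoC t) * u t)%C) a b) <= B * RInt (fun t => Cmod (f (RtoC t))) a b.
Proof.
  intros Hf Hu HB Ha Hab Hb. assert (Hfu := unit_cont_ana f Hf).
  assert (Hex := unit_cont_ex_mod _ a b Hfu Ha Hab Hb).
  rewrite <- (RInt_scal (V := R_CompleteNormedModule)) by exact Hex.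
  apply CInt_norm; trivial. apply unit_cont_ex; trivial. now apply unit_cont_mult.
  now apply (ex_RInt_scal (V := R_NormedModule)).
  intros t Ht. rewrite Cmod_mult, Rmult_comm. unfold scal; simpl; unfold mult; simpl.
  apply Rmult_le_compat_r. apply Cmod_ge_0. apply HB. lra.
Qed.

Lemma Cplus_minus_l (x y : C) : (x + y - x)%C = y.
Proof. ring. Qed.

(** The point s0 depends on f and e alone; the weight enters only through its bound B. Applied to
    u(t) = k(t z), this is convergence uniform in z. *)
Lemma unit_int_tail (f : C -> C) (N e : R) : in_H1 f N -> 0 < e ->
  exists s0, 0 <= s0 < 1 /\ forall u B s, unit_cont u -> (forall t, 0 <= t < 1 -> Cmod (u t) <= B) ->
    s0 <= s < 1 -> Cmod (CInt (fun t => (f (RtoC t) * u t)%C) 0 s - unit_int f u) <= B * e.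
Proof.
  intros Hf He. destruct (H1_tail f N e Hf He) as (s0 & Hs0 & Htail).
  exists s0. split; trivial. intros u B s Hu HB Hs. assert (Hfa : ana 1 f) by apply Hf.
  assert (HB0 : 0 <= B) by (eapply Rle_trans; [apply Cmod_ge_0 | apply (HB 0); lra]).
  set (h := fun s => CInt (fun t => (f (RtoC t) * u t)%C) 0 s).
  assert (Hfu : unit_cont (fun t => (f (RtoC t) * u t)%C)).
  { apply unit_cont_mult; trivial. now apply unit_cont_ana. }
  assert (Hd : forall a b, 0 <= a -> a <= b -> b < 1 ->
    Cmod (h b - h a) <= B * RInt (fun t => Cmod (f (RtoC t))) a b).
  { intros a b Ha Hab Hb. replace (h b - h a)%C with (CInt (fun t => (f (RtoC t) * u t)%C) a b).
    now apply H1_int_bound.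
    unfold h. rewrite <- (CInt_Chasles _ 0 a b) by (apply unit_cont_ex; trivial; lra). symmetry; apply Cplus_minus_l. }
  (* The limit is first found along the sequence 1 - 1 / (n + 1), then shown to be the limit for s
     tending to 1. *)
  destruct (C_cauchy_lim (fun n => h (1 - / (INR n + 1)))) as [l Hl].
  { intros e' He'. assert (HBp : 0 < B + 1) by lra.
    destruct (H1_tail f N (e' / (2 * (B + 1))) Hf) as (s1 & Hs1 & Ht1). apply Rdiv_lt_0_compat; lra.
    destruct (nfloor_ex (/ (1 - s1))) as [n0 [_ Hn0]].
    { apply Rlt_le, Rinv_0_lt_compat; lra. }
    assert (Hpt : forall n, (n0 <= n)%nat -> s1 <= 1 - / (INR n + 1) < 1).
    { intros n Hn. apply le_INR in Hn. assert (P := pos_INR n0).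
      assert (0 < / (INR n + 1)) by (apply Rinv_0_lt_compat; lra). split; [|lra].
      assert (/ (INR n + 1) <= / / (1 - s1)).
      { apply Rinv_le_contravar. apply Rinv_0_lt_compat; lra. lra. }
      rewrite Rinv_inv in H0. lra. }
    assert (Hcase : forall a b, s1 <= a -> a <= b -> b < 1 -> Cmod (h b - h a) < e').
    { intros a b Ha Hab Hb. eapply Rle_lt_trans. apply Hd; lra.
      specialize (Ht1 a b Ha Hab Hb).
      apply Rle_lt_trans with (B * (e' / (2 * (B + 1)))). now apply Rmult_le_compat_l.
      apply Rle_lt_trans with ((B + 1) * (e' / (2 * (B + 1)))).
      apply Rmult_le_compat_r; [|lra]. apply Rlt_le, Rdiv_lt_0_compat; lra.
      replace ((B + 1) * (e' / (2 * (B + 1)))) with (e' / 2) by (field; lra). lra. }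
    exists n0. intros n m Hn Hm. assert (A1 := Hpt n Hn). assert (A2 := Hpt m Hm).
    destruct (Rle_dec (1 - / (INR n + 1)) (1 - / (INR m + 1))).
    rewrite Cmod_minus_sym. apply Hcase; lra. apply Hcase; lra. }
  assert (Hnear : forall s, 0 <= s < 1 -> forall e', 0 < e' -> exists s', s <= s' < 1 /\ Cmod (h s' - l) < e').
  { intros x Hx e' He'. destruct (Hl e' He') as [n1 Hn1].
    destruct (nfloor_ex (/ (1 - x))) as [n0 [_ Hn0]].
    { apply Rlt_le, Rinv_0_lt_compat; lra. }
    set (n := max n0 n1). exists (1 - / (INR n + 1)). split; [|apply Hn1; unfold n; lia].
    assert (Hn : (n0 <= n)%nat) by (unfold n; lia). apply le_INR in Hn. assert (P := pos_INR n0).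
    assert (0 < / (INR n + 1)) by (apply Rinv_0_lt_compat; lra). split; [|lra].
    assert (Hq : / (INR n + 1) <= / / (1 - x)).
    { apply Rinv_le_contravar. apply Rinv_0_lt_compat; lra. lra. }
    rewrite Rinv_inv in Hq. lra. }
  assert (Hlim : forall e0 s2, 0 < e0 -> 0 <= s2 < 1 ->
     (forall s s', s2 <= s -> s <= s' -> s' < 1 -> RInt (fun t => Cmod (f (RtoC t))) s s' <= e0) ->
     forall x, s2 <= x < 1 -> Cmod (h x - l) <= B * e0).
  { intros e0 s2 He0 Hs2 Ht2 x Hx. apply Rle_eps. intros e' He'.
    destruct (Hnear x ltac:(lra) e' He') as (s' & Hs' & Hl').
    replace (h x - l)%C with ((h s' - l) - (h s' - h x))%C by ring.
    unfold Cminus at 1. eapply Rle_trans. apply Cmod_triangle. rewrite Cmod_opp.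
    assert (A := Hd x s' ltac:(lra) ltac:(lra) ltac:(lra)).
    assert (A2 := Rmult_le_compat_l B _ _ HB0 (Ht2 x s' ltac:(lra) ltac:(lra) ltac:(lra))). lra. }
  assert (EL : unit_int f u = l).
  { refine (RInt_gen_lim1 _ l Hfu _). intros e' He'.
    destruct (H1_tail f N (e' / (B + 1)) Hf) as (s2 & Hs2 & Ht2). apply Rdiv_lt_0_compat; lra.
    exists s2. split; trivial. intros x Hx. eapply Rle_trans.
    apply (Hlim (e' / (B + 1)) s2); trivial. apply Rdiv_lt_0_compat; lra.
    apply Rle_trans with ((B + 1) * (e' / (B + 1))). apply Rmult_le_compat_r; [|lra].
    apply Rlt_le, Rdiv_lt_0_compat; lra. right; field; lra. }
  rewrite EL. apply (Hlim e s0); trivial.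
Qed.

Lemma unit_int_lim (f : C -> C) (N B : R) (u : R -> C) : in_H1 f N -> unit_cont u ->
  (forall t, 0 <= t < 1 -> Cmod (u t) <= B) ->
  is_lim1 (fun s => CInt (fun t => (f (RtoC t) * u t)%C) 0 s) (unit_int f u).
Proof.
  intros Hf Hu HB e He.
  assert (HB0 : 0 <= B) by (eapply Rle_trans; [apply Cmod_ge_0 | apply (HB 0); lra]).
  destruct (unit_int_tail f N (e / (B + 1)) Hf) as (s0 & Hs0 & H). apply Rdiv_lt_0_compat; lra.
  exists s0. split; trivial. intros s Hs. eapply Rle_trans. apply (H u B); trivial.
  apply Rle_trans with ((B + 1) * (e / (B + 1))). apply Rmult_le_compat_r; [|lra].
  apply Rlt_le, Rdiv_lt_0_compat; lra. right; field; lra.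
Qed.

Lemma is_lim1_bound (h : R -> C) (l : C) (B : R) : is_lim1 h l ->
  (forall s, 0 <= s < 1 -> Cmod (h s) <= B) -> Cmod l <= B.
Proof.
  intros Hl HB. apply Rle_eps. intros e He. destruct (Hl e He) as (s0 & Hs0 & H).
  specialize (H s0 ltac:(lra)). specialize (HB s0 Hs0).
  replace l with (h s0 - (h s0 - l))%C by ring. unfold Cminus at 1.
  eapply Rle_trans. apply Cmod_triangle. rewrite Cmod_opp. lra.
Qed.

Lemma is_lim1_minus (h k : R -> C) (l m : C) : is_lim1 h l -> is_lim1 k m ->
  is_lim1 (fun s => (h s - k s)%C) (l - m).
Proof.
  intros Hl Hm e He. destruct (Hl (e / 2)) as (s1 & Hs1 & H1'). lra.
  destruct (Hm (e / 2)) as (s2 & Hs2 & H2). lra.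
  exists (Rmax s1 s2). split. split. eapply Rle_trans; [|apply Rmax_l]; lra. apply Rmax_lub_lt; lra.
  intros s Hs. assert (A1 := Rmax_l s1 s2). assert (A2 := Rmax_r s1 s2).
  specialize (H1' s ltac:(lra)). specialize (H2 s ltac:(lra)).
  replace (h s - k s - (l - m))%C with ((h s - l) - (k s - m))%C by ring. unfold Cminus at 1.
  eapply Rle_trans. apply Cmod_triangle. rewrite Cmod_opp. lra.
Qed.

Lemma is_lim1_scal (h : R -> C) (l c : C) : is_lim1 h l -> is_lim1 (fun s => (c * h s)%C) (c * l).
Proof.
  intros Hl e He. assert (Hc := Cmod_ge_0 c).
  destruct (Hl (e / (Cmod c + 1))) as (s1 & Hs1 & H1'). apply Rdiv_lt_0_compat; lra.
  exists s1. split; trivial. intros s Hs. specialize (H1' s Hs).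
  replace (c * h s - c * l)%C with (c * (h s - l))%C by ring. rewrite Cmod_mult.
  apply Rle_trans with ((Cmod c + 1) * (e / (Cmod c + 1))). 2: right; field; lra.
  apply Rmult_le_compat; trivial. apply Cmod_ge_0. lra.
Qed.

Lemma is_lim1_ext (h k : R -> C) (l : C) : (forall s, 0 <= s < 1 -> h s = k s) -> is_lim1 h l -> is_lim1 k l.
Proof.
  intros E Hl e He. destruct (Hl e He) as (s1 & Hs1 & H1'). exists s1. split; trivial.
  intros s Hs. rewrite <- E by lra. now apply H1'.
Qed.

(** * The generalized Hilbert operator *)

Definition unit_bounded (u : R -> C) (B : R) : Prop :=
  unit_cont u /\ forall t, 0 <= t < 1 -> Cmod (u t) <= B.

Lemma unit_bounded_minus (u v : R -> C) (A B : R) : unit_bounded u A -> unit_bounded v B ->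
  unit_bounded (fun t => (u t - v t)%C) (A + B).
Proof.
  intros [Hu HA] [Hv HB]. split. intros t Ht. apply ccont_minus; auto.
  intros t Ht. unfold Cminus. eapply Rle_trans. apply Cmod_triangle. rewrite Cmod_opp.
  apply Rplus_le_compat; auto.
Qed.

Lemma unit_bounded_scal (c : C) (u : R -> C) (A : R) : unit_bounded u A -> unit_bounded (fun t => (c * u t)%C) (Cmod c * A).
Proof.
  intros [Hu HA]. split. intros t Ht. apply ccont_mult; auto. apply ccont_const.
  intros t Ht. rewrite Cmod_mult. apply Rmult_le_compat_l; auto. apply Cmod_ge_0.
Qed.

Lemma unit_bounded_bound_ge0 (u : R -> C) (B : R) : unit_bounded u B -> 0 <= B.
Proof. intros [_ H]. eapply Rle_trans; [apply Cmod_ge_0 | apply (H 0); lra]. Qed.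

Lemma unit_int_bound (f : C -> C) (N B : R) (u : R -> C) : in_H1 f N -> unit_bounded u B ->
  Cmod (unit_int f u) <= PI * N * B.
Proof.
  intros Hf Hu. assert (HB := unit_bounded_bound_ge0 u B Hu). destruct Hu as [Hu HuB].
  apply (is_lim1_bound _ _ _ (unit_int_lim f N B u Hf Hu HuB)).
  intros s Hs. eapply Rle_trans. apply (H1_int_bound f u B); trivial; try lra. apply Hf.
  rewrite Rmult_comm. apply Rmult_le_compat_r; trivial. now apply H1_int.
Qed.

Lemma unit_int_minus (f : C -> C) (N A B : R) (u v : R -> C) : in_H1 f N -> unit_bounded u A -> unit_bounded v B ->
  unit_int f (fun t => (u t - v t)%C) = (unit_int f u - unit_int f v)%C.
Proof.
  intros Hf Hu Hv. destruct (unit_bounded_minus u v A B Hu Hv) as [Huv HuvB].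
  destruct Hu as [Hu HA], Hv as [Hv HB].
  apply (is_lim1_unique _ _ _ (unit_int_lim f N _ _ Hf Huv HuvB)).
  assert (L := is_lim1_minus _ _ _ _ (unit_int_lim f N A u Hf Hu HA) (unit_int_lim f N B v Hf Hv HB)).
  refine (is_lim1_ext _ _ _ _ L). intros s Hs.
  assert (Hfu := unit_cont_ana f (proj1 Hf)).
  rewrite <- CInt_minus by (apply unit_cont_ex; try lra; now apply unit_cont_mult).
  apply CInt_ext. lra. intros t _. ceq. ring.
Qed.

Lemma unit_int_scal (f : C -> C) (N A : R) (c : C) (u : R -> C) : in_H1 f N -> unit_bounded u A ->
  unit_int f (fun t => (c * u t)%C) = (c * unit_int f u)%C.
Proof.
  intros Hf Hu. destruct (unit_bounded_scal c u A Hu) as [Hcu HcuB]. destruct Hu as [Hu HA].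
  apply (is_lim1_unique _ _ _ (unit_int_lim f N _ _ Hf Hcu HcuB)).
  assert (L := is_lim1_scal _ _ c (unit_int_lim f N A u Hf Hu HA)).
  refine (is_lim1_ext _ _ _ _ L). intros s Hs.
  assert (Hfu := unit_cont_ana f (proj1 Hf)).
  rewrite <- CInt_scal by (apply unit_cont_ex; try lra; now apply unit_cont_mult).
  apply CInt_ext. lra. intros t _. ceq. ring.
Qed.

Lemma unit_int_minus_f (f g : C -> C) (N M A : R) (u : R -> C) : in_H1 f N -> in_H1 g M -> unit_bounded u A ->
  unit_int (fun z => (f z - g z)%C) u = (unit_int f u - unit_int g u)%C.
Proof.
  intros Hf Hg [Hu HA].
  apply (is_lim1_unique _ _ _ (unit_int_lim _ _ A u (H1_minus f g N M Hf Hg) Hu HA)).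
  assert (L := is_lim1_minus _ _ _ _ (unit_int_lim f N A u Hf Hu HA) (unit_int_lim g M A u Hg Hu HA)).
  refine (is_lim1_ext _ _ _ _ L). intros s Hs.
  assert (Hfu := unit_cont_ana f (proj1 Hf)). assert (Hgu := unit_cont_ana g (proj1 Hg)).
  rewrite <- CInt_minus by (apply unit_cont_ex; try lra; now apply unit_cont_mult).
  apply CInt_ext. lra. intros t _. ceq. ring.
Qed.

Lemma unit_int_ext (f : C -> C) (N A B : R) (u v : R -> C) : in_H1 f N -> unit_bounded u A -> unit_bounded v B ->
  (forall t, 0 <= t < 1 -> u t = v t) -> unit_int f u = unit_int f v.
Proof.
  intros Hf [Hu HA] [Hv HB] E.
  apply (is_lim1_unique _ _ _ (unit_int_lim f N A u Hf Hu HA)).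
  refine (is_lim1_ext _ _ _ _ (unit_int_lim f N B v Hf Hv HB)).
  intros s Hs. apply CInt_ext. lra. intros t Ht. rewrite E; trivial. lra.
Qed.

(** [hilbert_op g] is convertible to [kernel_op (C_derive g)], so from here on only the kernel k =
    g' occurs. *)
Definition kernel_op (k f : C -> C) (z : C) : C := unit_int f (fun t => k (RtoC t * z)%C).

Lemma Cmod_tz (t p : R) (z : C) : 0 <= t <= 1 -> Cmod z <= p -> Cmod (RtoC t * z) <= p.
Proof.
  intros Ht Hz. rewrite Cmod_mult, Cmod_R, Rabs_right by lra. assert (A := Cmod_ge_0 z). nra.
Qed.

Lemma unit_cont_dil (k : C -> C) (z : C) : ana 1 k -> Cmod z <= 1 -> unit_cont (fun t => k (RtoC t * z)%C).
Proof.
  intros Hk Hz t Ht. apply ccont_comp.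
  apply ccont_mult. apply ccont_RtoC, continuous_id. apply ccont_const.
  apply ana_ccont with 1; trivial. rewrite Cmod_mult, Cmod_R, Rabs_right by lra.
  assert (A := Cmod_ge_0 z). nra.
Qed.

Lemma unit_bounded_dil (k : C -> C) (K p : R) (z : C) : ana 1 k -> p < 1 ->
  (forall w, Cmod w <= p -> Cmod (k w) <= K) -> Cmod z <= p -> unit_bounded (fun t => k (RtoC t * z)%C) K.
Proof.
  intros Hk Hp HK Hz. split. apply unit_cont_dil; trivial; lra.
  intros t Ht. apply HK, Cmod_tz; trivial; lra.
Qed.

Lemma kernel_op_unif (k f : C -> C) (N p e : R) : in_H1 f N -> ana 1 k -> 0 <= p < 1 -> 0 < e ->
  exists s0, 0 <= s0 < 1 /\ forall s z, s0 <= s < 1 -> Cmod z <= p ->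
    Cmod (CInt (fun t => (f (RtoC t) * k (RtoC t * z))%C) 0 s - kernel_op k f z) <= e.
Proof.
  intros Hf Hk Hp He. destruct (ana_est 1 p k Hk Hp) as (K & HK & HKe).
  destruct (unit_int_tail f N (e / (K + 1)) Hf) as (s0 & Hs0 & H). apply Rdiv_lt_0_compat; lra.
  exists s0. split; trivial. intros s z Hs Hz.
  assert (G : unit_bounded (fun t => k (RtoC t * z)%C) K).
  { apply unit_bounded_dil with p; trivial. lra. intros w Hw. apply (HKe w w Hw Hw). }
  eapply Rle_trans. apply (H (fun t => k (RtoC t * z)%C) K s); trivial; apply G.
  apply Rle_trans with ((K + 1) * (e / (K + 1))). apply Rmult_le_compat_r; [|lra].
  apply Rlt_le, Rdiv_lt_0_compat; lra. right; field; lra.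
Qed.

(** The derivative is the integral of f(t) t k'(t z). The second order remainder of k is bounded by
    K |w - z|^2 for every t, and integrating it against f costs the factor PI N. *)
Lemma kernel_op_ana (k f : C -> C) (N : R) : in_H1 f N -> ana 1 k -> ana 1 (kernel_op k f).
Proof.
  intros Hf Hk z Hz. assert (Hz0 := Cmod_ge_0 z). set (p := (Cmod z + 1) / 2).
  assert (Hp : 0 <= p < 1) by (unfold p; lra). assert (HN : 0 <= N) by apply Hf.
  destruct (ana_est 1 p k Hk Hp) as (K & HK & HKe).
  assert (Hk' := ana_C_derive 1 k Hk).
  destruct (ana_est 1 p _ Hk' Hp) as (K' & HK' & HKe').
  set (d := fun t => (RtoC t * C_derive k (RtoC t * z))%C).
  assert (Gz : forall w, Cmod w <= p -> unit_bounded (fun t => k (RtoC t * w)%C) K).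
  { intros w Hw. apply unit_bounded_dil with p; trivial. lra. intros x Hx. apply (HKe x x Hx Hx). }
  assert (Gd : unit_bounded d K').
  { split. intros t Ht. apply ccont_mult. apply ccont_RtoC, continuous_id.
    apply (unit_cont_dil _ z Hk'); trivial; lra.
    intros t Ht. unfold d. assert (Htz : Cmod (RtoC t * z) <= p) by (apply Cmod_tz; unfold p; lra).
    destruct (HKe' _ _ Htz Htz) as [A _].
    rewrite Cmod_mult, Cmod_R, Rabs_right by lra.
    assert (B := Cmod_ge_0 (C_derive k (RtoC t * z))). nra. }
  exists (unit_int f d). apply is_Cder_quad with (d := p - Cmod z) (K := PI * N * K). unfold p; lra.
  intros w Hw.
  assert (Hwp : Cmod w <= p).
  { assert (A := Cmod_cont_diff w z). apply Rabs_le_between in A. lra. }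
  assert (Hzp : Cmod z <= p) by (unfold p; lra).
  unfold kernel_op. rewrite <- (unit_int_scal f N K'), <- (unit_int_minus f N K K), <- (unit_int_minus f N (K + K) (Cmod (w - z) * K'));
    auto. 2: now apply unit_bounded_minus; auto. 2: now apply unit_bounded_scal.
  eapply Rle_trans. apply (unit_int_bound f N (K * Cmod (w - z) ^ 2)); trivial.
  - split. intros t Ht. apply ccont_minus. apply ccont_minus; apply Gz; trivial.
    apply ccont_mult. apply ccont_const. now apply Gd.
    intros t Ht. assert (Htz : Cmod (RtoC t * z) <= p) by (apply Cmod_tz; trivial; lra).
    assert (Htw : Cmod (RtoC t * w) <= p) by (apply Cmod_tz; trivial; lra).
    destruct (HKe _ _ Htz Htw) as (_ & _ & Q).
    replace (RtoC t * w - RtoC t * z)%C with (RtoC t * (w - z))%C in Q by ring.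
    unfold d. replace ((w - z) * (t * C_derive k (t * z)))%C with (t * (w - z) * C_derive k (t * z))%C by ring.
    eapply Rle_trans. exact Q. apply Rmult_le_compat_l; trivial.
    apply pow_incr. split. apply Cmod_ge_0. apply Cmod_tz; lra.
  - right. ring.
Qed.

(** For s < 1 the integral over [0, s] is an average of Lipschitz families: z |-> f(t) k(t z) has
    mean at most B |f(t)|, since the mean of k(t z) on radius r is that of k on radius t r. The
    remainder is uniformly at most e on the circle. *)
Lemma kernel_op_mean (p : Rbar) (k f : C -> C) (N B : R) : Rbar_le 1 p -> in_H1 f N -> ana 1 k ->
  (forall r, 0 < r < 1 -> mean_le p r k B) ->
  forall r, 0 < r < 1 -> mean_le p r (kernel_op k f) (PI * N * B).
Proof.
  intros Hp Hf Hk HB r Hr. assert (HN : 0 <= N) by apply Hf. assert (Hfa : ana 1 f) by apply Hf.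
  assert (B0 := mean_le_ge0 p r k B ltac:(lra) Hp (HB r Hr)).
  apply mean_le_eps. intros e He.
  destruct (kernel_op_unif k f N r e Hf Hk) as (s & Hs & HT); try lra.
  specialize (fun z => HT s z ltac:(lra)).
  set (T := fun z => CInt (fun t => (f (RtoC t) * k (RtoC t * z))%C) 0 s).
  destruct (ana_est 1 s f Hfa Hs) as (Kf & HKf & HKfe).
  destruct (ana_est 1 r k Hk) as (Kk & HKk & HKke). lra.
  assert (Hrt : forall t, 0 <= t <= s -> Cmod (RtoC t) <= s) by (intros t Ht; rewrite Cmod_R, Rabs_right; lra).
  destruct (integral_minkowski p r (Kf * Kk * 2 + Kf * B) 0 s
    (fun t z => (f (RtoC t) * k (RtoC t * z))%C) (fun t => B * Cmod (f (RtoC t)))) as [IM IC]; trivial; try lra.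
  - assert (0 <= Kf * Kk) by nra. nra.
  - intros t Ht. rewrite Rmult_comm.
    assert (Hc : circ_cont r (fun z => k (RtoC t * z)%C)).
    { intros x. apply (ccont_comp (fun x => (RtoC t * circle_pt r x)%C) k).
      apply ccont_mult. apply ccont_const. apply ccont_circle_pt.
      apply ana_ccont with 1; trivial. apply Rle_lt_trans with r; [|lra]. apply Cmod_tz. lra.
      rewrite Cmod_circle_pt; lra. }
    apply mean_le_scal with (c := f (RtoC t)); trivial. lra.
    (* At t = 0 the circle degenerates; Cauchy's formula bounds |k(0)| by the mean of |k|, hence by
       B. *)
    destruct (Req_dec t 0) as [->|Hn].
    + apply mean_le_sup; trivial. lra. intros z Hz.
      replace (0 * z)%C with (RtoC 0) by ring.
      rewrite (cauchy_formula 1 r k 0) by (trivial; try lra; rewrite Cmod_0; lra).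
      assert (Hkc : pcont (fun t => k (circle_pt r t))) by (apply (pcont_ana 1); trivial; lra).
      eapply Rle_trans; [|apply (mean_le_rmean p r k B); trivial; try lra; now apply HB].
      apply cmean_norm.
      apply pcont_mult. apply (pcont_cauchy_density 1); trivial; lra. apply pcont_kernel; try lra. rewrite Cmod_0; lra.
      now apply pcont_Cmod.
      intros x. assert (Hx := circle_neq r x 0 ltac:(lra) ltac:(rewrite Cmod_0; lra)).
      replace (circle_pt r x - 0)%C with (circle_pt r x) in * by ring.
      right. f_equal. field. trivial.
    + apply (proj1 (mean_le_dil p r t k B ltac:(lra))). apply HB. nra.
  - intros t t' z z' Ht Ht' Hz Hz'.
    destruct (HKfe (RtoC t') (RtoC t)) as (_ & F2 & _); auto.
    destruct (HKfe (RtoC t) (RtoC t)) as (F1 & _ & _); auto.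
    assert (A : Cmod (t * z) <= r) by (apply Cmod_tz; lra).
    assert (A' : Cmod (t' * z') <= r) by (apply Cmod_tz; lra).
    destruct (HKke (t' * z') (t * z))%C as (K1 & K2 & _); auto.
    rewrite <- RtoC_minus, Cmod_R in F2.
    assert (Dz : Cmod (t * z - t' * z') <= Rabs (t - t') + Cmod (z - z')).
    { replace (t * z - t' * z')%C with ((t - t')%R * z + t' * (z - z'))%C by (rewrite RtoC_minus; ring).
      eapply Rle_trans. apply Cmod_triangle. rewrite !Cmod_mult, !Cmod_R, (Rabs_right t') by lra.
      assert (0 <= Rabs (t - t')) by apply Rabs_pos. assert (0 <= Cmod (z - z')) by apply Cmod_ge_0. nra. }
    replace (f t * k (t * z) - f t' * k (t' * z'))%C with
      (f t * (k (t * z) - k (t' * z')) + (f t - f t') * k (t' * z'))%C by ring.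
    eapply Rle_trans. apply Cmod_triangle. rewrite !Cmod_mult.
    assert (P1 := Rabs_pos (t - t')). assert (P2 := Cmod_ge_0 (z - z')).
    assert (E1 : Cmod (f t) * Cmod (k (t * z)%C - k (t' * z')%C) <= Kf * (Kk * (Rabs (t - t') + Cmod (z - z')))).
    { apply Rmult_le_compat; trivial; try apply Cmod_ge_0. eapply Rle_trans. exact K2.
      now apply Rmult_le_compat_l. }
    assert (E2 : Cmod (f t - f t') * Cmod (k (t' * z')%C) <= Kf * Rabs (t - t') * Kk).
    { apply Rmult_le_compat; trivial; try apply Cmod_ge_0. }
    assert (Q : 0 <= Kf * Kk) by nra. assert (Q2 : 0 <= Kf * B) by nra.
    assert (Q3 := Rmult_le_pos _ _ Q P2). assert (Q4 := Rmult_le_pos _ _ Q2 P1). assert (Q5 := Rmult_le_pos _ _ Q2 P2).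
    nra.
  - intros t t' Ht Ht'.
    destruct (HKfe (RtoC t') (RtoC t)) as (_ & F2 & _); auto. rewrite <- RtoC_minus, Cmod_R in F2.
    rewrite <- Rmult_minus_distr_l, Rabs_mult, (Rabs_right B) by lra.
    assert (A := Cmod_cont_diff (f t) (f t')).
    assert (P1 := Rabs_pos (t - t')). assert (Q : 0 <= Kf * Kk) by nra. assert (Q1 := Rmult_le_pos _ _ Q P1).
    apply Rle_trans with (B * (Kf * Rabs (t - t'))). apply Rmult_le_compat_l; lra. lra.
  - fold T in IM, IC.
    assert (HTc : circ_cont r (kernel_op k f)).
    { apply (pcont_ana 1). lra. now apply kernel_op_ana with N. }
    apply mean_le_ext with (fun z => (T z + (kernel_op k f z - T z))%C). lra. intros; ring.
    apply mean_le_plus; trivial. lra. now apply circ_cont_minus.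
    + apply mean_le_mono with (2 := IM).
      rewrite (RInt_scal (V := R_CompleteNormedModule)).
      2: apply (unit_cont_ex_mod (fun t => f (RtoC t))); try lra; now apply unit_cont_ana.
      unfold scal; simpl; unfold mult; simpl. rewrite Rmult_comm. apply Rmult_le_compat_r; trivial.
      apply (H1_int f N s Hf Hs).
    + apply mean_le_sup; trivial. lra. now apply circ_cont_minus.
      intros z Hz. rewrite Cmod_minus_sym. apply HT. lra.
Qed.

(** * Test functions concentrating at 1 *)

Definition ftest (a : R) (z : C) : C := (RtoC (1 - a ^ 2) * (/ (1 - a * z) * / (1 - a * z)))%C.

Lemma ftest_den (a : R) (z : C) : 0 <= a < 1 -> Cmod z <= 1 -> (1 - a * z)%C <> RtoC 0.
Proof.
  intros Ha Hz. apply Cminus_neq_0. intros E.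
  assert (E1 : Cmod (a * z) = 1) by (rewrite <- E; apply Cmod_1).
  rewrite Cmod_mult, Cmod_R, Rabs_right in E1 by lra. assert (A := Cmod_ge_0 z). nra.
Qed.

Lemma ftest_real (a t : R) : 0 <= a < 1 -> 0 <= t <= 1 ->
  ftest a (RtoC t) = RtoC ((1 - a ^ 2) / (1 - a * t) ^ 2).
Proof.
  intros Ha Ht. assert (0 < 1 - a * t) by nra. unfold ftest.
  rewrite <- RtoC_mult, <- RtoC_minus, <- RtoC_inv, <- !RtoC_mult by lra. f_equal. field. lra.
Qed.

Lemma ftest_ana (a : R) : 0 <= a < 1 -> ana 1 (ftest a).
Proof.
  intros Ha. assert (H : ana 1 (fun z => / (1 - a * z))%C).
  { apply ana_inv. apply ana_minus. apply ana_const. apply ana_mult. apply ana_const. apply ana_id.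
    intros z Hz. apply ftest_den; trivial; lra. }
  apply ana_mult. apply ana_const. now apply ana_mult.
Qed.

(** On the circle of radius r the modulus is the Poisson kernel with parameter s = a r, times (1 -
    a^2) / (1 - s^2) <= 1. *)
Lemma ftest_H1 (a : R) : 0 <= a < 1 -> in_H1 (ftest a) 1.
Proof.
  intros Ha. split; [|split]. now apply ftest_ana. lra. intros r Hr.
  set (s := a * r). assert (Hs : 0 <= s < 1) by (unfold s; nra).
  assert (Hsa : s ^ 2 <= a ^ 2) by (apply pow_incr; unfold s; nra). assert (Ha1 : a ^ 2 < 1) by nra.
  replace (rmean (fun t => Cmod (ftest a (circle_pt r t)))) with
    (rmean (fun t => (1 - a ^ 2) / (1 - s ^ 2) * PK s (t - 0))).
  - rewrite rmean_scal by (intros; now apply PK_continuous). rewrite rmean_PK, Rmult_1_r by trivial.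
    apply Rmult_le_reg_r with (1 - s ^ 2). nra. unfold Rdiv. rewrite Rmult_assoc, Rinv_l; nra.
  - unfold rmean. f_equal. apply RInt_ext. intros t _. rewrite Rminus_0_r.
    assert (Hd := ftest_den a (circle_pt r t) Ha ltac:(rewrite Cmod_circle_pt; lra)).
    unfold ftest. rewrite !Cmod_mult, Cmod_R, Cmod_inv, Rabs_right by (trivial; lra).
    assert (E : Cmod (1 - a * circle_pt r t) * Cmod (1 - a * circle_pt r t) = 1 - 2 * s * cos t + s ^ 2).
    { replace (Cmod (1 - a * circle_pt r t) * Cmod (1 - a * circle_pt r t)) with
        (Cmod (1 - a * circle_pt r t) ^ 2) by ring.
      rewrite Cmod2_alt. unfold circle_pt, s. simpl.
      assert (S1 := sin2_cos2 t). unfold Rsqr in S1.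
      replace (a * r * (a * r * 1)) with (a * r * (a * r) * (sin t * sin t + cos t * cos t)) by (rewrite S1; ring).
      ring. }
    rewrite <- Rinv_mult, E. unfold PK. assert (A := PK_den s t Hs).
    req. field. split; nra.
Qed.

(** The primitive (1 - a^2) t / (1 - a t) vanishes at 0 and equals 1 + a at t = 1; this is where the
    constant 2 comes from. *)
Lemma ftest_int (a s : R) : 0 <= a < 1 -> 0 <= s < 1 ->
  RInt (fun t => (1 - a ^ 2) / (1 - a * t) ^ 2) 0 s = (1 - a ^ 2) * s / (1 - a * s).
Proof.
  intros Ha Hs.
  assert (Hd : forall t, 0 <= t <= s -> 0 < 1 - a * t) by (intros t Ht; nra).
  apply is_RInt_unique.
  assert (H := is_RInt_derive (V := R_CompleteNormedModule) (fun t => (1 - a ^ 2) * t / (1 - a * t))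
    (fun t => (1 - a ^ 2) / (1 - a * t) ^ 2) 0 s).
  rewrite Rmin_left, Rmax_right in H by lra.
  replace ((1 - a ^ 2) * s / (1 - a * s)) with
    (minus ((1 - a ^ 2) * s / (1 - a * s)) ((1 - a ^ 2) * 0 / (1 - a * 0))).
  apply H.
  - intros t Ht. specialize (Hd t Ht). auto_derive. lra. req. field. lra.
  - intros t Ht. specialize (Hd t Ht). apply (ex_derive_continuous (V := R_NormedModule)).
    auto_derive. assert (0 < (1 - a * t) * ((1 - a * t) * 1)) by nra. simpl. lra.
  - unfold minus, plus, opp; simpl. specialize (Hd s ltac:(lra)). field. lra.
Qed.

Lemma ftest_unit_int_1 (a : R) : 0 <= a < 1 -> unit_int (ftest a) (fun _ => RtoC 1) = RtoC (1 + a).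
Proof.
  intros Ha. assert (G : unit_bounded (fun _ => RtoC 1) 1).
  { split. intros t _; apply ccont_const. intros t _. rewrite Cmod_1. lra. }
  apply (is_lim1_unique _ _ _ (unit_int_lim _ 1 1 _ (ftest_H1 a Ha) (proj1 G) (proj2 G))).
  apply is_lim1_ext with (fun s => RtoC ((1 - a ^ 2) * s / (1 - a * s))).
  { intros s Hs. rewrite <- ftest_int by trivial. rewrite <- CInt_RtoC.
    apply CInt_ext. lra. intros t Ht. rewrite ftest_real by lra. ceq. ring.
    apply ex_RInt_cont. lra. intros t Ht. assert (0 < 1 - a * t) by nra.
    apply (ex_derive_continuous (V := R_NormedModule)).
    auto_derive. assert (0 < (1 - a * t) * ((1 - a * t) * 1)) by nra. lra. }
  intros e He. set (x := 1 - e * (1 - a) / 2). exists (Rmax 0 x). split.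
  { split. apply Rmax_l. apply Rmax_lub_lt. lra. unfold x. assert (0 < e * (1 - a)) by nra. lra. }
  intros s Hs. assert (A1 := Rmax_l 0 x). assert (A2 := Rmax_r 0 x).
  assert (Hd : 1 - a <= 1 - a * s) by nra.
  rewrite <- RtoC_minus, Cmod_R.
  replace ((1 - a ^ 2) * s / (1 - a * s) - (1 + a)) with (- ((1 + a) * (1 - s) / (1 - a * s))) by (field; lra).
  rewrite Rabs_Ropp, Rabs_right.
  2:{ apply Rle_ge. apply Rmult_le_pos. nra. apply Rlt_le, Rinv_0_lt_compat; lra. }
  apply Rmult_le_reg_r with (1 - a * s). lra. unfold Rdiv. rewrite Rmult_assoc, Rinv_l by lra.
  assert (Hq : x <= s) by lra. unfold x in Hq.
  assert (e * (1 - a) <= e * (1 - a * s)) by (apply Rmult_le_compat_l; lra). nra.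
Qed.

(* The mass of [ftest a] on [0,1] tends to 2 and concentrates at 1 as [a] tends to 1. *)
Lemma ftest_conv (k : C -> C) (r e : R) : ana 1 k -> 0 <= r < 1 -> 0 < e ->
  exists a0, 0 <= a0 < 1 /\ forall a z, a0 <= a < 1 -> Cmod z <= r ->
    Cmod (kernel_op k (ftest a) z - 2 * k z) <= e.
Proof.
  intros Hk Hr He. destruct (ana_est 1 r k Hk Hr) as (K & HK & HKe).
  set (d := e / (8 * (K + 1))). assert (Hd : 0 < d) by (unfold d; apply Rdiv_lt_0_compat; lra).
  assert (HKd : K * d <= e / 8).
  { assert ((K + 1) * d = e / 8) by (unfold d; field; lra). nra. }
  (* x bounds 1 - a. The term d^2 controls the quadratic part of the estimate below, and e / (4 (K +
     1)) the replacement of 1 + a by 2. *)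
  set (x := Rmin (/ 2) (Rmin (d * d) (e / (4 * (K + 1))))).
  assert (Hx : 0 < x).
  { unfold x. repeat apply Rmin_glb_lt. lra. nra. apply Rdiv_lt_0_compat; lra. }
  assert (Hx1 : x <= / 2) by apply Rmin_l.
  assert (Hx2 : x <= d * d) by (eapply Rle_trans; [apply Rmin_r | apply Rmin_l]).
  assert (Hx3 : x <= e / (4 * (K + 1))) by (eapply Rle_trans; [apply Rmin_r | apply Rmin_r]).
  assert (HKx : K * x <= e / 4).
  { apply Rle_trans with ((K + 1) * (e / (4 * (K + 1)))). apply Rmult_le_compat; lra. right; field; lra. }
  exists (1 - x). split. lra. intros a z Ha Hz. assert (Ha' : 0 <= a < 1) by lra.
  assert (HF := ftest_H1 a Ha'). assert (HFa := ftest_ana a Ha').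
  assert (G1 : unit_bounded (fun _ => RtoC 1) 1).
  { split. intros t _; apply ccont_const. intros t _. rewrite Cmod_1. lra. }
  assert (Gk : unit_bounded (fun t => k (RtoC t * z)%C) K).
  { apply unit_bounded_dil with r; trivial. lra. intros w Hw. apply (HKe w w Hw Hw). }
  assert (Gz := unit_bounded_scal (k z) _ _ G1).
  assert (E : (kernel_op k (ftest a) z - k z * RtoC (1 + a))%C =
     unit_int (ftest a) (fun t => (k (RtoC t * z) - k z * 1)%C)).
  { rewrite (unit_int_minus _ 1 K (Cmod (k z) * 1)) by trivial.
    rewrite (unit_int_scal _ 1 1) by trivial. rewrite ftest_unit_int_1 by trivial. reflexivity. }
  destruct (unit_bounded_minus _ _ _ _ Gk Gz) as [Gm1 Gm2].
  assert (B1 : Cmod (unit_int (ftest a) (fun t => (k (RtoC t * z) - k z * 1)%C)) <= e / 2).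
  { apply (is_lim1_bound _ _ _ (unit_int_lim _ 1 _ _ HF Gm1 Gm2)). intros s Hs.
    (* The majorant after |k(t z) - k z| <= K (1 - a t) and AM-GM. As f_a(t) (1 - a t)^2 = 1 - a^2,
       the quadratic part becomes a constant of order 1 - a. *)
    set (v := fun t => K * d * ((1 - a ^ 2) / (1 - a * t) ^ 2) + K * (1 - a ^ 2) / (4 * d)).
    assert (Hfc : forall t, 0 <= t <= s -> continuous (fun t => (1 - a ^ 2) / (1 - a * t) ^ 2) t).
    { intros t Ht. assert (0 < 1 - a * t) by nra. apply (ex_derive_continuous (V := R_NormedModule)).
      auto_derive. assert (0 < (1 - a * t) * ((1 - a * t) * 1)) by nra. lra. }
    assert (Hfx : ex_RInt (fun t => (1 - a ^ 2) / (1 - a * t) ^ 2) 0 s) by (apply ex_RInt_cont; trivial; lra).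
    assert (Hvx : ex_RInt v 0 s).
    { apply ex_RInt_cont. lra. intros t Ht. apply continuous_plusR. apply continuous_scalR; auto. apply continuous_const. }
    apply Rle_trans with (RInt v 0 s).
    - apply CInt_norm; trivial. lra. apply unit_cont_ex; try lra. apply unit_cont_mult; trivial.
      now apply unit_cont_ana.
      intros t Ht. rewrite ftest_real by lra. rewrite Cmod_mult, Cmod_R.
      assert (Hp : 0 < 1 - a * t) by nra. assert (Hp2 : 0 < (1 - a * t) ^ 2) by (apply pow_lt; lra).
      assert (Ha2 : 0 <= 1 - a ^ 2) by nra.
      set (X := (1 - a ^ 2) / (1 - a * t) ^ 2).
      assert (HX : 0 <= X) by (apply Rmult_le_pos; trivial; apply Rlt_le, Rinv_0_lt_compat; lra).
      rewrite Rabs_right by lra.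
      assert (Hw : Cmod (k (RtoC t * z)%C - k z * 1) <= K * (1 - a * t)).
      { replace (k z * 1)%C with (k z) by ring.
        destruct (HKe z (RtoC t * z)%C Hz) as (_ & Q & _). apply Cmod_tz; trivial; lra.
        eapply Rle_trans. exact Q. apply Rmult_le_compat_l; trivial.
        replace (t * z - z)%C with ((t - 1)%R * z)%C by (rewrite RtoC_minus; ring).
        rewrite Cmod_mult, Cmod_R, Rabs_left1 by lra. assert (Z0 := Cmod_ge_0 z). nra. }
      apply Rle_trans with (X * (K * (1 - a * t))). now apply Rmult_le_compat_l.
      assert (EX : X * (1 - a * t) ^ 2 = 1 - a ^ 2) by (unfold X; field; lra).
      set (y := 1 - a * t) in *.
      (* AM-GM: [y <= d + y^2 / (4 d)] *)
      assert (Hy : y <= d + y ^ 2 / (4 * d)).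
      { apply Rmult_le_reg_r with (4 * d). lra.
        replace ((d + y ^ 2 / (4 * d)) * (4 * d)) with (4 * d ^ 2 + y ^ 2) by (field; lra).
        assert (0 <= (y - 2 * d) ^ 2) by apply pow2_ge_0. nra. }
      apply Rle_trans with (X * (K * (d + y ^ 2 / (4 * d)))).
      apply Rmult_le_compat_l; trivial. now apply Rmult_le_compat_l.
      right. unfold v. fold y. fold X. rewrite <- EX. field. lra.
    - unfold v.
      rewrite (RInt_plus (V := R_CompleteNormedModule)) by (apply (ex_RInt_scal (V := R_NormedModule)); trivial || apply (ex_RInt_const (V := R_NormedModule))).
      rewrite (RInt_scal (V := R_CompleteNormedModule)) by trivial.
      rewrite RInt_const_R, ftest_int by trivial.
      unfold plus, scal; simpl; unfold mult; simpl.
      assert (Hps : 0 < 1 - a * s) by nra.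
      assert (U1 : (1 - a * (a * 1)) * s / (1 - a * s) <= 2).
      { apply Rmult_le_reg_r with (1 - a * s); trivial. unfold Rdiv. rewrite Rmult_assoc, Rinv_l by lra. nra. }
      assert (U2 : K * (1 - a * (a * 1)) / (4 * d) <= e / 8 / 2).
      { apply Rmult_le_reg_r with (4 * d). lra. unfold Rdiv at 1. rewrite Rmult_assoc, Rinv_l by lra.
        assert (1 - a * (a * 1) <= 2 * x) by nra.
        assert (K * (1 - a * (a * 1)) <= K * (2 * (d * d))) by (apply Rmult_le_compat_l; lra).
        assert (K * d * d <= e / 8 * d) by (apply Rmult_le_compat_r; lra). lra. }
      assert (U3 : 0 <= K * d) by nra.
      assert (U4 : 0 <= K * (1 - a * (a * 1)) / (4 * d)).
      { apply Rmult_le_pos. apply Rmult_le_pos; trivial; nra. apply Rlt_le, Rinv_0_lt_compat; lra. }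
      assert (U5 : K * d * ((1 - a * (a * 1)) * s / (1 - a * s)) <= K * d * 2) by (now apply Rmult_le_compat_l).
      assert (U6 : (s - 0) * (K * (1 - a * (a * 1)) / (4 * d)) <= 1 * (K * (1 - a * (a * 1)) / (4 * d)))
        by (apply Rmult_le_compat_r; lra).
      lra. }
  replace (kernel_op k (ftest a) z - 2 * k z)%C with
    ((kernel_op k (ftest a) z - k z * RtoC (1 + a)) + k z * RtoC (a - 1))%C
    by (rewrite RtoC_plus, RtoC_minus; ring).
  eapply Rle_trans. apply Cmod_triangle. rewrite E. rewrite Cmod_mult, Cmod_R, Rabs_left1 by lra.
  destruct (HKe z z Hz Hz) as [Kz _]. assert (Z0 := Cmod_ge_0 (k z)).
  assert (Cmod (k z) * - (a - 1) <= K * x) by (apply Rmult_le_compat; lra). lra.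
Qed.

(** * Polynomial approximation in Hardy spaces *)

Lemma rpow_le_weak (x y p : R) : 0 <= p -> x <= y -> rpow x p <= rpow y p.
Proof.
  intros Hp Hxy. destruct (Req_dec p 0) as [->|Hn].
  - destruct (Rle_dec x 0). rewrite rpow_npos by trivial. apply rpow_ge0.
    rewrite !rpow_pos_eq, !Rpower_O by lra. lra.
  - apply rpow_le; lra.
Qed.

(** Write z^p = z z^(p-1) and use the monotonicity of z^(p-1). *)
Lemma rpow_superadd (x y p : R) : 1 <= p -> 0 <= x -> 0 <= y ->
  rpow x p + rpow y p <= rpow (x + y) p.
Proof.
  intros Hp Hx Hy.
  assert (E : forall z, 0 <= z -> rpow z p = z * rpow z (p - 1)).
  { intros z Hz. rewrite <- (rpow_1 z) at 2 by trivial. rewrite <- rpow_plus. f_equal. ring. }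
  rewrite (E x), (E y), (E (x + y)) by lra.
  assert (A := rpow_le_weak x (x + y) (p - 1) ltac:(lra) ltac:(lra)).
  assert (B := rpow_le_weak y (x + y) (p - 1) ltac:(lra) ltac:(lra)). nra.
Qed.

Lemma rpow_sq (x q : R) : 0 <= x -> rpow x q = rpow (x ^ 2) (q / 2).
Proof. intros Hx. rewrite <- rpow_2, rpow_rpow by trivial. f_equal. field. Qed.

(** The parallelogram law raised to the power q / 2 >= 1: superadditivity handles the left side,
    convexity the right side. *)
Lemma clarkson (q : R) (a b : C) : 2 <= q ->
  rpow (Cmod (/ 2 * (a + b))) q + rpow (Cmod (/ 2 * (a - b))) q <=
  / 2 * (rpow (Cmod a) q + rpow (Cmod b) q).
Proof.
  intros Hq. rewrite !(rpow_sq (Cmod _)) by apply Cmod_ge_0.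
  assert (P : forall z, 0 <= Cmod z ^ 2) by (intros; apply pow2_ge_0).
  eapply Rle_trans. apply rpow_superadd; trivial. lra.
  replace (Cmod (/ 2 * (a + b)) ^ 2 + Cmod (/ 2 * (a - b)) ^ 2) with
    (/ 2 * Cmod a ^ 2 + / 2 * Cmod b ^ 2).
  - eapply Rle_trans. apply rpow_convex; trivial; lra. lra.
  - rewrite <- RtoC_inv by lra. rewrite !Cmod2_alt. destruct a, b. simpl. field.
Qed.

Lemma pmean_ge0 (q r : R) (f : C -> C) : 0 < q -> circ_cont r f -> 0 <= pmean q r f.
Proof.
  intros Hq Hf. apply rmean_ge0. intros; now apply pmean_cont. intros; apply rpow_ge0.
Qed.

Lemma mean_le_pmean (q r : R) (f : C -> C) : 0 < q -> circ_cont r f ->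
  mean_le (Finite q) r f (rpow (pmean q r f) (/ q)).
Proof.
  intros Hq Hf. apply mean_le_fin; trivial. apply rpow_ge0.
  rewrite rpow_rpow, Rinv_l, rpow_1. lra. now apply pmean_ge0. lra.
Qed.

Lemma pmean_mono (q rho r r' : R) (f : C -> C) : 1 <= q -> ana rho f -> 0 < r' <= r -> r < rho ->
  pmean q r' f <= pmean q r f.
Proof.
  intros Hq Hf Hr Hrho. destruct (Req_dec r' r) as [->|Hn]. lra.
  assert (Hc : circ_cont r f) by (apply (pcont_ana rho); trivial; lra).
  assert (M := mean_le_pmean q r f ltac:(lra) Hc).
  apply (mean_le_radius (Finite q) rho r (r' / r)) in M; trivial; try lra.
  - replace (r' / r * r) with r' in M by (field; lra).
    apply mean_le_fin in M; try lra. 2: apply rpow_ge0.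
    rewrite rpow_rpow, Rinv_l, rpow_1 in M; trivial. now apply pmean_ge0; [lra|]. lra.
  - split. apply Rdiv_lt_0_compat; lra. apply Rmult_lt_reg_r with r. lra.
    unfold Rdiv. rewrite Rmult_assoc, Rinv_l; lra.
Qed.

Lemma pmean_dil (q r s : R) (f : C -> C) : pmean q r (fun z => f (RtoC s * z)%C) = pmean q (s * r) f.
Proof.
  unfold pmean, rmean. f_equal. apply RInt_ext. intros t _. now rewrite <- circle_pt_scal.
Qed.

Lemma ana_dil (rho s : R) (f : C -> C) : 0 < s <= 1 -> 0 < rho -> ana rho f -> ana rho (fun z => f (RtoC s * z)%C).
Proof.
  intros Hs Hrho Hf. apply (ana_comp_scal rho); trivial; rewrite Cmod_R, Rabs_right; nra.
Qed.

Lemma rmean_le_pmean (q r : R) (f : C -> C) : 1 <= q -> circ_cont r f ->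
  rmean (fun t => Cmod (f (circle_pt r t))) <= 1 + pmean q r f.
Proof.
  intros Hq Hf. rewrite <- (rmean_const 1) at 1. unfold pmean. rewrite <- rmean_plus.
  - apply rmean_le. now apply pcont_Cmod. intros t; apply continuous_plusR. apply continuous_const.
    apply pmean_cont; trivial; lra.
    intros t. set (x := Cmod _). assert (Hx : 0 <= x) by apply Cmod_ge_0.
    assert (B := rpow_bernoulli x q Hq Hx). assert (P := rpow_ge0 x q). nra.
  - intros t; apply continuous_const.
  - intros t; apply pmean_cont; trivial; lra.
Qed.

(* Uniform convexity, uniformly in [F] and [r]: on the small circle [r'] the dilate [F(s z)] is
   uniformly close to [F] by Cauchy's estimates, so the mean of [(F + F(s z)) / 2] is nearly [La]
   there, hence also on the larger circle [r], and Clarkson's inequality applies. *)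
Lemma dilation_close (q eta La r' : R) : 2 <= q -> 0 < eta -> 0 <= La -> 0 < r' < 1 ->
  exists s, 0 < s < 1 /\ forall r rho F, (1 + r') / 2 <= r -> r < rho -> ana rho F ->
    pmean q r F <= La + eta -> La - 3 * eta <= pmean q r' F ->
    pmean q r (fun z => (F z - F (RtoC s * z)%C)%C) <= rpow 2 q * (5 * eta).
Proof.
  intros Hq Heta HLa Hr'. set (r1 := (1 + r') / 2).
  assert (Hr1 : r' < r1 < 1) by (unfold r1; lra).
  assert (Hi : 0 < / (r1 - r')) by (apply Rinv_0_lt_compat; lra).
  (* Bound for the mean of |F|, from x <= 1 + x^q. *)
  set (M := 1 + (La + eta)). assert (HM : 0 < M) by (unfold M; lra).
  set (Cb := r1 / (r1 - r') * M). set (L := (/ (r1 - r')) ^ 2 * (r1 * M)).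
  assert (HCb : 0 < Cb).
  { unfold Cb, Rdiv. apply Rmult_lt_0_compat; trivial. apply Rmult_lt_0_compat; lra. }
  assert (HL : 0 < L).
  { unfold L. apply Rmult_lt_0_compat. apply pow_lt; trivial. apply Rmult_lt_0_compat; lra. }
  (* On the circle r', where |F| <= Cb, replacing F by its average with the dilate moves |F|^q by at
     most X (1 - s): the derivative of x^q at Cb times the displacement. *)
  set (X := q * rpow Cb (q - 1) * (L * r')).
  assert (HX : 0 < X).
  { unfold X. apply Rmult_lt_0_compat. apply Rmult_lt_0_compat. lra. now apply rpow_pos.
    apply Rmult_lt_0_compat; lra. }
  set (x := Rmin (/ 2) (eta / X)).
  assert (Hx : 0 < x) by (unfold x; apply Rmin_glb_lt; [lra | now apply Rdiv_lt_0_compat]).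
  assert (Hx1 : x <= / 2) by apply Rmin_l.
  assert (Hx2 : X * x <= eta).
  { apply Rle_trans with (X * (eta / X)). apply Rmult_le_compat_l. lra. apply Rmin_r.
    right; field; lra. }
  set (s := 1 - x). assert (Hs : 0 < s < 1) by (unfold s; lra). exists s. split; trivial.
  intros r rho F Hr Hrr HF HM1 HM2.
  assert (Hrp : forall a, 0 < a <= r -> circ_cont a F) by (intros a Ha; apply (pcont_ana rho); trivial; lra).
  assert (HFs : ana rho (fun z => F (RtoC s * z)%C)) by (apply ana_dil; trivial; lra).
  assert (Hc0 := Hrp r ltac:(lra)).
  assert (Hcs : circ_cont r (fun z => F (RtoC s * z)%C)) by (apply (pcont_ana rho); trivial; lra).
  assert (Hmean : rmean (fun t => Cmod (F (circle_pt r1 t))) <= M).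
  { eapply Rle_trans. apply (rmean_le_pmean q). lra. apply Hrp; lra. unfold M. apply Rplus_le_compat_l.
    eapply Rle_trans; [|exact HM1]. apply pmean_mono with rho; trivial; lra. }
  assert (HbF : forall z, Cmod z <= r' -> Cmod (F z) <= Cb).
  { intros z Hz. eapply Rle_trans. apply (cauchy_estimate rho r1 r'); trivial; lra.
    unfold Cb. apply Rmult_le_compat_l; trivial. apply Rlt_le. unfold Rdiv. apply Rmult_lt_0_compat; lra. }
  assert (Hcl : forall z, Cmod z = r' -> Cmod (F (RtoC s * z)%C - F z) <= L * r' * x).
  { intros z Hz. eapply Rle_trans. apply (cauchy_lip rho r1 r'); trivial; try lra.
    rewrite Cmod_mult, Cmod_R, Rabs_right, Hz by lra. nra.
    replace (s * z - z)%C with (RtoC (- x) * z)%C by (unfold s; rewrite RtoC_minus, RtoC_opp; ring).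
    rewrite Cmod_mult, Cmod_R, Rabs_Ropp, Rabs_right, Hz by lra.
    apply Rle_trans with (x * r' * L). 2: right; ring.
    apply Rmult_le_compat_l. nra. unfold L. apply Rmult_le_compat_l. apply pow_le; lra.
    apply Rmult_le_compat_l; lra. }
  set (A := fun z => (/ 2 * (F z + F (RtoC s * z)%C))%C). set (D := fun z => (/ 2 * (F z - F (RtoC s * z)%C))%C).
  assert (HA : ana rho A) by (apply ana_mult; [apply ana_const | now apply ana_plus]).
  assert (HD : ana rho D) by (apply ana_mult; [apply ana_const | now apply ana_minus]).
  assert (Hq0 : 0 < q) by lra.
  assert (S1 : La - 4 * eta <= pmean q r' A).
  { assert (E : pmean q r' F <= eta + pmean q r' A).
    { rewrite <- (rmean_const eta). unfold pmean. rewrite <- rmean_plus.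
      2: intros t; apply continuous_const. 2: intros t; apply pmean_cont; trivial; apply (pcont_ana rho); trivial; lra.
      apply rmean_le. intros t; apply pmean_cont; trivial; apply Hrp; lra.
      intros t; apply continuous_plusR. apply continuous_const.
      apply pmean_cont; trivial; apply (pcont_ana rho); trivial; lra.
      intros t. set (z := circle_pt r' t). assert (Hz : Cmod z = r') by (apply Cmod_circle_pt; lra).
      assert (T := rpow_tangent (Cmod (A z)) (Cmod (F z)) q ltac:(lra) (Cmod_ge_0 _) (Cmod_ge_0 _)).
      assert (Hdiff : Cmod (F z) - Cmod (A z) <= L * r' * x).
      { assert (U := Cmod_cont_diff (F z) (A z)). apply Rabs_le_between in U.
        replace (F z - A z)%C with (- / 2 * (F (RtoC s * z)%C - F z))%C in U by (unfold A; field).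
        rewrite Cmod_mult, Cmod_opp, Cmod_inv, Cmod_R, Rabs_right in U; try lra.
        assert (V := Hcl z Hz). assert (W := Cmod_ge_0 (F (RtoC s * z)%C - F z)). lra.
        intros E. apply RtoC_inj in E. lra. }
      assert (Hpw : rpow (Cmod (F z)) (q - 1) <= rpow Cb (q - 1)).
      { apply rpow_le. lra. apply HbF. lra. }
      assert (Hp0 := rpow_ge0 (Cmod (F z)) (q - 1)).
      assert (Hlx : 0 <= L * r' * x) by (repeat apply Rmult_le_pos; lra).
      assert (Z : q * rpow (Cmod (F z)) (q - 1) * (Cmod (F z) - Cmod (A z)) <= eta).
      { apply Rle_trans with (q * rpow (Cmod (F z)) (q - 1) * (L * r' * x)).
        apply Rmult_le_compat_l; trivial. nra.
        apply Rle_trans with (q * rpow Cb (q - 1) * (L * r' * x)).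
        apply Rmult_le_compat_r; trivial. apply Rmult_le_compat_l; lra.
        eapply Rle_trans; [|exact Hx2]. right. unfold X. ring. }
      lra. }
    lra. }
  assert (S2 : pmean q r' A <= pmean q r A) by (apply pmean_mono with rho; trivial; lra).
  assert (S3 : pmean q r (fun z => F (RtoC s * z)%C) <= La + eta).
  { rewrite pmean_dil. eapply Rle_trans; [|exact HM1]. apply pmean_mono with rho; trivial; try lra. nra. }
  assert (HAc : circ_cont r A) by (apply (pcont_ana rho); trivial; lra).
  assert (HDc : circ_cont r D) by (apply (pcont_ana rho); trivial; lra).
  assert (PC := fun f H t => pmean_cont q r f t Hq0 H).
  assert (S4 : pmean q r A + pmean q r D <= / 2 * (pmean q r F + pmean q r (fun z => F (RtoC s * z)%C))).
  { unfold pmean. rewrite <- !rmean_plus, <- rmean_scal; try (apply PC; assumption).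
    - apply rmean_le.
      intros t; apply continuous_plusR; apply PC; assumption.
      intros t; apply continuous_scalR, continuous_plusR; [apply (PC F) | apply (PC (fun z => F (RtoC s * z)%C))]; assumption.
      intros t. unfold A, D. now apply clarkson.
    - intros t; apply continuous_plusR; [apply (PC F) | apply (PC (fun z => F (RtoC s * z)%C))]; assumption.
    - apply (PC (fun z => F (RtoC s * z)%C)); assumption. }
  (* The average A keeps at least La - 4 eta out of a total of La + eta, which leaves 5 eta for D,
     half of the difference. *)
  assert (S5 : pmean q r D <= 5 * eta) by lra.
  replace (pmean q r (fun z => (F z - F (RtoC s * z)%C)%C)) with (rpow 2 q * pmean q r D).
  - apply Rmult_le_compat_l; trivial. apply rpow_ge0.
  - unfold pmean. rewrite <- rmean_scal by (apply PC; assumption).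
    unfold rmean. f_equal. apply RInt_ext. intros t _. rewrite <- rpow_mult by (apply Cmod_ge_0 || lra).
    f_equal. replace 2 with (Cmod (RtoC 2)) at 1 by (rewrite Cmod_R; apply Rabs_right; lra).
    rewrite <- Cmod_mult. f_equal. unfold D. field.
Qed.

(** AM-GM with a weight in the role of Cauchy-Schwarz: a small c makes the term of the merely
    bounded factor small, provided the mean of the other factor is much smaller than c. *)
Lemma pmean_mult (p c r : R) (A B : C -> C) : 1 <= p -> 0 < c -> circ_cont r A -> circ_cont r B ->
  pmean p r (fun z => (A z * B z)%C) <= / 2 * (c * pmean (2 * p) r A + / c * pmean (2 * p) r B).
Proof.
  intros Hp Hc HA HB. assert (Hci : 0 < / c) by now apply Rinv_0_lt_compat.
  assert (PA := fun t => pmean_cont (2 * p) r A t ltac:(lra) HA).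
  assert (PB := fun t => pmean_cont (2 * p) r B t ltac:(lra) HB).
  unfold pmean. rewrite <- !rmean_scal, <- rmean_plus, <- rmean_scal; trivial;
    try (intros t; apply continuous_scalR; trivial; fail).
  2: intros t; apply continuous_plusR; apply continuous_scalR; trivial.
  apply rmean_le.
  - intros t. apply (pmean_cont p r (fun z => (A z * B z)%C)). lra. now apply circ_cont_mult.
  - intros t. apply continuous_scalR, continuous_plusR; apply continuous_scalR; trivial.
  - intros t. rewrite Cmod_mult, rpow_mult by apply Cmod_ge_0.
    replace (2 * p) with (p + p) by ring. rewrite !rpow_plus.
    set (x := rpow (Cmod (A _)) p). set (y := rpow (Cmod (B _)) p).
    apply Rmult_le_reg_l with (2 * c). lra.
    replace (2 * c * (/ 2 * (c * (x * x) + / c * (y * y)))) with (c * x * (c * x) + y * y) by (field; lra).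
    assert (0 <= (c * x - y) ^ 2) by apply pow2_ge_0. nra.
Qed.

Lemma rpow_right_cont (x p e : R) : 1 <= p -> 0 < e -> exists d, 0 < d /\ rpow (x + d) p <= rpow x p + e.
Proof.
  intros Hp He. assert (H := continuous_rpow p x ltac:(lra)).
  destruct (H _ (locally_ball (rpow x p) (mkposreal e He))) as [d Hd].
  assert (Hd0 := cond_pos d). exists (d / 2). split. lra.
  assert (B : ball x d (x + d / 2)).
  { unfold ball; simpl. unfold AbsRing_ball, abs, minus, plus, opp; simpl.
    replace (x + d / 2 + - x) with (d / 2) by ring. rewrite Rabs_right; lra. }
  specialize (Hd _ B). unfold ball in Hd; simpl in Hd.
  unfold AbsRing_ball, abs, minus, plus, opp in Hd; simpl in Hd. apply Rabs_lt_between in Hd. lra.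
Qed.

(** With k = G K on the circle of radius r, k - k_s = K (G - G_s) + G_s (K - K_s), where the index s
    marks dilates. G and K change with r, but s is fixed before r because [dilation_close] is
    uniform over functions and radii; only the supremum La of the means and one radius r' with a
    nearly extremal mean enter its choice. *)
Lemma mean_conv (p N e : R) (k : C -> C) : 1 <= p -> ana 1 k ->
  (forall r, 0 < r < 1 -> mean_le (Finite p) r k N) -> 0 < e ->
  exists s, 0 < s < 1 /\ forall r, 0 < r < 1 ->
    mean_le (Finite p) r (fun z => (k z - k (RtoC s * z)%C)%C) e.
Proof.
  intros Hp Hk HN He. assert (Hp1 : Rbar_le 1 (Finite p)) by exact Hp.
  assert (HN0 := mean_le_ge0 (Finite p) (/ 2) k N ltac:(lra) Hp1 (HN (/ 2) ltac:(lra))).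
  assert (Hkc : forall r, 0 < r < 1 -> circ_cont r k) by (intros r Hr; apply (pcont_ana 1); trivial; lra).
  set (E := fun x => exists r, 0 < r < 1 /\ x = pmean p r k).
  destruct (completeness E) as [La [HLa1 HLa2]].
  { exists (rpow N p). intros x (r & Hr & ->). apply mean_le_fin; trivial. lra. now apply HN. }
  { exists (pmean p (/ 2) k). exists (/ 2). split; trivial. lra. }
  assert (HLa : 0 <= La).
  { apply Rle_trans with (pmean p (/ 2) k). apply pmean_ge0. lra. apply Hkc; lra.
    apply HLa1. exists (/ 2). split; trivial. lra. }
  set (e1 := rpow (e / 2) p). assert (He1 : 0 < e1) by (apply rpow_pos; lra).
  (* The weight in [pmean_mult]: c times the bounded mean is at most e1, and eta below makes the
     small mean divided by c at most e1. *)
  set (c := e1 / (La + 1)). assert (Hc : 0 < c) by (apply Rdiv_lt_0_compat; lra).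
  assert (H2q := rpow_pos 2 (2 * p) ltac:(lra)).
  set (eta := Rmin 1 (c * e1 / (5 * rpow 2 (2 * p)))).
  assert (Heta : 0 < eta).
  { unfold eta. apply Rmin_glb_lt. lra. apply Rdiv_lt_0_compat. now apply Rmult_lt_0_compat. lra. }
  assert (Heta1 : eta <= 1) by apply Rmin_l.
  assert (Heta2 : rpow 2 (2 * p) * (5 * eta) <= c * e1).
  { apply Rle_trans with (rpow 2 (2 * p) * (5 * (c * e1 / (5 * rpow 2 (2 * p))))).
    apply Rmult_le_compat_l. lra. apply Rmult_le_compat_l. lra. apply Rmin_r. right; field; lra. }
  assert (Hr' : exists r', 0 < r' < 1 /\ La - eta <= pmean p r' k).
  { apply NNPP. intros Hn. assert (B : La <= La - eta). { apply HLa2. intros x (r & Hr & ->).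
    apply Rnot_lt_le. intros Hlt. apply Hn. exists r. split; trivial. lra. } lra. }
  destruct Hr' as (r' & Hr' & HL').
  destruct (dilation_close (2 * p) eta La r') as (s & Hs & Hclose); trivial; try lra.
  set (r1 := (1 + r') / 2) in *.
  exists s. split; trivial.
  assert (Hks : ana 1 (fun z => (k z - k (RtoC s * z)%C)%C)).
  { apply ana_minus; trivial. apply ana_dil; trivial; lra. }
  assert (Main : forall r, r1 <= r < 1 -> mean_le (Finite p) r (fun z => (k z - k (RtoC s * z)%C)%C) e).
  { intros r Hr. assert (Hr0 : 0 < r < 1) by (unfold r1 in Hr; lra).
    set (N' := rpow La (/ p)). assert (HN' : 0 <= N') by apply rpow_ge0.
    destruct (rpow_right_cont N' p eta Hp Heta) as (e2 & He2 & Hr2).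
    assert (EN : rpow N' p = La) by (unfold N'; rewrite rpow_rpow, Rinv_l, rpow_1; trivial; lra).
    rewrite EN in Hr2.
    destruct (factorization 1 r e2 k Hk ltac:(lra) He2) as (rho & G & K & Hrho & HG & HK & HGK & Hb).
    (* |k| + e2 as a complex-valued function, so that Minkowski's inequality bounds its p-mean; by
       the choice of e2 this stays below La + eta. *)
    set (kk := fun z => (RtoC (Cmod (k z)) + RtoC e2)%C).
    assert (Hkk1 : circ_cont r (fun z => RtoC (Cmod (k z)))).
    { intros t. apply ccont_RtoC. apply (pcont_Cmod _ (Hkc r Hr0)). }
    assert (Hkk : mean_le (Finite p) r kk (N' + e2)).
    { apply mean_le_plus; trivial; try lra. apply pcont_const.
      - apply mean_le_fin; try lra. rewrite EN.
        apply Rle_trans with (pmean p r k). right. unfold pmean, rmean. f_equal. apply RInt_ext.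
        intros t _. rewrite Cmod_R, Rabs_right; trivial. apply Rle_ge, Cmod_ge_0.
        apply HLa1. now exists r.
      - apply mean_le_sup; trivial. lra. apply pcont_const. intros z _. rewrite Cmod_R, Rabs_right; lra. }
    apply mean_le_fin in Hkk; try lra.
    assert (Hkkc : circ_cont r kk) by (apply circ_cont_plus; trivial; apply pcont_const).
    assert (Hbd : forall F, ana rho F -> (forall t, Cmod (F (circle_pt r t)) ^ 2 <= Cmod (k (circle_pt r t)) + e2) ->
       pmean (2 * p) r F <= La + eta).
    { intros F HF HFb. apply Rle_trans with (2 := Hr2). apply Rle_trans with (2 := Hkk).
      apply rmean_le. intros t; apply pmean_cont. lra. apply (pcont_ana rho); trivial; lra.
      intros t; apply pmean_cont; trivial; lra.
      intros t. rewrite rpow_sq by apply Cmod_ge_0. replace (2 * p / 2) with p by field.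
      apply rpow_le. lra. eapply Rle_trans. apply HFb. unfold kk. rewrite <- RtoC_plus, Cmod_R.
      apply Rle_abs. }
    assert (BG := Hbd G HG (fun t => proj1 (Hb t))). assert (BK := Hbd K HK (fun t => proj2 (Hb t))).
    assert (Hcc : forall F a, ana rho F -> 0 < a <= r -> circ_cont a F).
    { intros F a HF Ha. apply (pcont_ana rho); trivial; lra. }
    assert (Hr'r : 0 < r' <= r) by (unfold r1 in Hr; lra).
    (* On r' the means of G and K average to at least La - eta, and each is at most La + eta; so
       each is at least La - 3 eta. *)
    assert (PM := pmean_mult p 1 r' G K Hp Rlt_0_1 (Hcc G r' HG Hr'r) (Hcc K r' HK Hr'r)).
    assert (EGK : forall a, pmean p a (fun z => (G z * K z)%C) = pmean p a k).
    { intros a. unfold pmean, rmean. f_equal. apply RInt_ext. intros t _. now rewrite <- HGK. }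
    rewrite EGK in PM.
    assert (MG := pmean_mono (2 * p) rho r r' G ltac:(lra) HG Hr'r ltac:(lra)).
    assert (MK := pmean_mono (2 * p) rho r r' K ltac:(lra) HK Hr'r ltac:(lra)).
    assert (CG := Hclose r rho G ltac:(lra) ltac:(lra) HG BG ltac:(lra)).
    assert (CK := Hclose r rho K ltac:(lra) ltac:(lra) HK BK ltac:(lra)).
    assert (HGs : ana rho (fun z => G (RtoC s * z)%C)) by (apply ana_dil; trivial; lra).
    assert (HKs : ana rho (fun z => K (RtoC s * z)%C)) by (apply ana_dil; trivial; lra).
    assert (BGs : pmean (2 * p) r (fun z => G (RtoC s * z)%C) <= La + eta).
    { rewrite pmean_dil. eapply Rle_trans; [|exact BG]. apply pmean_mono with rho; trivial; try lra. nra. }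
    set (U1 := fun z => (G z - G (RtoC s * z)%C)%C). set (U2 := fun z => (K z - K (RtoC s * z)%C)%C).
    assert (HU1 : ana rho U1) by (now apply ana_minus). assert (HU2 : ana rho U2) by (now apply ana_minus).
    assert (Half : forall A B, ana rho A -> ana rho B -> pmean (2 * p) r A <= La + eta ->
       pmean (2 * p) r B <= rpow 2 (2 * p) * (5 * eta) ->
       mean_le (Finite p) r (fun z => (A z * B z)%C) (e / 2)).
    { intros A B HA HB MA MB. apply mean_le_fin; try lra. fold e1.
      eapply Rle_trans. apply (pmean_mult p c); trivial; apply Hcc; trivial; lra.
      assert (V1 : c * pmean (2 * p) r A <= e1).
      { apply Rle_trans with (c * (La + 1)). apply Rmult_le_compat_l; lra. right. unfold c. field. lra. }
      assert (V2 : / c * pmean (2 * p) r B <= e1).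
      { apply Rmult_le_reg_l with c; trivial. rewrite <- Rmult_assoc, Rinv_r by lra. lra. }
      lra. }
    apply mean_le_ext with (fun z => (K z * U1 z + G (RtoC s * z)%C * U2 z)%C). lra.
    { intros z _. unfold U1, U2. rewrite (HGK z), (HGK (RtoC s * z)%C). ring. }
    replace e with (e / 2 + e / 2) by field.
    apply mean_le_plus; trivial; try lra.
    - apply circ_cont_mult; apply Hcc; trivial; lra.
    - apply (circ_cont_mult r (fun z => G (RtoC s * z)%C) U2); apply Hcc; trivial; lra.
    - apply Half; trivial.
    - apply (Half (fun z => G (RtoC s * z)%C) U2); trivial. }
  (* Radii below r1 follow from r1 by monotonicity of the means. *)
  intros r Hr. destruct (Rle_dec r1 r) as [Hle|Hlt]. apply Main; lra.
  assert (Hr1 : r1 < 1) by (unfold r1; lra).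
  assert (A := Main r1 ltac:(lra)).
  apply (mean_le_radius (Finite p) 1 r1 (r / r1)) in A; trivial; try lra.
  replace (r / r1 * r1) with r in A by (field; lra). exact A.
  split. apply Rdiv_lt_0_compat; lra. apply Rmult_lt_reg_r with r1. lra.
  unfold Rdiv. rewrite Rmult_assoc, Rinv_l; lra.
Qed.

Definition poly_approx (p : Rbar) (k : C -> C) : Prop :=
  forall e, 0 < e -> exists b n, forall r, 0 < r < 1 -> mean_le p r (fun z => (k z - csum b n z)%C) e.

(** A dilate is analytic on the disc of radius 1 / s > 1, so its Taylor polynomials converge to it
    uniformly on the closed unit disc. *)
Lemma dilation_poly_approx (p : Rbar) (k : C -> C) : Rbar_le 1 p -> ana 1 k ->
  (forall e, 0 < e -> exists s, 0 < s < 1 /\ forall r, 0 < r < 1 ->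
    mean_le p r (fun z => (k z - k (RtoC s * z)%C)%C) e) ->
  poly_approx p k.
Proof.
  intros Hp Hk H e He. destruct (H (e / 2)) as (s & Hs & Hd). lra.
  assert (Hks : ana (/ s) (fun z => k (RtoC s * z)%C)).
  { apply (ana_comp_scal 1); trivial. rewrite Cmod_R, Rabs_right by lra. right; field; lra.
    rewrite Cmod_R, Rabs_right; lra. }
  assert (Hsi : 1 < / s) by (rewrite <- Rinv_1; apply Rinv_lt_contravar; lra).
  destruct (taylor_uniform (/ s) 1 (e / 2) _ Hks) as (b & n & Hb); try lra.
  exists b, n. intros r Hr.
  assert (C1 : circ_cont r k) by (apply (pcont_ana 1); trivial; lra).
  assert (C2 : circ_cont r (fun z => k (RtoC s * z)%C)) by (apply (pcont_ana (/ s)); trivial; lra).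
  assert (C3 : circ_cont r (csum b n)) by (apply (pcont_ana 1); try lra; apply ana_csum).
  apply mean_le_ext with (fun z => ((k z - k (RtoC s * z)%C) + (k (RtoC s * z)%C - csum b n z))%C). lra.
  intros; ring.
  replace e with (e / 2 + e / 2) by field.
  apply mean_le_plus; trivial; try lra. now apply circ_cont_minus.
  now apply (circ_cont_minus r (fun z => k (RtoC s * z)%C) (csum b n)). now apply Hd.
  apply mean_le_sup; trivial. lra. now apply (circ_cont_minus r (fun z => k (RtoC s * z)%C) (csum b n)).
  intros z Hz. apply Hb. lra.
Qed.

Lemma Hp_poly_approx (p N : R) (k : C -> C) : 1 <= p -> ana 1 k ->
  (forall r, 0 < r < 1 -> mean_le (Finite p) r k N) -> poly_approx (Finite p) k.
Proof.
  intros Hp Hk HN. apply dilation_poly_approx; trivial.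
  intros e He. now apply mean_conv with N.
Qed.

(** * Compactness *)

Definition sub_seq (phi : nat -> nat) : Prop := forall n, (phi n < phi (S n))%nat.
Definition cv (u : nat -> C) (l : C) : Prop :=
  forall e, 0 < e -> exists n0, forall n, (n0 <= n)%nat -> Cmod (u n - l) < e.

Lemma sub_seq_ge (phi : nat -> nat) (n : nat) : sub_seq phi -> (n <= phi n)%nat.
Proof. intros H. induction n. lia. specialize (H n). lia. Qed.

Lemma sub_seq_lt (phi : nat -> nat) (n m : nat) : sub_seq phi -> (n < m)%nat -> (phi n < phi m)%nat.
Proof. intros H. induction 1. apply H. specialize (H m). lia. Qed.

Lemma sub_seq_comp (phi psi : nat -> nat) : sub_seq phi -> sub_seq psi -> sub_seq (fun n => phi (psi n)).
Proof. intros H1' H2 n. now apply sub_seq_lt. Qed.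

Lemma cv_comp (u : nat -> C) (l : C) (phi : nat -> nat) : sub_seq phi -> cv u l -> cv (fun n => u (phi n)) l.
Proof.
  intros Hphi H e He. destruct (H e He) as [n0 Hn0]. exists n0. intros n Hn. apply Hn0.
  assert (A := sub_seq_ge phi n Hphi). lia.
Qed.

Lemma inv_S_small (e : R) : 0 < e -> exists n0, forall n, (n0 <= n)%nat -> / (INR n + 1) < e.
Proof.
  intros He. destruct (nfloor_ex (/ e)) as [n0 [_ Hn0]]. apply Rlt_le, Rinv_0_lt_compat; lra.
  exists n0. intros n Hn. apply le_INR in Hn. rewrite <- (Rinv_inv e).
  assert (P := Rinv_0_lt_compat e He). apply Rinv_lt_contravar; [|lra]. apply Rmult_lt_0_compat; lra.
Qed.

Lemma bw_R (u : nat -> R) (B : R) : (forall n, Rabs (u n) <= B) ->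
  exists phi l, sub_seq phi /\ forall e, 0 < e -> exists n0, forall n, (n0 <= n)%nat -> Rabs (u (phi n) - l) < e.
Proof.
  intros HB. destruct (Bolzano_Weierstrass u (fun x => - B <= x <= B)) as [l Hl].
  apply compact_P3. intros n. specialize (HB n). now apply Rabs_le_between.
  assert (Hnear : forall m e, 0 < e -> exists n, (m <= n)%nat /\ Rabs (u n - l) < e).
  { intros m e He. destruct (Hl (disc l (mkposreal e He)) m) as (n & Hn & Hd).
    exists (mkposreal e He). intros x Hx. exact Hx. exists n. split; trivial. }
  destruct (Hnear O 1 Rlt_0_1) as (n0 & _ & Hn0).
  destruct (dep_choice (fun n m => Rabs (u m - l) < / (INR n + 1)) (fun n m m' => (m < m')%nat) n0)
    as (phi & _ & Hphi).
  { simpl. rewrite Rplus_0_l, Rinv_1. exact Hn0. }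
  { intros n x _. destruct (Hnear (S x) (/ (INR (S n) + 1))) as (y & Hy & Hy').
    apply Rinv_0_lt_compat. assert (A := pos_INR (S n)). lra.
    exists y. split; trivial. }
  exists phi, l. split. intros n. apply Hphi.
  intros e He. destruct (inv_S_small e He) as [m Hm]. exists m. intros n Hn.
  eapply Rlt_trans. apply Hphi. now apply Hm.
Qed.

Lemma bw_C (u : nat -> C) (B : R) : (forall n, Cmod (u n) <= B) ->
  exists phi l, sub_seq phi /\ cv (fun n => u (phi n)) l.
Proof.
  intros HB.
  destruct (bw_R (fun n => fst (u n)) B) as (phi & l1 & Hphi & H1').
  { intros n. eapply Rle_trans; [apply re_le_Cmod | apply HB]. }
  destruct (bw_R (fun n => snd (u (phi n))) B) as (psi & l2 & Hpsi & H2).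
  { intros n. eapply Rle_trans; [|apply (HB (phi n))]. eapply Rle_trans; [|apply Rmax_Cmod]. apply Rmax_r. }
  exists (fun n => phi (psi n)), (l1, l2). split. now apply sub_seq_comp.
  intros e He. destruct (H1' (e / 2)) as [n1 Hn1]. lra. destruct (H2 (e / 2)) as [n2 Hn2]. lra.
  exists (max n1 n2). intros n Hn. assert (A := sub_seq_ge psi n Hpsi).
  specialize (Hn1 (psi n) ltac:(lia)). specialize (Hn2 n ltac:(lia)).
  set (v := u (phi (psi n))) in *.
  replace (v - (l1, l2))%C with (RtoC (fst v - l1) + Ci * RtoC (snd v - l2))%C
    by (destruct v; apply injective_projections; simpl; ring).
  eapply Rle_lt_trans. apply Cmod_triangle. rewrite Cmod_mult, Cmod_Ci, !Cmod_R. lra.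
Qed.

Lemma diagonal (u : nat -> nat -> C) (B : R) : (forall j n, Cmod (u j n) <= B) ->
  exists phi, sub_seq phi /\ forall j, exists l, cv (fun n => u j (phi n)) l.
Proof.
  intros HB.
  destruct (dep_choice
    (fun j Phi => sub_seq Phi /\ forall i, (i < j)%nat -> exists l, cv (fun n => u i (Phi n)) l)
    (fun j Phi Phi' => exists psi, sub_seq psi /\ forall n, Phi' n = Phi (psi n)) (fun n => n))
    as (Phi & _ & HPhi).
  { split. intros n; lia. intros i Hi; lia. }
  { intros j Phi [HPhi Hcv]. destruct (bw_C (fun n => u j (Phi n)) B) as (psi & l & Hpsi & Hl).
    intros; apply HB. exists (fun n => Phi (psi n)). split.
    - split. now apply sub_seq_comp. intros i Hi. destruct (Nat.eq_dec i j) as [->|Hn]. now exists l.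
      destruct (Hcv i ltac:(lia)) as [l' Hl']. exists l'. now apply (cv_comp (fun n => u i (Phi n))).
    - now exists psi. }
  assert (Hcomp : forall j m, (j <= m)%nat -> exists psi, sub_seq psi /\ forall n, Phi m n = Phi j (psi n)).
  { intros j m. induction 1 as [|m Hm IH].
    - exists (fun n => n). split; trivial. intros n; lia.
    - destruct IH as (psi & Hpsi & E). destruct (proj2 (HPhi m)) as (psi' & Hpsi' & E').
      exists (fun n => psi (psi' n)). split. now apply sub_seq_comp. intros n. now rewrite E', E. }
  exists (fun n => Phi n n). split.
  - intros n. destruct (proj2 (HPhi n)) as (psi & Hpsi & E). rewrite E.
    apply sub_seq_lt. apply HPhi. assert (A := sub_seq_ge psi (S n) Hpsi). lia.
  - intros j. destruct (proj2 (proj1 (HPhi (S j))) j ltac:(lia)) as [l Hl]. exists l.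
    (* Only from index S j on does the diagonal run inside the subsequence [Phi (S j)], which makes
       u j converge. *)
    intros e He. destruct (Hl e He) as [n0 Hn0]. exists (max n0 (S j)). intros n Hn.
    destruct (Hcomp (S j) n ltac:(lia)) as (psi & Hpsi & E). rewrite E. apply Hn0.
    assert (A := sub_seq_ge psi n Hpsi). lia.
Qed.

(** Cauchy's formula passes to the uniform limit on a circle, so h is the Cauchy transform of its
    own values there. *)
Lemma weierstrass (F : nat -> C -> C) (h : C -> C) : (forall n, ana 1 (F n)) ->
  (forall p, 0 <= p < 1 -> forall e, 0 < e -> exists n0, forall n z, (n0 <= n)%nat -> Cmod z <= p ->
    Cmod (F n z - h z) <= e) -> ana 1 h.
Proof.
  intros HF Hu a Ha. assert (Ha0 := Cmod_ge_0 a). set (R0 := (Cmod a + 1) / 2).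
  assert (HR : 0 < R0 < 1) by (unfold R0; lra). assert (HaR : Cmod a < R0) by (unfold R0; lra).
  assert (Hc : forall t, Cmod (circle_pt R0 t) <= R0) by (intros; rewrite Cmod_circle_pt; lra).
  assert (Hh : pcont (fun t => h (circle_pt R0 t))).
  { intros t. apply ccont_R_eps. intros e He. destruct (Hu R0 ltac:(lra) (e / 4)) as [n Hn]. lra.
    specialize (fun z => Hn n z ltac:(lia)).
    assert (Hcn := pcont_ana 1 R0 (F n) ltac:(lra) (HF n) t).
    rewrite ccont_R_eps in Hcn. destruct (Hcn (e / 4)) as (d & Hd & Hd'). lra.
    exists d. split; trivial. intros y Hy. specialize (Hd' y Hy).
    assert (A := Hn _ (Hc y)). assert (B := Hn _ (Hc t)). rewrite Cmod_minus_sym in A.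
    set (zy := circle_pt R0 y) in *. set (zt := circle_pt R0 t) in *.
    replace (h zy - h zt)%C with ((h zy - F n zy) + ((F n zy - F n zt) + (F n zt - h zt)))%C by ring.
    eapply Rle_lt_trans. apply Cmod_triangle.
    assert (T := Cmod_triangle (F n zy - F n zt) (F n zt - h zt)). lra. }
  set (k := fun t => (h (circle_pt R0 t) * circle_pt R0 t)%C).
  assert (Hk : pcont k) by (apply pcont_mult; trivial; apply pcont_circle).
  assert (E : forall w, Cmod w < R0 -> h w = CT1 R0 k w).
  { intros w Hw. assert (Hwk := pcont_kernel R0 w ltac:(lra) Hw).
    assert (Z : (h w - CT1 R0 k w)%C = RtoC 0).
    { apply Cmod_eq_0. apply Rle_antisym; [|apply Cmod_ge_0]. apply Rle_eps. intros e He. rewrite Rplus_0_l.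
      assert (Hi : 0 < / (R0 - Cmod w)) by (apply Rinv_0_lt_compat; lra).
      set (X := 1 + / (R0 - Cmod w)). assert (HX : 0 < X) by (unfold X; lra).
      destruct (Hu R0 ltac:(lra) (e / X)) as [n Hn]. now apply Rdiv_lt_0_compat.
      specialize (fun z => Hn n z ltac:(lia)).
      set (kn := fun t => (F n (circle_pt R0 t) * circle_pt R0 t)%C).
      assert (Hkn : pcont kn) by (apply (pcont_cauchy_density 1); trivial; lra).
      assert (En : F n w = CT1 R0 kn w) by (apply (cauchy_CT 1); trivial; lra).
      assert (D : Cmod (CT1 R0 kn w - CT1 R0 k w) <= / (R0 - Cmod w) * (e / X)).
      { unfold CT1. rewrite <- cmean_minus by (now apply pcont_mult).
        rewrite (cmean_ext _ (fun t => ((kn t - k t) * / (circle_pt R0 t - w))%C)) by (intros; ring).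
        eapply Rle_trans. apply cmean_mult_bound with (B := / (R0 - Cmod w)); trivial.
        now apply pcont_minus. intros t; apply kernel_bound; lra.
        apply Rmult_le_compat_l. lra. rewrite <- (rmean_const (e / X)).
        apply rmean_le. apply pcont_Cmod; now apply pcont_minus. intros t; apply continuous_const.
        intros t. unfold kn, k.
        replace (F n (circle_pt R0 t) * circle_pt R0 t - h (circle_pt R0 t) * circle_pt R0 t)%C with
          ((F n (circle_pt R0 t) - h (circle_pt R0 t)) * circle_pt R0 t)%C by ring.
        rewrite Cmod_mult, Cmod_circle_pt by lra. assert (A := Hn _ (Hc t)).
        assert (P := Cmod_ge_0 (F n (circle_pt R0 t) - h (circle_pt R0 t))). nra. }
      assert (A := Hn w ltac:(lra)). rewrite En, Cmod_minus_sym in A.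
      replace (h w - CT1 R0 k w)%C with ((h w - CT1 R0 kn w) + (CT1 R0 kn w - CT1 R0 k w))%C by ring.
      eapply Rle_trans. apply Cmod_triangle.
      assert (EX : e / X + / (R0 - Cmod w) * (e / X) = e) by (unfold X; field; unfold X in HX; lra).
      lra. }
    replace (h w) with ((h w - CT1 R0 k w) + CT1 R0 k w)%C by ring. rewrite Z. ring. }
  exists (CT2 R0 k a). apply is_Cder_ext_loc with (f := CT1 R0 k) (d := R0 - Cmod a). lra.
  - intros w Hw. symmetry. apply E. assert (A := Cmod_cont_diff w a). apply Rabs_le_between in A. lra.
  - now apply is_Cder_CT1.
Qed.

Lemma mean_le_pointwise (p : Rbar) (F : C -> C) (B R0 q : R) (z : C) : Rbar_le 1 p -> ana 1 F ->
  0 < R0 < 1 -> q < R0 -> Cmod z <= q -> mean_le p R0 F B -> Cmod (F z) <= R0 / (R0 - q) * B.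
Proof.
  intros Hp HF HR Hq Hz HB. eapply Rle_trans. apply (cauchy_estimate 1 R0 q); trivial; lra.
  apply Rmult_le_compat_l. apply Rmult_le_pos. lra. apply Rlt_le, Rinv_0_lt_compat; lra.
  apply (mean_le_rmean p); trivial. lra. apply (pcont_ana 1); trivial; lra.
Qed.

(** Completeness of H^p: Cauchy's estimate turns closeness of the means into locally uniform
    closeness, which yields an analytic limit h. On each circle, h is then replaced by some F m at
    an arbitrarily small uniform cost. *)
Lemma mean_complete (p : Rbar) (F : nat -> C -> C) : Rbar_le 1 p -> (forall n, ana 1 (F n)) ->
  (forall e, 0 < e -> exists n0, forall n m, (n0 <= n)%nat -> (n0 <= m)%nat ->
     forall r, 0 < r < 1 -> mean_le p r (fun z => (F n z - F m z)%C) e) ->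
  exists h, ana 1 h /\ forall e, 0 < e -> exists n0, forall n, (n0 <= n)%nat ->
     forall r, 0 < r < 1 -> mean_le p r (fun z => (F n z - h z)%C) e.
Proof.
  intros Hp HF HC.
  assert (Hloc : forall q, 0 <= q < 1 -> forall e, 0 < e -> exists n0, forall n m z, (n0 <= n)%nat -> (n0 <= m)%nat ->
     Cmod z <= q -> Cmod (F n z - F m z) <= e).
  { intros q Hq e He. set (R0 := (q + 1) / 2). assert (HR : 0 < R0 < 1) by (unfold R0; lra).
    assert (Hqr : q < R0) by (unfold R0; lra).
    assert (HX : 0 < R0 / (R0 - q)) by (apply Rdiv_lt_0_compat; lra).
    destruct (HC (e / (R0 / (R0 - q)))) as [n0 Hn0]. now apply Rdiv_lt_0_compat.
    exists n0. intros n m z Hn Hm Hz.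
    assert (A := mean_le_pointwise p (fun z => (F n z - F m z)%C) _ R0 q z Hp (ana_minus 1 _ _ (HF n) (HF m)) HR Hqr Hz
      (Hn0 n m Hn Hm R0 HR)). eapply Rle_trans. exact A. right. field. split; lra. }
  (* The pointwise limit; only its values on the open disc are controlled. *)
  set (h := fun z => epsilon (inhabits (RtoC 0)) (fun l => cv (fun n => F n z) l)).
  assert (Hh : forall z, Cmod z < 1 -> cv (fun n => F n z) (h z)).
  { intros z Hz. unfold h. apply epsilon_spec. apply C_cauchy_lim. intros e He.
    destruct (Hloc (Cmod z) (conj (Cmod_ge_0 z) Hz) (e / 2)) as [n0 Hn0]. lra.
    exists n0. intros n m Hn Hm. eapply Rle_lt_trans. apply Hn0; trivial. lra. lra. }
  assert (Hu : forall q, 0 <= q < 1 -> forall e, 0 < e -> exists n0, forall n z, (n0 <= n)%nat -> Cmod z <= q ->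
    Cmod (F n z - h z) <= e).
  { intros q Hq e He. destruct (Hloc q Hq e He) as [n0 Hn0]. exists n0. intros n z Hn Hz.
    apply Rle_eps. intros e' He'. destruct (Hh z ltac:(lra) e' He') as [m0 Hm0].
    specialize (Hm0 (max n0 m0) ltac:(lia)). specialize (Hn0 n (max n0 m0) z Hn ltac:(lia) Hz).
    replace (F n z - h z)%C with ((F n z - F (max n0 m0) z) + (F (max n0 m0) z - h z))%C by ring.
    eapply Rle_trans. apply Cmod_triangle. lra. }
  assert (Hha : ana 1 h) by now apply weierstrass with F.
  exists h. split; trivial. intros e He. destruct (HC e He) as [n0 Hn0]. exists n0. intros n Hn r Hr.
  assert (Cc : forall f, ana 1 f -> circ_cont r f) by (intros; apply (pcont_ana 1); trivial; lra).
  apply mean_le_eps. intros e' He'. destruct (Hu r ltac:(lra) e' He') as [m0 Hm0].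
  set (m := max n0 m0).
  apply mean_le_ext with (fun z => ((F n z - F m z) + (F m z - h z))%C). lra. intros; ring.
  apply mean_le_plus; trivial. lra. apply Cc, ana_minus; trivial. apply Cc, ana_minus; trivial.
  apply Hn0; trivial. unfold m; lia.
  apply mean_le_sup; trivial. lra. apply Cc, ana_minus; trivial.
  intros z Hz. apply Hm0. unfold m; lia. lra.
Qed.

(** * Polynomial kernels and the compactness criterion *)

Lemma unit_bounded_pow (j : nat) : unit_bounded (fun t => (RtoC t ^ j)%C) 1.
Proof.
  split.
  - intros t _. induction j; simpl. apply ccont_const. apply ccont_mult; trivial. apply ccont_RtoC, continuous_id.
  - intros t Ht. rewrite Cmod_pow, Cmod_R, Rabs_right by lra. rewrite <- (pow1 j). apply pow_incr. lra.
Qed.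

Lemma unit_bounded_csum (b : nat -> C) (n : nat) (z : C) : exists B, unit_bounded (fun t => csum b n (RtoC t * z)%C) B.
Proof.
  induction n as [|n [B [HB1 HB2]]]; simpl.
  - exists 0. split. intros t _; apply ccont_const. intros t _. rewrite Cmod_0. lra.
  - destruct (unit_bounded_scal (b n * z ^ n) _ _ (unit_bounded_pow n)) as [G1 G2].
    exists (B + Cmod (b n * z ^ n) * 1). split.
    + intros t Ht. apply ccont_plus; auto.
      apply ccont_ext with (fun t => (b n * z ^ n * RtoC t ^ n)%C).
      intros y. rewrite Cpow_mult_l. ring. now apply G1.
    + intros t Ht. eapply Rle_trans. apply Cmod_triangle. apply Rplus_le_compat; auto.
      rewrite Cpow_mult_l. replace (b n * (t ^ n * z ^ n))%C with (b n * z ^ n * t ^ n)%C by ring. auto.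
Qed.

(** By induction, an operator with polynomial kernel depends on f only through finitely many
    moments: it has finite rank. *)
Lemma kernel_op_csum_S (f : C -> C) (N : R) (b : nat -> C) (n : nat) (z : C) : in_H1 f N ->
  kernel_op (csum b (S n)) f z = (kernel_op (csum b n) f z + b n * z ^ n * unit_int f (fun t => (RtoC t ^ n)%C))%C.
Proof.
  intros Hf. unfold kernel_op. destruct (unit_bounded_csum b n z) as [B HB]. destruct (unit_bounded_csum b (S n) z) as [B' HB'].
  assert (G := unit_bounded_scal (b n * z ^ n) _ _ (unit_bounded_pow n)).
  rewrite <- (unit_int_scal f N 1) by (trivial; apply unit_bounded_pow).
  set (u := fun t : R => csum b (S n) (RtoC t * z)%C) in *.
  set (v := fun t : R => (b n * z ^ n * RtoC t ^ n)%C) in *.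
  assert (E : unit_int f (fun t => csum b n (RtoC t * z)%C) = (unit_int f u - unit_int f v)%C).
  { rewrite <- (unit_int_minus f N _ _ u v Hf HB' G).
    apply (unit_int_ext f N _ _ _ _ Hf HB (unit_bounded_minus _ _ _ _ HB' G)).
    intros t _. unfold u, v. simpl. rewrite Cpow_mult_l. ring. }
  rewrite E. ring.
Qed.

Lemma kernel_op_csum_0 (f : C -> C) (N : R) (b : nat -> C) (z : C) : in_H1 f N -> kernel_op (csum b 0) f z = RtoC 0.
Proof.
  intros Hf. apply Cmod_eq_0. apply Rle_antisym; [|apply Cmod_ge_0].
  replace 0 with (PI * N * 0) by ring. apply (unit_int_bound f N 0); trivial.
  split. intros t _; apply ccont_const. intros t _. simpl. rewrite Cmod_0. lra.
Qed.

Lemma kernel_op_minus_f (k f g : C -> C) (N M : R) (z : C) : in_H1 f N -> in_H1 g M -> ana 1 k -> Cmod z < 1 ->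
  kernel_op k (fun z => (f z - g z)%C) z = (kernel_op k f z - kernel_op k g z)%C.
Proof.
  intros Hf Hg Hk Hz. destruct (ana_est 1 (Cmod z) k Hk (conj (Cmod_ge_0 z) Hz)) as (K & HK & HKe).
  apply (unit_int_minus_f f g N M K); trivial. apply unit_bounded_dil with (Cmod z); trivial; try lra.
  intros w Hw. apply (HKe w w Hw Hw).
Qed.

Lemma kernel_op_minus_k (k l f : C -> C) (N : R) (z : C) : in_H1 f N -> ana 1 k -> ana 1 l -> Cmod z < 1 ->
  kernel_op (fun z => (k z - l z)%C) f z = (kernel_op k f z - kernel_op l f z)%C.
Proof.
  intros Hf Hk Hl Hz. destruct (ana_est 1 (Cmod z) k Hk (conj (Cmod_ge_0 z) Hz)) as (K & HK & HKe).
  destruct (ana_est 1 (Cmod z) l Hl (conj (Cmod_ge_0 z) Hz)) as (L & HL & HLe).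
  apply (unit_int_minus f N K L); trivial; apply unit_bounded_dil with (Cmod z); trivial; try lra.
  intros w Hw. apply (HKe w w Hw Hw). intros w Hw. apply (HLe w w Hw Hw).
Qed.

(** Along a subsequence all moments converge. Splitting k into a polynomial and a remainder of small
    norm, the images form a Cauchy sequence: the polynomial part by the moments, the remainder by
    [kernel_op_mean]. *)
Lemma kernel_op_compact (p : Rbar) (k : C -> C) (Nk : R) : Rbar_le 1 p -> ana 1 k ->
  (forall r, 0 < r < 1 -> mean_le p r k Nk) -> poly_approx p k -> H1_compact p (kernel_op k).
Proof.
  intros Hp Hk HN HA.
  assert (HT : forall f N, in_H1 f N -> Hardy p (kernel_op k f)).
  { intros f N Hf. apply Hardy_intro with (PI * N * Nk). now apply kernel_op_ana with N. now apply kernel_op_mean. }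
  split. { intros f Hf. destruct (H1_Hardy f Hf) as (N & HfN & _). now apply HT with N. }
  intros f K HfK.
  assert (HK : forall n, in_H1 (f n) K).
  { intros n. destruct (HfK n) as [Hf HfN]. destruct (H1_Hardy (f n) Hf) as (N & (A & B & D) & E).
    rewrite E in HfN. simpl in HfN. split; trivial. split. lra. intros r Hr. specialize (D r Hr). lra. }
  assert (HK0 : 0 <= K) by apply (HK O).
  assert (HPI := PI_RGT_0).
  set (mu := fun j n => unit_int (f n) (fun t => (RtoC t ^ j)%C)).
  destruct (diagonal mu (PI * K * 1)) as (phi & Hphi & Hcv).
  { intros j n. apply unit_int_bound; trivial. apply unit_bounded_pow. }
  set (F := fun n => f (phi n)). assert (HF : forall n, in_H1 (F n) K) by (intros; apply HK).
  assert (Hpoly : forall b N e, 0 < e -> exists n0, forall n m z, (n0 <= n)%nat -> (n0 <= m)%nat -> Cmod z <= 1 ->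
     Cmod (kernel_op (csum b N) (fun z => (F n z - F m z)%C) z) <= e).
  { intros b N. induction N as [|N IH]; intros e He.
    - exists O. intros n m z _ _ _. rewrite (kernel_op_csum_0 _ (K + K)). rewrite Cmod_0; lra. now apply H1_minus.
    - destruct (IH (e / 2)) as [n1 Hn1]. lra. destruct (Hcv N) as [l Hl].
      assert (Hb := Cmod_ge_0 (b N)).
      destruct (Hl (e / (4 * (Cmod (b N) + 1)))) as [n2 Hn2]. apply Rdiv_lt_0_compat; lra.
      exists (max n1 n2). intros n m z Hn Hm Hz.
      rewrite (kernel_op_csum_S _ (K + K)) by (now apply H1_minus).
      rewrite (unit_int_minus_f (F n) (F m) K K 1) by (trivial; apply unit_bounded_pow).
      assert (A1 := Hn2 n ltac:(lia)). assert (A2 := Hn2 m ltac:(lia)). cbv beta in A1, A2.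
      assert (A3 := Hn1 n m z ltac:(lia) ltac:(lia) Hz).
      assert (A4 : Cmod (mu N (phi n) - mu N (phi m)) <= e / (2 * (Cmod (b N) + 1))).
      { replace (mu N (phi n) - mu N (phi m))%C with ((mu N (phi n) - l) - (mu N (phi m) - l))%C by ring.
        unfold Cminus at 1. eapply Rle_trans. apply Cmod_triangle. rewrite Cmod_opp.
        replace (e / (2 * (Cmod (b N) + 1))) with (e / (4 * (Cmod (b N) + 1)) + e / (4 * (Cmod (b N) + 1))) by (field; lra).
        lra. }
      eapply Rle_trans. apply Cmod_triangle.
      assert (A5 : Cmod (b N * z ^ N * (mu N (phi n) - mu N (phi m))) <= e / 2).
      { rewrite !Cmod_mult, Cmod_pow.
        assert (Hzp : Cmod z ^ N <= 1).
        { rewrite <- (pow1 N). apply pow_incr. split; trivial. apply Cmod_ge_0. }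
        assert (Hzp0 : 0 <= Cmod z ^ N) by (apply pow_le, Cmod_ge_0).
        apply Rle_trans with ((Cmod (b N) + 1) * (e / (2 * (Cmod (b N) + 1)))).
        apply Rmult_le_compat; trivial. now apply Rmult_le_pos. apply Cmod_ge_0. nra.
        right; field; lra. }
      replace e with (e / 2 + e / 2) by field. apply Rplus_le_compat; [exact A3 | exact A5]. }
  assert (HTF : forall n, ana 1 (kernel_op k (F n))) by (intros n; apply kernel_op_ana with K; trivial).
  destruct (mean_complete p (fun n => kernel_op k (F n)) Hp HTF) as (h & Hh & Hlim).
  (* Differences of the sequence lie in H^1 with bound K + K, so the remainder contributes at most
     PI (K + K) e / (2 X) <= e / 2. *)
  { intros e He. set (X := PI * (K + K) + 1). assert (HX : 0 < X) by (unfold X; nra).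
    destruct (HA (e / (2 * X))) as (b & N & HbN). apply Rdiv_lt_0_compat; lra.
    destruct (Hpoly b N (e / 2)) as [n0 Hn0]. lra.
    exists n0. intros n m Hn Hm r Hr.
    assert (HD : in_H1 (fun z => (F n z - F m z)%C) (K + K)) by now apply H1_minus.
    set (D := fun z => (F n z - F m z)%C) in *.
    set (Q := fun z => (k z - csum b N z)%C) in *.
    assert (Hcs : ana 1 (csum b N)) by apply ana_csum.
    assert (HQ : ana 1 Q) by now apply ana_minus.
    assert (M1 := kernel_op_mean p Q D (K + K) (e / (2 * X)) Hp HD HQ HbN r Hr).
    assert (Hc1 : circ_cont r (kernel_op Q D)) by (apply (pcont_ana 1); [lra | now apply kernel_op_ana with (K + K)]).
    assert (Hc2 : circ_cont r (kernel_op (csum b N) D)) by (apply (pcont_ana 1); [lra | now apply kernel_op_ana with (K + K)]).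
    apply mean_le_ext with (fun z => (kernel_op Q D z + kernel_op (csum b N) D z)%C). lra.
    { intros z Hz. rewrite (kernel_op_minus_k k (csum b N) D (K + K)) by (trivial; lra).
      rewrite <- (kernel_op_minus_f k (F n) (F m) K K) by (trivial; lra). fold D. ring. }
    apply mean_le_mono with (PI * (K + K) * (e / (2 * X)) + e / 2).
    - assert (E : X * (e / (2 * X)) = e / 2) by (field; lra).
      assert (0 < e / (2 * X)) by (apply Rdiv_lt_0_compat; lra). unfold X in E at 1. lra.
    - apply mean_le_plus; trivial. lra. apply mean_le_sup; trivial. lra.
      intros z Hz. apply Hn0; trivial. lra. }
  exists phi, h. split; [exact Hphi|]. split.
  - destruct (Hlim 1 Rlt_0_1) as [n0 Hn0].
    (* h is an image of the sequence minus a difference of mean at most 1. *)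
    apply Hardy_intro with (PI * K * Nk + 1); trivial. intros r Hr.
    assert (Hc1 : circ_cont r (kernel_op k (F n0))) by (apply (pcont_ana 1); [lra | trivial]).
    assert (Hc2 : circ_cont r h) by (apply (pcont_ana 1); [lra | trivial]).
    assert (M0 := Hn0 n0 (le_n _) r Hr).
    assert (M1 := mean_le_scal p r (RtoC (-1)) _ 1 ltac:(lra) Hp (circ_cont_minus r _ _ Hc1 Hc2) M0).
    rewrite Cmod_R in M1. replace (Rabs (-1) * 1) with 1 in M1 by (rewrite Rabs_left; lra).
    apply mean_le_ext with (fun z => (kernel_op k (F n0) z + RtoC (-1) * (kernel_op k (F n0) z - h z))%C). lra.
    intros z _. replace (RtoC (-1)) with (- RtoC 1)%C by (apply injective_projections; simpl; ring). ring.
    apply mean_le_plus; trivial. lra. apply pcont_mult. apply pcont_const. now apply circ_cont_minus.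
    now apply kernel_op_mean.
  - intros e He. destruct (Hlim (e / 2)) as [n0 Hn0]. lra. exists n0. intros n Hn.
    apply Rbar_le_lt_trans with (Finite (e / 2)). apply Hardy_norm_le. intros r Hr. now apply (Hn0 n Hn).
    simpl. lra.
Qed.

(** * The disc algebra and the theorem *)

Lemma mean_le_half (p : Rbar) (r B : R) (k : C -> C) : 0 <= r -> Rbar_le 1 p -> circ_cont r k ->
  mean_le p r (fun z => (2 * k z)%C) B -> mean_le p r k (B / 2).
Proof.
  intros Hr Hp Hk HB.
  assert (Hc : circ_cont r (fun z => (2 * k z)%C)) by (apply pcont_mult; trivial; apply pcont_const).
  assert (M := mean_le_scal p r (RtoC (/ 2)) _ B Hr Hp Hc HB).
  rewrite Cmod_R, Rabs_right in M by lra.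
  replace (B / 2) with (/ 2 * B) by field.
  apply mean_le_ext with (3 := M); trivial. intros z _. rewrite RtoC_inv by lra. field.
Qed.

Lemma Hardy_intro_op (p : Rbar) (k f : C -> C) (N B : R) : Rbar_le 1 p -> in_H1 f N -> ana 1 k ->
  (forall r, 0 < r < 1 -> mean_le p r k B) -> Rbar_le (Hardy_norm p (kernel_op k f)) (Finite (PI * N * B)).
Proof. intros Hp Hf Hk HB. apply Hardy_norm_le. now apply kernel_op_mean. Qed.

Lemma kernel_op_bound_upper (p : Rbar) (k : C -> C) (B : R) : Rbar_le 1 p -> ana 1 k ->
  (forall r, 0 < r < 1 -> mean_le p r k B) -> H1_bound p (kernel_op k) (PI * B).
Proof.
  intros Hp Hk HB f Hf. destruct (H1_Hardy f Hf) as (N & HN & E). rewrite E. simpl.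
  replace (PI * B * N) with (PI * N * B) by ring. now apply Hardy_intro_op.
Qed.

Lemma kernel_op_bound_lower (p : Rbar) (k : C -> C) (K : R) : Rbar_le 1 p -> ana 1 k ->
  H1_bound p (kernel_op k) K -> forall r, 0 < r < 1 -> mean_le p r k (K / 2).
Proof.
  intros Hp Hk HK r Hr.
  assert (Hkc : circ_cont r k) by (apply (pcont_ana 1); trivial; lra).
  apply mean_le_half; trivial; try lra. apply mean_le_eps. intros e He.
  destruct (ftest_conv k r e Hk) as (a & Ha & Hconv); try lra.
  assert (HF := ftest_H1 a Ha).
  destruct (H1_Hardy (ftest a) (proj1 (Hardy_H1 _ _ HF))) as (N & HN & E).
  assert (HN1 : N <= 1).
  { assert (A := proj2 (Hardy_H1 _ _ HF)). rewrite E in A. exact A. }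
  (* K N <= K uses K >= 0. This comes from K N >= 0 once N > 0, and N is positive because f_a(0) = 1
     - a^2 is. *)
  assert (HN0 : 0 < N).
  { assert (Hh : 0 < / 2 < 1) by lra.
    assert (A := cauchy_estimate 1 (/ 2) 0 (ftest a) 0 (ftest_ana a Ha) Hh ltac:(lra) ltac:(rewrite Cmod_0; lra)).
    replace (/ 2 / (/ 2 - 0)) with 1 in A by field. rewrite Rmult_1_l in A.
    assert (B := proj2 (proj2 HN) (/ 2) Hh).
    assert (P : 0 < (1 - a ^ 2) / (1 - a * 0) ^ 2) by (apply Rdiv_lt_0_compat; nra).
    rewrite (ftest_real a 0), Cmod_R, Rabs_right in A by lra. lra. }
  assert (HB := HK (ftest a) (proj1 (Hardy_H1 _ _ HF))). rewrite E in HB. simpl in HB.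
  assert (HB2 := proj1 (Hardy_norm_le p _ _) HB).
  assert (HKN := mean_le_ge0 p r _ _ ltac:(lra) Hp (HB2 r Hr)).
  assert (HK0 : 0 <= K). { apply Rmult_le_reg_r with N; lra. }
  assert (HT : ana 1 (kernel_op k (ftest a))) by (apply kernel_op_ana with N; trivial).
  assert (HTc : circ_cont r (kernel_op k (ftest a))) by (apply (pcont_ana 1); trivial; lra).
  assert (H2c : circ_cont r (fun z => (2 * k z)%C)) by (apply pcont_mult; trivial; apply pcont_const).
  apply mean_le_ext with (fun z => (kernel_op k (ftest a) z + (2 * k z - kernel_op k (ftest a) z))%C). lra. intros; ring.
  apply mean_le_plus; trivial; try lra. now apply (circ_cont_minus r (fun z => (2 * k z)%C)).
  apply mean_le_mono with (K * N). nra. now apply HB2.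
  apply mean_le_sup; trivial. lra. now apply (circ_cont_minus r (fun z => (2 * k z)%C)).
  intros z Hz. rewrite Cmod_minus_sym. apply Hconv; lra.
Qed.

Definition a_seq (n : nat) : R := 1 - / (INR n + 1).

Lemma a_seq_range (n : nat) : 0 <= a_seq n < 1.
Proof.
  unfold a_seq. assert (P := pos_INR n). assert (Q : 0 < / (INR n + 1)) by (apply Rinv_0_lt_compat; lra).
  assert (/ (INR n + 1) <= / 1) by (apply Rinv_le_contravar; lra). rewrite Rinv_1 in H. lra.
Qed.

Lemma a_seq_cv (e : R) : 0 < e -> exists n0, forall n, (n0 <= n)%nat -> 1 - e <= a_seq n.
Proof.
  intros He. destruct (inv_S_small e He) as [n0 H]. exists n0. intros n Hn. specialize (H n Hn).
  unfold a_seq. lra.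
Qed.

(* Test functions: along a convergent subsequence of the images of [ftest (a_seq n)] the limit is [2 k]. *)
Lemma compact_limit (p : Rbar) (k : C -> C) : Rbar_le 1 p -> ana 1 k -> H1_compact p (kernel_op k) ->
  exists N, (forall r, 0 < r < 1 -> mean_le p r k N) /\
  forall e, 0 < e -> exists a, 0 <= a < 1 /\
    forall r, 0 < r < 1 -> mean_le p r (fun z => (kernel_op k (ftest a) z - 2 * k z)%C) e.
Proof.
  intros Hp Hk [_ HC].
  destruct (HC (fun n => ftest (a_seq n)) 1) as (phi & h & Hphi & Hh & Hlim).
  { intros n. apply Hardy_H1, ftest_H1, a_seq_range. }
  assert (Hha : ana 1 h) by apply Hh.
  assert (HTa : forall a, 0 <= a < 1 -> ana 1 (kernel_op k (ftest a))).
  { intros a Ha. apply kernel_op_ana with 1; trivial. now apply ftest_H1. }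
  assert (Hlim' : forall e, 0 < e -> exists n0, forall n, (n0 <= n)%nat -> forall r, 0 < r < 1 ->
    mean_le p r (fun z => (kernel_op k (ftest (a_seq (phi n))) z - h z)%C) e).
  { intros e He. destruct (Hlim e He) as [n0 Hn0]. exists n0. intros n Hn. apply Hardy_norm_le.
    apply Rbar_lt_le. now apply Hn0. }
  (* Convergence of the means implies pointwise convergence, and there [ftest_conv] identifies the
     limit. *)
  assert (E : forall z, Cmod z < 1 -> h z = (2 * k z)%C).
  { intros z Hz. assert (Hz0 := Cmod_ge_0 z). set (R0 := (Cmod z + 1) / 2).
    assert (HR : 0 < R0 < 1) by (unfold R0; lra). assert (HzR : Cmod z < R0) by (unfold R0; lra).
    assert (Z : (h z - 2 * k z)%C = RtoC 0).
    { apply Cmod_eq_0. apply Rle_antisym; [|apply Cmod_ge_0]. apply Rle_eps. intros e He. rewrite Rplus_0_l.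
      set (X := R0 / (R0 - Cmod z)). assert (HX : 0 < X) by (apply Rdiv_lt_0_compat; lra).
      destruct (Hlim' (e / (2 * X))) as [n1 Hn1]. apply Rdiv_lt_0_compat; lra.
      destruct (ftest_conv k (Cmod z) (e / 2) Hk) as (a0 & Ha0 & Hconv); try lra.
      destruct (a_seq_cv (1 - a0)) as [n2 Hn2]. lra.
      set (n := max n1 n2). assert (Hn := sub_seq_ge phi n Hphi).
      assert (A1 := Hconv (a_seq (phi n)) z). assert (Ra := a_seq_range (phi n)).
      assert (Rb := Hn2 (phi n) ltac:(unfold n in *; lia)). specialize (A1 ltac:(lra) ltac:(lra)).
      assert (A2 := mean_le_pointwise p (fun z => (kernel_op k (ftest (a_seq (phi n))) z - h z)%C) _ R0 (Cmod z) z Hp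
        (ana_minus 1 _ _ (HTa _ Ra) Hha) HR HzR (Rle_refl _) (Hn1 n ltac:(unfold n; lia) R0 HR)).
      cbv beta in A2. fold X in A2. replace (X * (e / (2 * X))) with (e / 2) in A2 by (field; lra).
      set (T := kernel_op k (ftest (a_seq (phi n))) z) in *.
      replace (h z - 2 * k z)%C with ((T - 2 * k z) - (T - h z))%C by ring.
      unfold Cminus at 1. eapply Rle_trans. apply Cmod_triangle. rewrite Cmod_opp. lra. }
    replace (h z) with ((h z - 2 * k z) + 2 * k z)%C by ring. rewrite Z. ring. }
  destruct (Hardy_finite p h Hp Hh) as (N & HN & _ & HNh).
  exists (N / 2). split.
  - intros r Hr. apply mean_le_half; trivial; try lra. apply (pcont_ana 1); trivial; lra.
    apply mean_le_ext with (3 := HNh r Hr). lra. intros z Hz. apply E. lra.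
  - intros e He. destruct (Hlim' e He) as [n0 Hn0]. exists (a_seq (phi n0)). split. apply a_seq_range.
    intros r Hr. apply mean_le_ext with (3 := Hn0 n0 (le_n _) r Hr). lra.
    intros z Hz. cbv beta. rewrite E; trivial. lra.
Qed.

(** * Uniform continuity on the disc and the disc algebra *)

Definition disc_ucont (k : C -> C) : Prop :=
  forall e, 0 < e -> exists d, 0 < d /\ forall z w, Cmod z < 1 -> Cmod w < 1 -> Cmod (z - w) < d ->
    Cmod (k z - k w) <= e.

(** Boundedness of k suffices. For t <= s < 1 the points t z stay in the disc of radius s, where k
    is Lipschitz; the integral over [s, 1) is small uniformly in z because k is bounded. *)
Lemma kernel_op_disc_ucont (k f : C -> C) (N B : R) : in_H1 f N -> ana 1 k ->
  (forall z, Cmod z < 1 -> Cmod (k z) <= B) -> disc_ucont (kernel_op k f).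
Proof.
  intros Hf Hk HB e He. assert (HPI := PI_RGT_0). assert (HN : 0 <= N) by apply Hf.
  assert (HB0 : 0 <= B) by (eapply Rle_trans; [apply Cmod_ge_0 | apply (HB 0); rewrite Cmod_0; lra]).
  destruct (unit_int_tail f N (e / (4 * (B + 1))) Hf) as (s & Hs & Htail). apply Rdiv_lt_0_compat; lra.
  destruct (ana_est 1 s k Hk Hs) as (K & HK & HKe).
  set (X := PI * N * K + 1). assert (HPN : 0 <= PI * N) by (apply Rmult_le_pos; lra).
  assert (HX : 0 < X) by (unfold X; nra).
  exists (e / (2 * X)). split. apply Rdiv_lt_0_compat; lra.
  intros z w Hz Hw Hzw.
  assert (G : forall x, Cmod x < 1 -> unit_bounded (fun t => k (RtoC t * x)%C) B).
  { intros x Hx. split. apply unit_cont_dil; trivial; lra. intros t Ht. apply HB.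
    apply Rle_lt_trans with (Cmod x); trivial. apply Cmod_tz; lra. }
  set (T := fun x => CInt (fun t => (f (RtoC t) * k (RtoC t * x))%C) 0 s).
  assert (HT : forall x, Cmod x < 1 -> Cmod (T x - kernel_op k f x) <= e / 4).
  { intros x Hx. destruct (G x Hx) as [G1 G2]. eapply Rle_trans. apply (Htail _ B s G1 G2). lra.
    apply Rle_trans with ((B + 1) * (e / (4 * (B + 1)))). apply Rmult_le_compat_r; [|lra].
    apply Rlt_le, Rdiv_lt_0_compat; lra. right; field; lra. }
  assert (HD : Cmod (T z - T w) <= e / 2).
  { assert (Hfu := unit_cont_ana f (proj1 Hf)).
    unfold T. rewrite <- CInt_minus by (apply unit_cont_ex; try lra; apply unit_cont_mult; trivial; now apply G).
    apply Rle_trans with (RInt (fun t => K * Cmod (z - w) * Cmod (f (RtoC t))) 0 s).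
    - apply CInt_norm. lra.
      apply (ex_RInt_minus (V := C_R_NormedModule)); apply unit_cont_ex; try lra; apply unit_cont_mult; trivial; now apply G.
      apply (ex_RInt_scal (V := R_NormedModule)). apply (unit_cont_ex_mod (fun t => f (RtoC t))); trivial; lra.
      intros t Ht. replace (f t * k (t * z)%C - f t * k (t * w)%C)%C with (f t * (k (t * z)%C - k (t * w)%C))%C by ring.
      rewrite Cmod_mult, Rmult_comm. apply Rmult_le_compat_r. apply Cmod_ge_0.
      assert (Hs1 : forall x, Cmod x < 1 -> Cmod (t * x) <= s).
      { intros x Hx. rewrite Cmod_mult, Cmod_R, Rabs_right by lra. assert (P := Cmod_ge_0 x). nra. }
      destruct (HKe _ _ (Hs1 w Hw) (Hs1 z Hz)) as (_ & Q & _). eapply Rle_trans. exact Q.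
      apply Rmult_le_compat_l; trivial. replace (t * z - t * w)%C with (t * (z - w))%C by ring.
      apply Cmod_tz; lra.
    - rewrite (RInt_scal (V := R_CompleteNormedModule)).
      2: apply (unit_cont_ex_mod (fun t => f (RtoC t))); trivial; lra.
      unfold scal; simpl; unfold mult; simpl.
      assert (A := H1_int f N s Hf Hs). assert (P := Cmod_ge_0 (z - w)).
      assert (P2 := Rmult_le_pos _ _ HK P).
      apply Rle_trans with (K * Cmod (z - w) * (PI * N)). now apply Rmult_le_compat_l.
      apply Rle_trans with (X * (e / (2 * X))). 2: right; field; lra.
      apply Rle_trans with (X * Cmod (z - w)). unfold X. nra. apply Rmult_le_compat_l; lra. }
  assert (A1 := HT z Hz). assert (A2 := HT w Hw). rewrite Cmod_minus_sym in A1.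
  replace (kernel_op k f z - kernel_op k f w)%C with ((kernel_op k f z - T z) + ((T z - T w) + (T w - kernel_op k f w)))%C by ring.
  eapply Rle_trans. apply Cmod_triangle.
  assert (U := Cmod_triangle (T z - T w) (T w - kernel_op k f w)). lra.
Qed.

Lemma mean_le_inf_disc (f : C -> C) (B : R) : ana 1 f ->
  (forall r, 0 < r < 1 -> mean_le p_infty r f B) -> forall z, Cmod z < 1 -> Cmod (f z) <= B.
Proof.
  intros Hf H z Hz. assert (Hz0 := Cmod_ge_0 z). destruct (Req_dec (Cmod z) 0) as [E|E].
  - apply Cmod_eq_0 in E. subst z. assert (Hh : 0 < / 2 < 1) by lra.
    assert (A := mean_le_pointwise p_infty f B (/ 2) 0 0 I Hf Hh ltac:(lra) ltac:(rewrite Cmod_0; lra) (H _ Hh)).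
    replace (/ 2 / (/ 2 - 0)) with 1 in A by field. lra.
  - assert (A := H (Cmod z) ltac:(lra)). rewrite mean_le_inf in A. now apply A.
Qed.

Lemma compact_disc_ucont (k : C -> C) : ana 1 k -> H1_compact p_infty (kernel_op k) -> disc_ucont k.
Proof.
  intros Hk HC. destruct (compact_limit p_infty k I Hk HC) as (N & HN & Hlim).
  intros e He. destruct (Hlim (e / 2)) as (a & Ha & Hconv). lra.
  assert (HF := ftest_H1 a Ha).
  assert (HT : ana 1 (kernel_op k (ftest a))) by now apply kernel_op_ana with 1.
  assert (H2k : ana 1 (fun z => (2 * k z)%C)) by (apply ana_mult; trivial; apply ana_const).
  assert (Hd := mean_le_inf_disc _ _ (ana_minus 1 _ _ HT H2k) Hconv). cbv beta in Hd.
  destruct (kernel_op_disc_ucont k (ftest a) 1 N HF Hk (mean_le_inf_disc k N Hk HN) e He) as (d & Hd0 & Hu).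
  exists d. split; trivial. intros z w Hz Hw Hzw.
  assert (A1 := Hd z Hz). assert (A2 := Hd w Hw). assert (A3 := Hu z w Hz Hw Hzw).
  set (T := kernel_op k (ftest a)) in *. rewrite Cmod_minus_sym in A1.
  assert (A : Cmod (2 * (k z - k w)) <= 2 * e).
  { replace (2 * (k z - k w))%C with ((2 * k z - T z) + ((T z - T w) + (T w - 2 * k w)))%C by ring.
    eapply Rle_trans. apply Cmod_triangle.
    assert (U := Cmod_triangle (T z - T w) (T w - 2 * k w)). lra. }
  rewrite Cmod_mult, Cmod_R, Rabs_right in A by lra. lra.
Qed.

Lemma cv_unique (u : nat -> C) (l m : C) : cv u l -> cv u m -> l = m.
Proof.
  intros Hl Hm. assert (E : (l - m)%C = RtoC 0).
  { apply Cmod_eq_0. apply Rle_antisym; [|apply Cmod_ge_0]. apply Rle_eps. intros e He.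
    destruct (Hl (e / 2)) as [n1 Hn1]. lra. destruct (Hm (e / 2)) as [n2 Hn2]. lra.
    specialize (Hn1 (max n1 n2) ltac:(lia)). specialize (Hn2 (max n1 n2) ltac:(lia)).
    set (x := u (max n1 n2)) in *. replace (l - m)%C with ((x - m) - (x - l))%C by ring.
    unfold Cminus at 1. eapply Rle_trans. apply Cmod_triangle. rewrite Cmod_opp. lra. }
  replace l with ((l - m) + m)%C by ring. rewrite E. ring.
Qed.

Lemma Cmod_a_seq (n : nat) (z : C) : Cmod z <= 1 -> Cmod (RtoC (a_seq n) * z) < 1.
Proof.
  intros Hz. assert (A := a_seq_range n). rewrite Cmod_mult, Cmod_R, Rabs_right by lra.
  assert (P := Cmod_ge_0 z). nra.
Qed.

(** F z is the limit of k at the points [a_seq n * z], which are interior also for |z| = 1; uniform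
    continuity makes them Cauchy and carries over to F. *)
Lemma disc_ucont_extension (k : C -> C) : disc_ucont k ->
  exists F, (forall z, Cmod z < 1 -> F z = k z) /\
  forall e, 0 < e -> exists d, 0 < d /\ forall z w, Cmod z <= 1 -> Cmod w <= 1 -> Cmod (z - w) < d ->
    Cmod (F z - F w) <= e.
Proof.
  intros Hu.
  set (F := fun z => epsilon (inhabits (RtoC 0)) (fun l => cv (fun n => k (RtoC (a_seq n) * z)%C) l)).
  assert (HF : forall z, Cmod z <= 1 -> cv (fun n => k (RtoC (a_seq n) * z)%C) (F z)).
  { intros z Hz. unfold F. apply epsilon_spec. apply C_cauchy_lim. intros e He.
    destruct (Hu (e / 2)) as (d & Hd & Hk). lra.
    destruct (a_seq_cv (d / 2)) as [n0 Hn0]. lra. exists n0. intros n m Hn Hm.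
    apply Rle_lt_trans with (e / 2); [|lra]. apply Hk; try (now apply Cmod_a_seq).
    replace (a_seq n * z - a_seq m * z)%C with (RtoC (a_seq n - a_seq m) * z)%C by (rewrite RtoC_minus; ring).
    rewrite Cmod_mult, Cmod_R. assert (A := Hn0 n Hn). assert (B := Hn0 m Hm).
    assert (A1 := a_seq_range n). assert (B1 := a_seq_range m). assert (P := Cmod_ge_0 z).
    assert (Q : Rabs (a_seq n - a_seq m) <= d / 2) by (apply Rabs_le; lra).
    assert (Q0 := Rabs_pos (a_seq n - a_seq m)). nra. }
  exists F. split.
  - intros z Hz. apply (cv_unique _ _ _ (HF z ltac:(lra))). intros e He.
    destruct (Hu (e / 2)) as (d & Hd & Hk). lra.
    destruct (a_seq_cv (d / 2)) as [n0 Hn0]. lra. exists n0. intros n Hn.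
    apply Rle_lt_trans with (e / 2); [|lra]. apply Hk; trivial. apply Cmod_a_seq; lra.
    replace (a_seq n * z - z)%C with (RtoC (a_seq n - 1) * z)%C by (rewrite RtoC_minus; ring).
    rewrite Cmod_mult, Cmod_R. assert (A := Hn0 n Hn). assert (A1 := a_seq_range n).
    assert (P := Cmod_ge_0 z). rewrite Rabs_left by lra. nra.
  - intros e He. destruct (Hu (e / 2)) as (d & Hd & Hk). lra. exists d. split; trivial.
    intros z w Hz Hw Hzw. apply Rle_eps. intros e' He'.
    destruct (HF z Hz (e' / 2)) as [n1 Hn1]. lra. destruct (HF w Hw (e' / 2)) as [n2 Hn2]. lra.
    set (n := max n1 n2). specialize (Hn1 n ltac:(unfold n; lia)). specialize (Hn2 n ltac:(unfold n; lia)).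
    set (x := k (a_seq n * z)%C) in *. set (y := k (a_seq n * w)%C) in *.
    assert (D : Cmod (x - y) <= e / 2).
    { apply Hk; try (now apply Cmod_a_seq).
      replace (a_seq n * z - a_seq n * w)%C with (RtoC (a_seq n) * (z - w))%C by ring.
      eapply Rle_lt_trans; [|exact Hzw]. apply Cmod_tz. assert (A := a_seq_range n). lra. lra. }
    rewrite Cmod_minus_sym in Hn1.
    replace (F z - F w)%C with ((F z - x) + ((x - y) + (y - F w)))%C by ring.
    eapply Rle_trans. apply Cmod_triangle.
    assert (U := Cmod_triangle (x - y) (y - F w)). lra.
Qed.

Lemma continuous_on_disc_eps (F : C -> C) (z : C) :
  continuous_on (fun z : C => Cmod z <= 1) F -> Cmod z <= 1 ->
  forall e, 0 < e -> exists d, 0 < d /\ forall w, Cmod w <= 1 -> Cmod (w - z) < d -> Cmod (F w - F z) < e.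
Proof.
  intros HF Hz e He. assert (He2 : 0 < e / 2) by lra.
  destruct (HF z Hz _ (locally_ball (F z) (mkposreal _ He2))) as [d Hd].
  exists d. split. apply cond_pos. intros w Hw Hwz.
  assert (A := Hd w (C_ball_Cmod _ _ _ Hwz) Hw). apply Cmod_C_ball in A. simpl in A. lra.
Qed.

Lemma continuous_on_disc_intro (F : C -> C) :
  (forall e, 0 < e -> exists d, 0 < d /\ forall z w, Cmod z <= 1 -> Cmod w <= 1 -> Cmod (z - w) < d ->
    Cmod (F z - F w) <= e) ->
  continuous_on (fun z : C => Cmod z <= 1) F.
Proof.
  intros H z Hz P [e HP]. assert (He := cond_pos e). destruct (H (e / 2)) as (d & Hd & H1'). lra.
  assert (Hd2 : 0 < d / 2) by lra. exists (mkposreal _ Hd2). intros w Hw Hw1. apply HP, C_ball_Cmod.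
  apply Cmod_C_ball in Hw. simpl in Hw. apply Rle_lt_trans with (e / 2); [|lra]. apply H1'; trivial. lra.
Qed.

(* Heine's theorem on the closed disc, by Bolzano-Weierstrass. *)
Lemma continuous_on_disc_ucont (F : C -> C) : continuous_on (fun z : C => Cmod z <= 1) F -> disc_ucont F.
Proof.
  intros HF e He. apply NNPP. intros Hn.
  assert (Hbad : forall n, exists zw : C * C, Cmod (fst zw) < 1 /\ Cmod (snd zw) < 1 /\
    Cmod (fst zw - snd zw) < / (INR n + 1) /\ e < Cmod (F (fst zw) - F (snd zw))).
  { intros n. apply NNPP. intros Hn'. apply Hn. exists (/ (INR n + 1)). split.
    apply Rinv_0_lt_compat. assert (P := pos_INR n). lra.
    intros z w Hz Hw Hzw. apply Rnot_lt_le. intros Hlt. apply Hn'. exists (z, w). now repeat split. }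
  destruct (choice _ Hbad) as [zw Hzw].
  destruct (bw_C (fun n => fst (zw n)) 1) as (phi & l & Hphi & Hl).
  { intros n. apply Rlt_le, Hzw. }
  assert (Hl1 : Cmod l <= 1).
  { apply Rle_eps. intros e' He'. destruct (Hl e' He') as [n0 Hn0]. specialize (Hn0 n0 (le_n _)).
    assert (A := Cmod_cont_diff (fst (zw (phi n0))) l). apply Rabs_le_between in A.
    assert (B := proj1 (Hzw (phi n0))). lra. }
  destruct (continuous_on_disc_eps F l HF Hl1 (e / 2)) as (d & Hd & Hc). lra.
  destruct (Hl (d / 2)) as [n1 Hn1]. lra. destruct (inv_S_small (d / 2)) as [n2 Hn2]. lra.
  set (n := max n1 n2). specialize (Hn1 n ltac:(unfold n; lia)).
  assert (A := sub_seq_ge phi n Hphi). specialize (Hn2 (phi n) ltac:(unfold n in *; lia)).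
  destruct (Hzw (phi n)) as (Z1 & Z2 & Z3 & Z4). set (z := fst (zw (phi n))) in *. set (w := snd (zw (phi n))) in *.
  assert (C1 := Hc z ltac:(lra) ltac:(lra)).
  assert (C2 : Cmod (F w - F l) < e / 2).
  { apply Hc. lra. replace (w - l)%C with ((z - l) - (z - w))%C by ring. unfold Cminus at 1.
    eapply Rle_lt_trans. apply Cmod_triangle. rewrite Cmod_opp. lra. }
  replace (F z - F w)%C with ((F z - F l) - (F w - F l))%C in Z4 by ring. unfold Cminus at 1 in Z4.
  assert (U := Cmod_triangle (F z - F l) (- (F w - F l))). rewrite Cmod_opp in U. lra.
Qed.

Lemma disc_ucont_poly_approx (k : C -> C) : ana 1 k -> disc_ucont k -> poly_approx p_infty k.
Proof.
  intros Hk Hu. apply dilation_poly_approx; trivial. exact I.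
  intros e He. destruct (Hu e He) as (d & Hd & H).
  set (x := Rmin (/ 2) (d / 2)). assert (Hx : 0 < x) by (unfold x; apply Rmin_glb_lt; lra).
  assert (Hx1 : x <= / 2) by apply Rmin_l. assert (Hx2 : x <= d / 2) by apply Rmin_r.
  exists (1 - x). split. lra. intros r Hr. apply mean_le_inf. intros z Hz.
  apply H. lra. rewrite Cmod_mult, Cmod_R, Rabs_right by lra. nra.
  replace (z - (1 - x)%R * z)%C with (RtoC x * z)%C by (rewrite RtoC_minus; ring).
  rewrite Cmod_mult, Cmod_R, Rabs_right by lra. nra.
Qed.

Lemma H1_bounded_Hardy (p : Rbar) (k : C -> C) : Rbar_le 1 p -> ana 1 k ->
  H1_bounded p (kernel_op k) <-> Hardy p k.
Proof.
  intros Hp Hk. split.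
  - intros [K HK]. apply Hardy_intro with (K / 2); trivial. now apply kernel_op_bound_lower.
  - intros H. destruct (Hardy_finite p k Hp H) as (N & _ & _ & HN). exists (PI * N).
    now apply kernel_op_bound_upper.
Qed.

Lemma H1_compact_Hardy (p : Rbar) (k : C -> C) : Rbar_le 1 p -> ana 1 k ->
  H1_compact p (kernel_op k) -> Hardy p k.
Proof.
  intros Hp Hk HC. destruct (compact_limit p k Hp Hk HC) as (N & HN & _).
  now apply Hardy_intro with N.
Qed.

Theorem theorem3 (g : C -> C) (hg : analytic_on_disc g) :
  (forall p : R, 1 <= p ->
     (H1_bounded (Finite p) (hilbert_op g) <->
      H1_compact (Finite p) (hilbert_op g)) /\
     (H1_compact (Finite p) (hilbert_op g) <->
      Hardy (Finite p) (C_derive g))) /\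
  (H1_bounded p_infty (hilbert_op g) <-> Hardy p_infty (C_derive g)) /\
  (H1_compact p_infty (hilbert_op g) <-> disc_algebra (C_derive g)) /\
  (forall p : Rbar, Rbar_le (Finite 1) p ->
     Rbar_le (Rbar_mult (Finite 2) (Hardy_norm p (C_derive g)))
             (H1_op_norm p (hilbert_op g)) /\
     Rbar_le (H1_op_norm p (hilbert_op g))
             (Rbar_mult (Finite PI) (Hardy_norm p (C_derive g)))).
Proof.
  (* By conversion; g itself does not appear below this point except through its derivative k. *)
  change (hilbert_op g) with (kernel_op (C_derive g)).
  assert (Hk : ana 1 (C_derive g)) by exact (ana_C_derive 1 g hg).
  set (k := C_derive g) in *.
  split; [|split; [|split]].
  - intros p Hp.
    assert (HB := H1_bounded_Hardy (Finite p) k Hp Hk).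
    assert (HC : H1_compact (Finite p) (kernel_op k) <-> Hardy (Finite p) k).
    { split. now apply H1_compact_Hardy.
      intros H. destruct (Hardy_finite (Finite p) k Hp H) as (N & _ & _ & HN).
      apply kernel_op_compact with N; trivial. now apply Hp_poly_approx with N. }
    tauto.
  - apply H1_bounded_Hardy; trivial. exact I.
  - split.
    + intros HC. split. apply H1_compact_Hardy; trivial. exact I.
      destruct (disc_ucont_extension k (compact_disc_ucont k Hk HC)) as (F & HF1 & HF2).
      exists F. split; trivial. now apply continuous_on_disc_intro.
    + intros [H (F & HF & HFk)].
      destruct (Hardy_finite p_infty k I H) as (N & _ & _ & HN).
      apply kernel_op_compact with N; trivial. exact I. apply disc_ucont_poly_approx; trivial.
      intros e He. destruct (continuous_on_disc_ucont F HF e He) as (d & Hd & Hu).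
      exists d. split; trivial. intros z w Hz Hw. rewrite <- !HFk by trivial. now apply Hu.
  - intros p Hp. unfold H1_op_norm.
    destruct (Glb_Rbar_correct (H1_bound p (kernel_op k))) as [G1 G2]. assert (HPI := PI_RGT_0).
    assert (H0 := Hardy_norm_ge0 p k Hp). split.
    (* The lower estimate is checked for every admissible K; if there is none, the infimum is
       [p_infty] and the check is vacuous. *)
    + apply G2. intros K HK.
      assert (B := proj2 (Hardy_norm_le p k (K / 2)) (kernel_op_bound_lower p k K Hp Hk HK)).
      destruct (Hardy_norm p k) as [x| |]; simpl in B, H0; try contradiction. simpl. lra.
    + destruct (Hardy_norm p k) as [x| |] eqn:E; simpl in H0; try contradiction.
      * apply G1. simpl. apply kernel_op_bound_upper; trivial. apply Hardy_norm_le. rewrite E. apply Rbar_le_refl.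
      (* When g' is not in H^p the upper estimate is PI times infinity, which is infinite because PI
         > 0. *)
      * replace (Rbar_mult PI p_infty) with p_infty.
        destruct (Glb_Rbar _); exact I.
        unfold Rbar_mult, Rbar_mult'.
        destruct (Rle_dec 0 PI) as [Hle|Hle]; [|lra].
        destruct (Rle_lt_or_eq_dec 0 PI Hle); [reflexivity | lra].
Qed.
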